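(* Let $(u,v,P)$ solve the linearized system (with right-hand sides $f,g$ and boundary conditions) given in the context. Then for $\delta\in[0,1]$ and $\varepsilon\ll\theta_0$, $$\|u\|_A^2\lesssim\theta_0\|v\|_B^2+\delta\theta_0\|P\|_{L^2_{*,\delta}}^2+\|f\|_{L^2_{*,2+\delta}}^2+\varepsilon\|g\|_{L^2_{*,2+\delta}}^2,$$ with an implicit constant independent of $\varepsilon$, of small $\theta_0$, and of $(u,v,P,f,g)$.
   Context: Geometry. $R_0>0$, $\theta_0>0$ small, $0<\varepsilon\le1$, $\Omega=(0,\theta_0)\times(R_0,\infty)\ni(\omega,R)$; $r=r(R)=R_0+\sqrt\varepsilon(R-R_0)$; $\iint=\int_0^{\theta_0}\int_{R_0}^\infty\cdot\,dR\,d\omega$. Functions with subscript $e$ are functions of $(\omega,r)$, all others of $(\omega,R)$. Norms. $\|h\|_{L^2_{*,\kappa}}^2=\iint h^2r^\kappa$; $\|u\|_A^2=\iint(u_R^2r^{1+\delta}+\varepsilon u_\omega^2r^{-1+\delta}+\varepsilon u^2r^{-1+\delta})$; $\|v\|_B^2=\iint(r^\delta|\partial_R(rv)|^2+\varepsilon v_\omega^2r^\delta+\varepsilon v^2r^\delta)$. Linearized system: $\frac1ru_su_\omega+\frac1ru_{s\omega}u+u_{sR}v+v_su_R+\frac{\sqrt\varepsilon}rv_su+\frac{\sqrt\varepsilon}ru_sv+\frac1rP_\omega-u_{RR}-\frac{\sqrt\varepsilon}ru_R-\frac\varepsilon{r^2}u_{\omega\omega}+\frac\varepsilon{r^2}u-\frac{2\varepsilon^{3/2}}{r^2}v_\omega=f$,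 $\frac1ru_sv_\omega+\frac1rv_{s\omega}u+v_sv_R+v_{sR}v-\frac2r\frac1{\sqrt\varepsilon}u_su+\frac1\varepsilon P_R-v_{RR}-\frac{\sqrt\varepsilon}rv_R-\frac\varepsilon{r^2}v_{\omega\omega}+\frac{2\sqrt\varepsilon}{r^2}u_\omega+\frac\varepsilon{r^2}v=g$, $\frac1ru_\omega+\frac{\sqrt\varepsilon}rv+v_R=0$ (i.e. $u_\omega+\partial_R(rv)=0$), with $u=v=0$ on $\{\omega=0\}$ and $\{R=R_0\}$, and $\varepsilon v_\omega+ru_R=0$, $Pr=2\varepsilon u_\omega$ on $\{\omega=\theta_0\}$. Solutions are regular and decay as $R\to\infty$ so that the norms involved make sense. Profiles. $u_s=u_e^0+u_p^0+\sqrt\varepsilon u_e^1$, $v_s=v_p^0+v_e^1$, constructed from the following data. $u_b>0$ constant; $u_e^0=u_e^0(r)$ smooth, bounded below by a positive constant, with $\partial_r^ku_e^0$ ($k\ge1$) exponentially decaying; $u_e:=u_e^0(R_0)$; $\bar u_0(R),u_b^1(r),V_{b0}(r),V_{b1}(r)$ smooth with exponential decay (with derivatives); $\min\{u_b,\inf_R(u_e+\bar u_0)\}>0$; $|V_{b0}-V_{b1}|+|\partial_r(V_{b0}-V_{b1})|\lesssim\theta_0$; $V_{b0}(R_0)=-v_p^0(0,R_0)$, $V_{b1}(R_0)=-v_p^0(\theta_0,R_0)$. Prandtl-0: $(u_e+u_p^0)u^0_{p\omega}+(rv_p^0-R_0v_p^0(\omega,R_0))u^0_{pR}=R_0u^0_{pRR}$,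 $rv_p^0=\int_R^\infty u^0_{p\omega}$, $u_p^0(\omega,R_0)=u_b-u_e$, $u_p^0(0,R)=\bar u_0(R)$, $u_p^0\to0$ as $R\to\infty$. Euler-1: $Lv=-r\Delta v+(\frac{ru^0_{err}}{u_e^0}+\frac{u^0_{er}}{u_e^0})v-2v_r-\frac2rv$, $\Delta=\partial_r^2+\frac1r\partial_r+\frac1{r^2}\partial_\omega^2$; $\mathcal B=(1-\frac\omega{\theta_0})\frac{v_p^0(\omega,R_0)}{v_p^0(0,R_0)}V_{b0}(r)+\frac\omega{\theta_0}\frac{v_p^0(\omega,R_0)}{v_p^0(\theta_0,R_0)}V_{b1}(r)$; $F=L\mathcal B$; $E_b=\chi_0(\frac\omega\varepsilon)F(0,r)+\chi_0(\frac{\theta_0-\omega}\varepsilon)F(\theta_0,r)$, $\chi_0$ a smooth cutoff supported in $[0,1]$, equal to $1$ near $0$. $Lv_e^1=E_b$, $v_e^1(\omega,R_0)=-v_p^0(\omega,R_0)$, $v_e^1(0,r)=V_{b0}$, $v_e^1(\theta_0,r)=V_{b1}$, $v_e^1\to0$ as $r\to\infty$; $u_e^1=u_b^1(r)-\int_0^\omega\partial_r(rv_e^1)d\omega'$. *)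

(* Defs.v *)
From Stdlib Require Export Reals.
From Coquelicot Require Export Coquelicot.
Open Scope R_scope.

(* Conventions.  A function of (omega,R) or of (omega,r) is a function
   [h w y], resp. [h w r], with the angle [w] first; [y] is the stretched
   variable R.  A function that is C^k up to the boundary of a closed domain is
   represented by a C^k extension to the whole line or plane (extensions exist
   for all the domains below).  Equations, bounds and boundary conditions are
   imposed only on the original domain, so two-sided derivatives at its boundary
   points are the one-sided ones. *)

Definition d1 (h : R -> R -> R) (w y : R) : R := Derive (fun t => h t y) w.
Definition d2 (h : R -> R -> R) (w y : R) : R := Derive (fun t => h w t) y.

Definition smooth (f : R -> R) : Prop := forall n x, ex_derive_n f n x.

Definition class_C (k : nat) (h : R -> R -> R) : Prop :=
  forall w y, ex_diff_n h k w y.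

Definition exp_decay_by (R0 : R) (K a : nat -> R) (f : R -> R) : Prop :=
  forall k r, R0 <= r -> Rabs (Derive_n f k r) <= K k * exp (- (a k * r)).

Definition exp_decay (R0 : R) (f : R -> R) : Prop :=
  exists K a, (forall k, 0 < a k) /\ exp_decay_by R0 K a f.

Definition rad (R0 eps y : R) : R := R0 + sqrt eps * (y - R0).

(* The double integral over (0,theta0) x (R0,+oo), as the limit of integrals over
   bounded rectangles.  It is only applied to nonnegative continuous integrands,
   for which it always exists in [0,+oo]. *)
Definition iint (R0 theta0 : R) (h : R -> R -> R) : Rbar :=
  Lim (fun N => RInt (fun w => RInt (fun y => h w y) R0 N) 0 theta0) p_infty.

Definition normL2 (R0 theta0 eps kappa : R) (h : R -> R -> R) : Rbar :=
  iint R0 theta0 (fun w y => h w y ^ 2 * Rpower (rad R0 eps y) kappa).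

Definition normA2 (R0 theta0 eps delta : R) (u : R -> R -> R) : Rbar :=
  iint R0 theta0 (fun w y =>
    let r := rad R0 eps y in
      d2 u w y ^ 2 * Rpower r (1 + delta)
    + eps * d1 u w y ^ 2 * Rpower r (-1 + delta)
    + eps * u w y ^ 2 * Rpower r (-1 + delta)).

Definition normB2 (R0 theta0 eps delta : R) (v : R -> R -> R) : Rbar :=
  iint R0 theta0 (fun w y =>
    let r := rad R0 eps y in
      Rpower r delta * d2 (fun w' y' => rad R0 eps y' * v w' y') w y ^ 2
    + eps * d1 v w y ^ 2 * Rpower r delta
    + eps * v w y ^ 2 * Rpower r delta).

(* Data that do not depend on theta0 and epsilon.  The cutoff chi0 is a function
   on the half-line [0,+oo). *)
Record profile_data (R0 ub : R) (ue0 ubar0 ub1 chi0 : R -> R) : Prop := {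
  pd_R0 : 0 < R0;
  pd_ue0_smooth : smooth ue0;
  pd_ue0_pos : exists m, 0 < m /\ forall r, R0 <= r -> m <= ue0 r;
  pd_ue0_decay : exp_decay R0 (Derive ue0);
  pd_ubar0_smooth : smooth ubar0;
  pd_ubar0_decay : exp_decay R0 ubar0;
  pd_ub1_smooth : smooth ub1;
  pd_ub1_decay : exp_decay R0 ub1;
  pd_ub_pos : 0 < ub;
  pd_inflow_pos : exists m, 0 < m /\ forall y, R0 <= y -> m <= ue0 R0 + ubar0 y;
  pd_chi0_smooth : smooth chi0;
  pd_chi0_near0 : exists eta, 0 < eta /\ forall t, 0 <= t <= eta -> chi0 t = 1;
  pd_chi0_supp : forall t, 1 < t -> chi0 t = 0
}.

(* The product r * v_p^0, which does not depend on epsilon. *)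
Definition rvp (up : R -> R -> R) (w y : R) : R :=
  RInt_gen (fun y' => d1 up w y') (at_point y) (Rbar_locally p_infty).

Definition vp (R0 eps : R) (up : R -> R -> R) (w y : R) : R :=
  rvp up w y / rad R0 eps y.

(* v_p^0(omega,R0), which does not depend on epsilon either since r(R0) = R0. *)
Definition vpw (R0 : R) (up : R -> R -> R) (w : R) : R := rvp up w R0 / R0.

(* The Prandtl-0 problem on (0,thetabar) x (R0,+oo).  The convergence u_p^0 -> 0
   is required in the class of smooth, rapidly decreasing profiles: some decay of
   the omega-derivatives is needed for v_p^0 and L(B) to be defined.  The decay
   also holds for the extension in omega, so that v_p^0(omega,R0) is smooth
   across omega = 0. *)
Record prandtl0 (R0 ub thetabar : R) (ue0 ubar0 : R -> R) (up : R -> R -> R)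
  : Prop := {
  p0_smooth : forall k, class_C k up;
  p0_decay : forall i j n : nat, exists M, forall w y, R0 <= y ->
    Rabs (partial_derive i j up w y) * (1 + y) ^ n <= M;
  p0_eq : forall w y, 0 < w < thetabar -> R0 < y ->
    (ue0 R0 + up w y) * d1 up w y
    + (rvp up w y - R0 * vpw R0 up w) * d2 up w y
    = R0 * d2 (d2 up) w y;
  p0_wall : forall w, 0 <= w <= thetabar -> up w R0 = ub - ue0 R0;
  p0_inflow : forall y, R0 <= y -> up 0 y = ubar0 y
}.

(* Side data of the Euler-1 problem.  They depend on theta0 (through their values
   at R0), hence the bounds K, a, K1 that are fixed before theta0. *)
Record euler_side_data (R0 theta0 : R) (up : R -> R -> R)
    (K a : nat -> R) (K1 : R) (Vb0 Vb1 : R -> R) : Prop := {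
  sd_smooth0 : smooth Vb0;
  sd_smooth1 : smooth Vb1;
  sd_decay0 : exp_decay_by R0 K a Vb0;
  sd_decay1 : exp_decay_by R0 K a Vb1;
  sd_close : forall r, R0 <= r ->
    Rabs (Vb0 r - Vb1 r) + Rabs (Derive (fun r' => Vb0 r' - Vb1 r') r)
    <= K1 * theta0;
  sd_corner0 : Vb0 R0 = - vpw R0 up 0;
  sd_corner1 : Vb1 R0 = - vpw R0 up theta0
}.

Definition laplace_polar (v : R -> R -> R) (w r : R) : R :=
  d2 (d2 v) w r + / r * d2 v w r + / r ^ 2 * d1 (d1 v) w r.

Definition eulerL (ue0 : R -> R) (v : R -> R -> R) (w r : R) : R :=
  - r * laplace_polar v w r
  + (r * Derive_n ue0 2 r / ue0 r + Derive ue0 r / ue0 r) * v w r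
  - 2 * d2 v w r - 2 / r * v w r.

Definition eulerB (R0 theta0 : R) (up : R -> R -> R) (Vb0 Vb1 : R -> R)
    (w r : R) : R :=
  (1 - w / theta0) * (vpw R0 up w / vpw R0 up 0) * Vb0 r
  + w / theta0 * (vpw R0 up w / vpw R0 up theta0) * Vb1 r.

Definition eulerF (R0 theta0 : R) (ue0 : R -> R) (up : R -> R -> R)
    (Vb0 Vb1 : R -> R) (w r : R) : R :=
  eulerL ue0 (eulerB R0 theta0 up Vb0 Vb1) w r.

Definition eulerE (R0 theta0 eps : R) (ue0 chi0 : R -> R) (up : R -> R -> R)
    (Vb0 Vb1 : R -> R) (w r : R) : R :=
  chi0 (w / eps) * eulerF R0 theta0 ue0 up Vb0 Vb1 0 r
  + chi0 ((theta0 - w) / eps) * eulerF R0 theta0 ue0 up Vb0 Vb1 theta0 r.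

(* Classical solutions of the Euler-1 problem; they are C^2 up to the corners but
   in general not smooth there. *)
Record euler1 (R0 theta0 eps : R) (ue0 chi0 : R -> R) (up : R -> R -> R)
    (Vb0 Vb1 : R -> R) (ve : R -> R -> R) : Prop := {
  e1_C2 : class_C 2 ve;
  e1_smooth : forall k w r, 0 < w < theta0 -> R0 < r -> ex_diff_n ve k w r;
  e1_eq : forall w r, 0 < w < theta0 -> R0 < r ->
    eulerL ue0 ve w r = eulerE R0 theta0 eps ue0 chi0 up Vb0 Vb1 w r;
  e1_wall : forall w, 0 <= w <= theta0 -> ve w R0 = - vpw R0 up w;
  e1_side0 : forall r, R0 <= r -> ve 0 r = Vb0 r;
  e1_side1 : forall r, R0 <= r -> ve theta0 r = Vb1 r;
  e1_infty : forall eta, 0 < eta -> exists M, forall w r,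
    0 <= w <= theta0 -> R0 <= r -> M <= r -> Rabs (ve w r) <= eta
}.

Definition ue1 (ub1 : R -> R) (ve : R -> R -> R) (w r : R) : R :=
  ub1 r - RInt (fun w' => d2 (fun w'' r' => r' * ve w'' r') w' r) 0 w.

Definition us (R0 eps : R) (ue0 ub1 : R -> R) (up ve : R -> R -> R) (w y : R)
  : R :=
  ue0 (rad R0 eps y) + up w y + sqrt eps * ue1 ub1 ve w (rad R0 eps y).

Definition vs (R0 eps : R) (up ve : R -> R -> R) (w y : R) : R :=
  vp R0 eps up w y + ve w (rad R0 eps y).

Record linearized_system (R0 theta0 eps : R) (Us Vs u v P f g : R -> R -> R)
  : Prop := {
  ls_u : class_C 2 u;
  ls_v : class_C 2 v;
  ls_P : class_C 1 P;
  ls_eq_u : forall w y, 0 < w < theta0 -> R0 < y ->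
    let r := rad R0 eps y in
    / r * Us w y * d1 u w y + / r * d1 Us w y * u w y
    + d2 Us w y * v w y + Vs w y * d2 u w y
    + sqrt eps / r * Vs w y * u w y + sqrt eps / r * Us w y * v w y
    + / r * d1 P w y
    - d2 (d2 u) w y - sqrt eps / r * d2 u w y - eps / r ^ 2 * d1 (d1 u) w y
    + eps / r ^ 2 * u w y - 2 * (eps * sqrt eps) / r ^ 2 * d1 v w y
    = f w y;
  ls_eq_v : forall w y, 0 < w < theta0 -> R0 < y ->
    let r := rad R0 eps y in
    / r * Us w y * d1 v w y + / r * d1 Vs w y * u w y
    + Vs w y * d2 v w y + d2 Vs w y * v w y
    - 2 / r * / sqrt eps * Us w y * u w y
    + / eps * d2 P w y
    - d2 (d2 v) w y - sqrt eps / r * d2 v w y - eps / r ^ 2 * d1 (d1 v) w y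
    + 2 * sqrt eps / r ^ 2 * d1 u w y + eps / r ^ 2 * v w y
    = g w y;
  ls_div : forall w y, 0 < w < theta0 -> R0 < y ->
    let r := rad R0 eps y in
    / r * d1 u w y + sqrt eps / r * v w y + d2 v w y = 0;
  ls_inflow : forall y, R0 <= y -> u 0 y = 0 /\ v 0 y = 0;
  ls_wall : forall w, 0 <= w <= theta0 -> u w R0 = 0 /\ v w R0 = 0;
  ls_outflow_shear : forall y, R0 <= y ->
    eps * d1 v theta0 y + rad R0 eps y * d2 u theta0 y = 0;
  ls_outflow_normal : forall y, R0 <= y ->
    P theta0 y * rad R0 eps y = 2 * eps * d1 u theta0 y
}.

(* Main.v *)
Require Import Defs.
From Stdlib Require Import Lra Lia Psatz.

(** Test the first equation with [u r^(1+delta)] and the second one with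
    [eps v r^(1+delta)].  Since [u_omega = - (r v)_R] and [u = v = 0] at the inflow,
    Poincare's inequality in the thin angle bounds [u] and [sqrt eps v] by
    [theta0] times the B-norm of [v], so that every term which is quadratic in them
    may carry a factor [1 / theta0]; the convection by [u_s] contributes a
    nonnegative outflow term, the viscous outflow terms cancel through the stress
    conditions, and [u_p] is absorbed by Hardy's inequality in [R].  Only the
    integrability of the norms is known at infinity, hence the flux through [R = N]
    is made small along a sequence.

    The uniform bounds [|v_e| <= C / r], [|(r v_e)_r| <= C / (theta0 r)] needed for
    the profiles come from the maximum principle: in the variables
    [(omega, ln r)], [r v_e] solves a Poisson equation with a bounded zero order
    term, which is harmless in a thin strip, and odd reflection in [ln r]
    together with linear barriers bounds the gradient. *)

(** Two derivatives of the Euler correction get no uniform bound: v^1_{e omega}, and the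
    R-derivative of u_e^1, which contains second derivatives of v_e while the source E_b varies on
    the scale eps. Both multiply the product u v and are integrated by parts: the fluxes contain
    [e * Q * u * v] and [e ^ 2 * Z * u * v], so that only Q = u_e^1 and Z = v_e^1 - V_{b1} have to
    be bounded. Subtracting V_{b1} changes no omega-derivative and makes Z vanish at the outflow,
    where the boundary term would have no sign.

    In the work of the pressure the divergence condition cancels everything but the derivative of
    the weight r^delta; this is the origin of the factor delta in front of P.

    The omega-part of the A-norm is not taken from the viscosity: u_omega = - (r v)_R bounds it by
    eps times the B-norm, which is one of the places where eps <= theta0 is used. *)

(** * Joint continuity of functions of two real variables *)

Lemma continuity_2d_pt_fst (f : R -> R) w y :
  continuity_pt f w -> continuity_2d_pt (fun s _ => f s) w y.
Proof.
  intros H. apply (continuity_1d_2d_pt_comp f (fun s _ => s)); [exact H|].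
  apply continuity_2d_pt_id1.
Qed.

Lemma continuity_2d_pt_snd (f : R -> R) w y :
  continuity_pt f y -> continuity_2d_pt (fun _ t => f t) w y.
Proof.
  intros H. apply (continuity_1d_2d_pt_comp f (fun _ t => t)); [exact H|].
  apply continuity_2d_pt_id2.
Qed.

Lemma continuity_2d_pt_pow (h : R -> R -> R) n w y :
  continuity_2d_pt h w y -> continuity_2d_pt (fun s t => h s t ^ n) w y.
Proof.
  intros H. induction n as [|n IH]; simpl.
  - apply continuity_2d_pt_const.
  - apply continuity_2d_pt_mult; assumption.
Qed.

Lemma continuity_2d_pt_scal k (h : R -> R -> R) w y :
  continuity_2d_pt h w y -> continuity_2d_pt (fun s t => k * h s t) w y.
Proof. apply continuity_2d_pt_mult, continuity_2d_pt_const. Qed.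

Lemma continuity_2d_pt_div (g h : R -> R -> R) w y :
  continuity_2d_pt g w y -> continuity_2d_pt h w y -> h w y <> 0 ->
  continuity_2d_pt (fun s t => g s t / h s t) w y.
Proof.
  intros Hg Hh H. unfold Rdiv. apply continuity_2d_pt_mult; [exact Hg|].
  now apply continuity_2d_pt_inv.
Qed.

Lemma continuity_2d_pt_comp (h : R -> R -> R) (f g : R -> R) w y :
  continuity_2d_pt h (f w) (g y) -> continuity_pt f w -> continuity_pt g y ->
  continuity_2d_pt (fun s t => h (f s) (g t)) w y.
Proof.
  intros Hh Hf Hg e. destruct (Hh e) as [d Hd].
  assert (Hf2 := continuity_2d_pt_fst f w y Hf).
  assert (Hg2 := continuity_2d_pt_snd g w y Hg).
  destruct (Hf2 d) as [d1 H1]. destruct (Hg2 d) as [d2 H2].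
  exists (mkposreal _ (Rmin_stable_in_posreal d1 d2)); simpl. intros u v Hu Hv.
  apply Hd.
  - apply (H1 u v); eapply Rlt_le_trans; try eassumption;
      [apply Rmin_l | apply Rmin_l].
  - apply (H2 u v); eapply Rlt_le_trans; try eassumption;
      [apply Rmin_r | apply Rmin_r].
Qed.

Lemma continuity_2d_pt_continuous1 (h : R -> R -> R) w y :
  continuity_2d_pt h w y -> continuous (fun s => h s y) w.
Proof.
  intros H. apply continuity_pt_filterlim. intros e He.
  destruct (H (mkposreal e He)) as [d Hd].
  exists d; split; [apply cond_pos|]. intros x [_ Hx].
  apply Hd; [exact Hx|]. rewrite Rminus_diag, Rabs_R0. apply cond_pos.
Qed.

Lemma continuity_2d_pt_continuous2 (h : R -> R -> R) w y :
  continuity_2d_pt h w y -> continuous (fun t => h w t) y.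
Proof.
  intros H. apply continuity_pt_filterlim. intros e He.
  destruct (H (mkposreal e He)) as [d Hd].
  exists d; split; [apply cond_pos|]. intros x [_ Hx].
  apply Hd; [|exact Hx]. rewrite Rminus_diag, Rabs_R0. apply cond_pos.
Qed.

Lemma is_derive_continuity_pt (f : R -> R) x l :
  is_derive f x l -> continuity_pt f x.
Proof.
  intros H. apply continuity_pt_filterlim.
  apply (ex_derive_continuous (K := R_AbsRing) (V := R_NormedModule)). now exists l.
Qed.

Lemma is_derive_Derive (f : R -> R) x l : is_derive f x l -> Derive (fun t => f t) x = l.
Proof. apply is_derive_unique. Qed.

Lemma locally_interval (P : R -> Prop) a b x :
  a < x < b -> (forall z, a < z < b -> P z) -> locally x P.
Proof.
  intros Hx H. assert (Hd : 0 < Rmin (x - a) (b - x)) by (apply Rmin_glb_lt; lra).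
  exists (mkposreal _ Hd). intros z Hz. apply Rabs_def2 in Hz. simpl in Hz.
  unfold minus, plus, opp in Hz; simpl in Hz.
  assert (H1 := Rmin_l (x - a) (b - x)). assert (H2 := Rmin_r (x - a) (b - x)).
  apply H. lra.
Qed.

(** * Integrals over rectangles *)

Lemma RInt_zero (f : R -> R) a b : a <= b -> (forall x, a < x < b -> f x = 0) -> RInt f a b = 0.
Proof.
  intros Hab H. rewrite (RInt_ext f (fun _ => 0)).
  - rewrite RInt_const. apply Rmult_0_r.
  - intros x Hx. rewrite Rmin_left, Rmax_right in Hx by lra. now apply H.
Qed.


Lemma ex_RInt_cont (f : R -> R) a b :
  (forall x, Rmin a b <= x <= Rmax a b -> continuous f x) -> ex_RInt f a b.
Proof. intros H. now apply (ex_RInt_continuous (V := R_CompleteNormedModule)). Qed.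

(** Continuity is two-sided, at [y = a] as well, and holds for every real [w]: the functions are
    given by extensions, so the edges of a rectangle need no one-sided limits. *)
Definition cont_strip (a : R) (h : R -> R -> R) : Prop :=
  forall w y, a <= y -> continuity_2d_pt h w y.

Lemma cont_strip_ex_RInt a h w b N :
  cont_strip a h -> a <= b -> a <= N -> ex_RInt (h w) b N.
Proof.
  intros H Hb HN. apply ex_RInt_cont. intros x [Hx _].
  apply continuity_2d_pt_continuous2, H.
  eapply Rle_trans; [|exact Hx]. now apply Rmin_glb.
Qed.

Lemma continuous_RInt_param a h N w :
  cont_strip a h -> a <= N -> continuous (fun s => RInt (h s) a N) w.
Proof.
  intros H HN. apply continuity_pt_filterlim. intros e He.
  (* The added 1 covers the degenerate case [N = a]; the factor 2 keeps the final inequality strict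
     although the integral bound is a weak one. *)
  assert (He' : 0 < e / (2 * (N - a + 1))) by (apply Rdiv_lt_0_compat; lra).
  destruct (uniform_continuity_2d_1d' h a N w) with (eps := mkposreal _ He')
    as [d Hd]; [intros; apply H; lra|].
  exists d; split; [apply cond_pos|]. intros x [_ Hx]. simpl in Hx |- *.
  unfold Rdist in *.
  assert (Hx' := Rabs_def2 _ _ Hx).
  assert (E : RInt (h x) a N - RInt (h w) a N
              = RInt (fun y => h x y - h w y) a N).
  { symmetry. apply (RInt_minus (V := R_CompleteNormedModule));
      now apply cont_strip_ex_RInt with a; try lra. }
  rewrite E.
  eapply Rle_lt_trans.
  - apply abs_RInt_le_const with (M := e / (2 * (N - a + 1))); [exact HN| |].
    + apply @ex_RInt_minus; now apply cont_strip_ex_RInt with a; try lra.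
    + intros t Ht. left.
      apply (Hd t w t x); try lra; rewrite Rminus_diag, Rabs_R0; apply cond_pos.
  - apply Rmult_lt_reg_r with (2 * (N - a + 1)); [lra|].
    field_simplify; [|lra]. nra.
Qed.

Definition rint2 (th a N : R) (h : R -> R -> R) : R :=
  RInt (fun w => RInt (fun y => h w y) a N) 0 th.

Lemma ex_rint2 th a N h :
  cont_strip a h -> a <= N -> ex_RInt (fun w => RInt (fun y => h w y) a N) 0 th.
Proof. intros. apply ex_RInt_cont. intros. now apply continuous_RInt_param. Qed.

Lemma rint2_plus th a N g h :
  cont_strip a g -> cont_strip a h -> a <= N ->
  rint2 th a N (fun w y => g w y + h w y) = rint2 th a N g + rint2 th a N h.
Proof.
  intros Hg Hh HN. unfold rint2.
  rewrite <- (RInt_plus (V := R_CompleteNormedModule)) by now apply ex_rint2.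
  apply RInt_ext. intros w _.
  apply (RInt_plus (V := R_CompleteNormedModule)); apply cont_strip_ex_RInt with a;
    (assumption || lra).
Qed.

Lemma rint2_scal th a N k h :
  cont_strip a h -> a <= N ->
  rint2 th a N (fun w y => k * h w y) = k * rint2 th a N h.
Proof.
  intros Hh HN. unfold rint2.
  rewrite <- (RInt_scal (V := R_CompleteNormedModule)) by now apply ex_rint2.
  apply RInt_ext. intros w _.
  apply (RInt_scal (V := R_CompleteNormedModule)); apply cont_strip_ex_RInt with a;
    (assumption || lra).
Qed.

Lemma rint2_le th a N g h :
  cont_strip a g -> cont_strip a h -> a <= N -> 0 <= th ->
  (forall w y, 0 < w < th -> a < y < N -> g w y <= h w y) ->
  rint2 th a N g <= rint2 th a N h.
Proof.
  intros Hg Hh HN Hth H. unfold rint2. apply RInt_le; try now apply ex_rint2.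
  - exact Hth.
  - intros w Hw. apply RInt_le; try (apply cont_strip_ex_RInt with a; (assumption||lra)).
    + exact HN.
    + intros y Hy. now apply H.
Qed.

Lemma rint2_ext th a N g h :
  a <= N -> 0 <= th ->
  (forall w y, 0 < w < th -> a < y < N -> g w y = h w y) ->
  rint2 th a N g = rint2 th a N h.
Proof.
  intros HN Hth H. unfold rint2. apply RInt_ext. intros w Hw.
  rewrite Rmin_left, Rmax_right in Hw by lra.
  apply RInt_ext. intros y Hy. rewrite Rmin_left, Rmax_right in Hy by lra.
  now apply H.
Qed.

Lemma rint2_nonneg th a N h :
  cont_strip a h -> a <= N -> 0 <= th ->
  (forall w y, 0 < w < th -> a < y < N -> 0 <= h w y) -> 0 <= rint2 th a N h.
Proof.
  intros Hh HN Hth H.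
  replace 0 with (rint2 th a N (fun _ _ => 0 * 0)).
  - apply rint2_le; try assumption.
    + intros w y _. apply continuity_2d_pt_const.
    + intros; rewrite Rmult_0_l; now apply H.
  - rewrite rint2_scal; [ring| |exact HN]. intros w y _. apply continuity_2d_pt_const.
Qed.


Lemma mvt_abs (f df : R -> R) x y :
  (forall z, Rmin x y <= z <= Rmax x y -> is_derive f z (df z)) ->
  exists z, Rmin x y <= z <= Rmax x y /\ f y - f x = df z * (y - x).
Proof.
  intros H. destruct (MVT_gen f x y df) as [z Hz].
  - intros z Hz. apply H. lra.
  - intros z Hz. now apply is_derive_continuity_pt with (df z), H.
  - now exists z.
Qed.

(** The mean value theorem replaces the difference quotient by a value of [hw] at a nearby
    parameter, and continuity of [hw] along the segment [s = w] makes this uniform in [y]. The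
    hypotheses are local in the parameter, so that the moving edge [N > a] of a rectangle can later
    serve as the parameter. *)
Lemma is_derive_RInt_par (h hw : R -> R -> R) a b w (d0 : posreal) :
  a <= b ->
  (forall s y, Rabs (s - w) < d0 -> a <= y <= b ->
     is_derive (fun s => h s y) s (hw s y)) ->
  (forall y, a <= y <= b -> continuity_2d_pt hw w y) ->
  (forall s, Rabs (s - w) < d0 -> ex_RInt (h s) a b) ->
  is_derive (fun s => RInt (h s) a b) w (RInt (hw w) a b).
Proof.
  intros Hab Hd Hc Hi. apply is_derive_Reals. intros e He.
  assert (He' : 0 < e / (2 * (b - a + 1))) by (apply Rdiv_lt_0_compat; lra).
  destruct (uniform_continuity_2d_1d' hw a b w Hc (mkposreal _ He')) as [d Hu].
  assert (Hiw : ex_RInt (hw w) a b).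
  { apply ex_RInt_cont. intros y Hy. rewrite Rmin_left, Rmax_right in Hy by lra.
    now apply continuity_2d_pt_continuous2, Hc. }
  assert (Hw0 : Rabs (w - w) < d0) by (rewrite Rminus_diag, Rabs_R0; apply cond_pos).
  exists (mkposreal _ (Rmin_stable_in_posreal d0 d)). simpl. intros k Hk0 Hk.
  assert (Hk1 : Rabs (w + k - w) < d0).
  { replace (w + k - w) with k by ring. eapply Rlt_le_trans; [exact Hk|apply Rmin_l]. }
  assert (Hk2 : Rabs k < d) by (eapply Rlt_le_trans; [exact Hk|apply Rmin_r]).
  assert (E : (RInt (h (w + k)) a b - RInt (h w) a b) / k - RInt (hw w) a b
     = RInt (fun y => (h (w + k) y - h w y) / k - hw w y) a b).
  { symmetry.
    rewrite (RInt_minus (V := R_CompleteNormedModule) (fun y => (h (w + k) y - h w y) / k)).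
    - f_equal. unfold Rdiv. rewrite (RInt_ext _ (fun y => scal (/ k) (minus (h (w + k) y) (h w y)))).
      + rewrite (RInt_scal (V := R_CompleteNormedModule)).
        * rewrite (RInt_minus (V := R_CompleteNormedModule)) by now apply Hi.
          unfold scal, minus, plus, opp; simpl; unfold mult; simpl. ring.
        * apply @ex_RInt_minus; now apply Hi.
      + intros y _. unfold scal, minus, plus, opp; simpl; unfold mult; simpl.
        unfold Rminus; ring.
    - apply ex_RInt_ext with (fun y => scal (/ k) (minus (h (w + k) y) (h w y))).
      + intros y _. unfold scal, minus, plus, opp; simpl; unfold mult; simpl. unfold Rminus, Rdiv. ring.
      + apply @ex_RInt_scal, @ex_RInt_minus; now apply Hi.
    - exact Hiw. }
  rewrite E.
  eapply Rle_lt_trans.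
  - apply abs_RInt_le_const with (M := e / (2 * (b - a + 1))); [exact Hab| |].
    + apply ex_RInt_ext with (fun y => minus (scal (/ k) (minus (h (w + k) y) (h w y))) (hw w y)).
      * intros y _. unfold scal, minus, plus, opp; simpl; unfold mult; simpl. unfold Rminus, Rdiv. ring.
      * apply @ex_RInt_minus; [|exact Hiw].
        apply @ex_RInt_scal, @ex_RInt_minus; now apply Hi.
    + intros y Hy.
      assert (Hz : forall z, Rmin w (w + k) <= z <= Rmax w (w + k) -> Rabs (z - w) <= Rabs k).
      { intros z Hz. unfold Rmin, Rmax in Hz. unfold Rabs.
        destruct (Rle_dec w (w + k)); destruct (Rcase_abs (z - w)); destruct (Rcase_abs k); lra. }
      destruct (mvt_abs (fun s => h s y) (fun s => hw s y) w (w + k)) as [z [Hz1 Hz2]].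
      { intros z Hz1. apply Hd; [|exact Hy]. apply Rle_lt_trans with (Rabs k); [now apply Hz|].
        replace k with (w + k - w) by ring. exact Hk1. }
      rewrite Hz2. replace (hw z y * (w + k - w) / k - hw w y) with (hw z y - hw w y) by (field; exact Hk0).
      left. assert (Hz3 := Hz z Hz1).
      assert (Hz4 := Rabs_def2 (z - w) d (Rle_lt_trans _ _ _ Hz3 Hk2)).
      apply (Hu y w y z); destruct Hz4; assert (Hdp := cond_pos d); try lra.

      * rewrite Rminus_diag, Rabs_R0; apply cond_pos.
  - apply Rmult_lt_reg_r with (2 * (b - a + 1)); [lra|].
    field_simplify; [|lra]. nra.
Qed.

Lemma is_derive_RInt_strip a h hw N w :
  (forall w y, a <= y -> is_derive (fun s => h s y) w (hw w y)) ->
  cont_strip a h -> cont_strip a hw -> a <= N ->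
  is_derive (fun s => RInt (h s) a N) w (RInt (hw w) a N).
Proof.
  intros Hd Hh Hhw HN. apply is_derive_RInt_par with (mkposreal 1 Rlt_0_1).
  - exact HN.
  - intros; apply Hd; lra.
  - intros; apply Hhw; lra.
  - intros. apply cont_strip_ex_RInt with a; (assumption || lra).
Qed.

Lemma is_RInt_derive_eq (f df : R -> R) a b :
  (forall x, Rmin a b <= x <= Rmax a b -> is_derive f x (df x)) ->
  (forall x, Rmin a b <= x <= Rmax a b -> continuous df x) ->
  RInt df a b = f b - f a.
Proof.
  intros H1 H2. apply is_RInt_unique. now apply (is_RInt_derive f df).
Qed.

(** The divergence theorem in the angle. The inner integral runs over [y], so it is differentiated
    under the integral sign and the order of integration is never exchanged. *)
Lemma rint2_dw th a N h hw :
  (forall w y, a <= y -> is_derive (fun s => h s y) w (hw w y)) ->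
  cont_strip a h -> cont_strip a hw -> a <= N ->
  rint2 th a N hw = RInt (h th) a N - RInt (h 0) a N.
Proof.
  intros Hd Hh Hhw HN. unfold rint2.
  apply (is_RInt_derive_eq (fun w => RInt (h w) a N)).
  - intros w _. now apply is_derive_RInt_strip.
  - intros w _. now apply continuous_RInt_param.
Qed.

Lemma rint2_dy th a N h hy :
  (forall w y, a <= y -> is_derive (h w) y (hy w y)) ->
  cont_strip a h -> cont_strip a hy -> a <= N ->
  rint2 th a N hy = RInt (fun w => h w N) 0 th - RInt (fun w => h w a) 0 th.
Proof.
  intros Hd Hh Hhy HN. unfold rint2.
  rewrite (RInt_ext _ (fun w => minus (h w N) (h w a))).
  - apply (RInt_minus (V := R_CompleteNormedModule));
      apply ex_RInt_cont; intros x _; apply continuity_2d_pt_continuous1, Hh; lra.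
  - intros w _. apply (is_RInt_derive_eq (h w)); intros y Hy; rewrite Rmin_left in Hy by lra.
    + apply Hd; lra.
    + apply continuity_2d_pt_continuous2, Hhy; lra.
Qed.

(** Making the flux small at infinity requires the growth rate of a rectangle integral as its outer
    edge moves; the upper limit of the inner integral is treated as a parameter of the outer one. *)
Lemma is_derive_rint2 th a N h :
  cont_strip a h -> 0 <= th -> a < N ->
  is_derive (fun M => rint2 th a M h) N (RInt (fun w => h w N) 0 th).
Proof.
  intros Hh Hth HN.
  assert (Hp : 0 < N - a) by lra.
  apply (is_derive_RInt_par (fun M w => RInt (h w) a M) (fun M w => h w M) 0 th N
          (mkposreal _ Hp)); simpl.
  - exact Hth.
  - intros s w Hs _. apply Rabs_def2 in Hs.
    apply (is_derive_RInt (h w) (fun M => RInt (h w) a M) a).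
    + apply (locally_interval _ a (s + 1)); [lra|]. intros z Hz.
      apply (RInt_correct (V := R_CompleteNormedModule)), cont_strip_ex_RInt with a; (assumption || lra).
    + apply continuity_2d_pt_continuous2, Hh; lra.
  - intros w _.
    intros e. destruct (Hh w N (Rlt_le _ _ HN) e) as [d Hd]. exists d. intros u v Hu Hv.
    now apply Hd.
  - intros s Hs. apply Rabs_def2 in Hs. apply ex_rint2; [exact Hh|lra].
Qed.

Lemma rint2_mono th a N N' h :
  cont_strip a h -> a <= N -> N <= N' -> 0 <= th ->
  (forall w y, 0 < w < th -> a < y -> 0 <= h w y) ->
  rint2 th a N h <= rint2 th a N' h.
Proof.
  intros Hh HN HN' Hth H. unfold rint2. apply RInt_le; try (now apply ex_rint2 || apply ex_rint2; (assumption||lra)).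
  - exact Hth.
  - intros w Hw.
    assert (E := RInt_Chasles (V := R_CompleteNormedModule) (h w) a N N').
    change plus with Rplus in E. change (fun y => h w y) with (h w). rewrite <- E;
      [|apply cont_strip_ex_RInt with a; (assumption||lra)..].
    assert (0 <= RInt (h w) N N'); [|lra].
    apply RInt_ge_0; [exact HN'|apply cont_strip_ex_RInt with a; (assumption||lra)|].
    intros y Hy. apply H; lra.
Qed.

(** * Monotone limits *)

(** [Lim] at infinity is by definition the limit along the integers, hence the comparison of
    sequences beyond a large index. Finiteness matters because [real] sends an infinite value to
    0. *)
Lemma le_Lim_mono (f : R -> R) a N :
  (forall x y, a <= x -> x <= y -> f x <= f y) -> is_finite (Lim f p_infty) ->
  a <= N -> f N <= real (Lim f p_infty).
Proof.
  intros Hf Hfin HN. unfold Lim in *. simpl in *.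
  assert (H : Rbar_le (Lim_seq (fun _ => f N)) (Lim_seq (fun n => f (INR n)))).
  { apply Lim_seq_le_loc. destruct (nfloor_ex (Rmax 0 N)) as [n Hn]; [apply Rmax_l|].
    exists (S n). intros m Hm. apply Hf; [exact HN|].
    apply Rle_trans with (INR n + 1); [apply Rle_trans with (Rmax 0 N); [apply Rmax_r|lra]|].
    rewrite <- S_INR. now apply le_INR. }
  rewrite Lim_seq_const, <- Hfin in H. exact H.
Qed.

Lemma Lim_le_bound (f : R -> R) a C :
  (forall x, a <= x -> f x <= C) -> is_finite (Lim f p_infty) ->
  real (Lim f p_infty) <= C.
Proof.
  intros Hf Hfin. unfold Lim in *. simpl in *.
  assert (H : Rbar_le (Lim_seq (fun n => f (INR n))) (Lim_seq (fun _ => C))).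
  { apply Lim_seq_le_loc. destruct (nfloor_ex (Rmax 0 a)) as [n Hn]; [apply Rmax_l|].
    exists (S n). intros m Hm. apply Hf.
    apply Rle_trans with (INR n + 1); [apply Rle_trans with (Rmax 0 a); [apply Rmax_r|lra]|].
    rewrite <- S_INR. now apply le_INR. }
  rewrite Lim_seq_const, <- Hfin in H. exact H.
Qed.

(** * Functions of two variables *)

Lemma continuity_2d_pt_swap (h : R -> R -> R) w y :
  continuity_2d_pt (fun s t => h t s) y w -> continuity_2d_pt h w y.
Proof.
  intros H e. destruct (H e) as [d Hd]. exists d. intros u v Hu Hv. now apply Hd.
Qed.

(** The increment is split at the corner [(w, v)]: on the leg in the first variable the mean value
    theorem and the local bound [B] of [hw] apply, on the other leg only continuity of [h w] at [y]
    is used. *)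
Lemma continuity_2d_pt_primitive (h hw : R -> R -> R) w y :
  (forall s t, is_derive (fun s => h s t) s (hw s t)) ->
  continuity_2d_pt hw w y -> continuity_pt (h w) y -> continuity_2d_pt h w y.
Proof.
  intros Hd Hc Hy e.
  destruct (Hc (mkposreal 1 Rlt_0_1)) as [d0 Hd0]. simpl in Hd0.
  set (B := Rabs (hw w y) + 1).
  assert (HB : 0 < B) by (unfold B; assert (H := Rabs_pos (hw w y)); lra).
  assert (He := cond_pos e). assert (Hd0p := cond_pos d0).
  destruct (Hy (e / 2)) as [d1 [Hd1 H1]]; [lra|].
  assert (Hm : 0 < Rmin (Rmin d0 d1) (e / (2 * B))).
  { repeat apply Rmin_glb_lt; try lra. apply Rdiv_lt_0_compat; lra. }
  exists (mkposreal _ Hm). simpl. intros u v Hu Hv.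
  assert (Hu0 : Rabs (u - w) < d0).
  { eapply Rlt_le_trans; [exact Hu|]. eapply Rle_trans; apply Rmin_l. }
  assert (Hv0 : Rabs (v - y) < d0).
  { eapply Rlt_le_trans; [exact Hv|]. eapply Rle_trans; apply Rmin_l. }
  assert (Hv1 : Rabs (v - y) < d1).
  { eapply Rlt_le_trans; [exact Hv|]. eapply Rle_trans; [apply Rmin_l|apply Rmin_r]. }
  assert (Hu1 : Rabs (u - w) < e / (2 * B)).
  { eapply Rlt_le_trans; [exact Hu|]. apply Rmin_r. }
  assert (Hyv : Rabs (h w v - h w y) < e / 2).
  { destruct (Req_dec y v) as [->|Hne].
    - rewrite Rminus_diag, Rabs_R0. lra.
    - apply (H1 v). split; [split; [exact I|exact Hne]|exact Hv1]. }
  destruct (mvt_abs (fun s => h s v) (fun s => hw s v) w u) as [z [Hz1 Hz2]].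
  { intros z _. apply Hd. }
  assert (Hz : Rabs (z - w) < d0).
  { eapply Rle_lt_trans; [|exact Hu0]. unfold Rmin, Rmax in Hz1. unfold Rabs.
    destruct (Rle_dec w u); destruct (Rcase_abs (z - w)); destruct (Rcase_abs (u - w)); lra. }
  assert (Hhw : Rabs (hw z v) <= B).
  { assert (H2 := Hd0 z v Hz Hv0). unfold B.
    replace (hw z v) with (hw w y + (hw z v - hw w y)) by ring.
    eapply Rle_trans; [apply Rabs_triang|]. lra. }
  replace (h u v - h w y) with ((h u v - h w v) + (h w v - h w y)) by ring.
  eapply Rle_lt_trans; [apply Rabs_triang|]. rewrite Hz2, Rabs_mult.
  assert (H3 : Rabs (hw z v) * Rabs (u - w) <= B * (e / (2 * B))).
  { apply Rmult_le_compat; try apply Rabs_pos; lra. }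
  replace (B * (e / (2 * B))) with (e / 2) in H3 by (field; lra). lra.
Qed.

Lemma class_C_cont k h : class_C k h -> forall w y, continuity_2d_pt h w y.
Proof. intros H w y. specialize (H w y). destruct k; apply H. Qed.

Lemma class_C_d1 k h : class_C (S k) h ->
  class_C k (d1 h) /\ forall w y, is_derive (fun s => h s y) w (d1 h w y).
Proof.
  intros H. split; intros w y; destruct (H w y) as (_ & H1 & H2 & H3 & H4).
  - exact H3.
  - now apply Derive_correct.
Qed.

Lemma class_C_d2 k h : class_C (S k) h ->
  class_C k (d2 h) /\ forall w y, is_derive (h w) y (d2 h w y).
Proof.
  intros H. split; intros w y; destruct (H w y) as (_ & H1 & H2 & H3 & H4).
  - exact H4.
  - now apply Derive_correct.
Qed.

Lemma class_C_Schwarz h : class_C 2 h -> forall w y, d1 (d2 h) w y = d2 (d1 h) w y.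
Proof.
  intros H w y.
  destruct (class_C_d1 _ _ H) as [H1 D1]. destruct (class_C_d2 _ _ H) as [H2 D2].
  destruct (class_C_d1 _ _ H2) as [H12 D12]. destruct (class_C_d2 _ _ H1) as [H21 D21].
  apply (Schwarz h).
  - apply locally_2d_forall. intros u v.
    repeat split; eexists; [apply D1 | apply D2 | apply D12 | apply D21].
  - apply (class_C_cont _ _ H12).
  - apply (class_C_cont _ _ H21).
Qed.

Lemma smooth_derive f n : smooth f -> forall x, is_derive (Derive_n f n) x (Derive_n f (S n) x).
Proof. intros H x. apply Derive_correct. exact (H (S n) x). Qed.

(** * Tail integrals *)

Definition tail (h : R -> R) (y : R) : R :=
  RInt_gen h (at_point y) (Rbar_locally p_infty).

Lemma is_RInt_inv_sq M a b : 0 < 1 + a -> a <= b ->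
  is_RInt (fun t => M / (1 + t) ^ 2) a b (M / (1 + a) - M / (1 + b)).
Proof.
  intros Ha Hb.
  replace (M / (1 + a) - M / (1 + b)) with (minus (- (M / (1 + b))) (- (M / (1 + a))))
    by (unfold minus, plus, opp; simpl; ring).
  apply (is_RInt_derive (fun t => - (M / (1 + t)))).
  - intros x Hx. rewrite Rmin_left in Hx by lra. auto_derive; [lra|]. field. lra.
  - intros x Hx. rewrite Rmin_left in Hx by lra.
    apply (ex_derive_continuous (K := R_AbsRing) (V := R_NormedModule)). auto_derive. nra.
Qed.

Section Tail.

Variables (a M : R) (h : R -> R).
Hypothesis Ha : 0 < a.
Hypothesis Hc : forall y, continuous h y.
Hypothesis Hb : forall y, a <= y -> Rabs (h y) * (1 + y) ^ 2 <= M.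

Lemma tail_hyp_nonneg : 0 <= M.
Proof.
  eapply Rle_trans; [|apply (Hb a); lra].
  apply Rmult_le_pos; [apply Rabs_pos|apply pow2_ge_0].
Qed.

Lemma tail_ex_RInt x y : ex_RInt h x y.
Proof. apply ex_RInt_cont. auto. Qed.

Lemma tail_RInt_bound x y : a <= x -> x <= y ->
  Rabs (RInt h x y) <= M / (1 + x) - M / (1 + y).
Proof.
  intros Hx Hy.
  apply (norm_RInt_le h (fun t => M / (1 + t) ^ 2) x y); [exact Hy| | |].
  - intros t Ht. change (norm (h t)) with (Rabs (h t)).
    apply Rmult_le_reg_r with ((1 + t) ^ 2); [apply pow_lt; lra|].
    unfold Rdiv. rewrite Rmult_assoc, Rinv_l, Rmult_1_r by (apply pow_nonzero; lra).
    apply Hb. lra.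
  - apply (RInt_correct (V := R_CompleteNormedModule)), tail_ex_RInt.
  - apply is_RInt_inv_sq; lra.
Qed.

Lemma tail_filterlim y :
  exists l, filterlim (fun N => RInt h y N) (Rbar_locally p_infty) (locally l).
Proof.
  apply (filterlim_locally_cauchy (U := R_CompleteSpace)). intros e.
  assert (HM := tail_hyp_nonneg). assert (He := cond_pos e).
  (* Increments beyond [u] are bounded by [M / (1 + u)], which is below [e] as soon as
     [u > M / e]. *)
  exists (fun N => Rmax a (M / e) < N). split; [now exists (Rmax a (M / e))|].
  assert (aux : forall u v, Rmax a (M / e) < u -> u <= v -> Rabs (RInt h y v - RInt h y u) < e).
  { intros u v Hu Huv.
    assert (Hua : a < u) by (eapply Rle_lt_trans; [apply Rmax_l|exact Hu]).
    assert (Hue : M / e < u) by (eapply Rle_lt_trans; [apply Rmax_r|exact Hu]).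
    replace (RInt h y v - RInt h y u) with (RInt h u v).
    2:{ assert (E := RInt_Chasles (V := R_CompleteNormedModule) h y u v
          (tail_ex_RInt _ _) (tail_ex_RInt _ _)). change plus with Rplus in E. lra. }
    eapply Rle_lt_trans; [apply tail_RInt_bound; lra|].
    assert (0 <= M / (1 + v)) by (apply Rmult_le_pos; [lra|left; apply Rinv_0_lt_compat; lra]).
    assert (M / (1 + u) < e); [|lra].
    apply Rmult_lt_reg_r with (1 + u); [lra|]. unfold Rdiv at 1.
    rewrite Rmult_assoc, Rinv_l, Rmult_1_r by lra.
    assert (M = M / e * e) by (field; lra). nra. }
  intros u v Hu Hv. change (Rabs (RInt h y v - RInt h y u) < e).
  destruct (Rle_dec u v); [now apply aux|].
  rewrite Rabs_minus_sym. apply aux; lra.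
Qed.

Lemma is_RInt_gen_tail y :
  is_RInt_gen h (at_point y) (Rbar_locally p_infty) (tail h y).
Proof.
  destruct (tail_filterlim y) as [l Hl].
  apply (RInt_gen_correct (V := R_CompleteNormedModule)). exists l.
  intros P HP. specialize (Hl P HP).
  exists (fun z => z = y) (fun N => P (RInt h y N)); [reflexivity|exact Hl|].
  intros x N -> HN. exists (RInt h y N). split; [|exact HN].
  apply (RInt_correct (V := R_CompleteNormedModule)), tail_ex_RInt.
Qed.

Lemma tail_Chasles y z : tail h y = RInt h y z + tail h z.
Proof.
  unfold tail at 1. apply (is_RInt_gen_unique (V := R_CompleteNormedModule) h).
  apply (is_RInt_gen_Chasles (V := R_NormedModule) h z (RInt h y z) (tail h z)).
  - apply is_RInt_gen_at_point. apply (RInt_correct (V := R_CompleteNormedModule)), tail_ex_RInt.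
  - apply is_RInt_gen_tail.
Qed.

Lemma tail_bound y : a <= y -> Rabs (tail h y) <= M / (1 + y).
Proof.
  intros Hy. assert (HM := tail_hyp_nonneg).
  apply (RInt_gen_norm (Fa := at_point y) (Fb := Rbar_locally p_infty) h
           (fun t => M / (1 + t) ^ 2) (tail h y) (M / (1 + y))).
  - exists (fun x => x = y) (fun N => y < N); [reflexivity|now exists y|].
    intros x N -> HN; simpl; lra.
  - exists (fun x => x = y) (fun N => y < N); [reflexivity|now exists y|].
    intros x N -> HN t Ht. simpl in Ht. change (norm (h t)) with (Rabs (h t)).
    apply Rmult_le_reg_r with ((1 + t) ^ 2); [apply pow_lt; lra|].
    unfold Rdiv. rewrite Rmult_assoc, Rinv_l, Rmult_1_r by (apply pow_nonzero; lra).
    apply Hb. lra.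
  - apply is_RInt_gen_tail.
  - intros P [d Hd].
    assert (Hdp := cond_pos d).
    exists (fun x => x = y) (fun N => Rmax y (M / d) < N);
      [reflexivity|now exists (Rmax y (M / d))|].
    intros x N -> HN.
    assert (Hua : y < N) by (eapply Rle_lt_trans; [apply Rmax_l|exact HN]).
    assert (Hue : M / d < N) by (eapply Rle_lt_trans; [apply Rmax_r|exact HN]).
    exists (M / (1 + y) - M / (1 + N)). split; [apply is_RInt_inv_sq; simpl; lra|].
    apply Hd. change (Rabs (M / (1 + y) - M / (1 + N) - M / (1 + y)) < d).
    replace (M / (1 + y) - M / (1 + N) - M / (1 + y)) with (- (M / (1 + N))) by ring.
    rewrite Rabs_Ropp, Rabs_pos_eq
      by (apply Rmult_le_pos; [lra|left; apply Rinv_0_lt_compat; lra]).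
    apply Rmult_lt_reg_r with (1 + N); [lra|]. unfold Rdiv at 1.
    rewrite Rmult_assoc, Rinv_l, Rmult_1_r by lra.
    assert (M = M / d * d) by (field; lra). nra.
Qed.

Lemma is_derive_tail y : is_derive (tail h) y (- h y).
Proof.
  apply is_derive_ext with (fun t => tail h y - RInt h y t).
  { intros t. rewrite (tail_Chasles y t). simpl. ring. }
  evar_last.
  - apply @is_derive_minus; [apply is_derive_const|].
    apply (is_derive_RInt h (fun t => RInt h y t) y y); [|apply Hc].
    apply filter_forall. intros t.
    apply (RInt_correct (V := R_CompleteNormedModule)), tail_ex_RInt.
  - unfold minus, plus, opp, zero; simpl; ring.
Qed.

End Tail.

(** In place of a uniform convergence argument, a second [w]-derivative with the same quadratic
    decay makes the Taylor remainder of the tails of order [k ^ 2]. *)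
Lemma is_derive_tail_param (h hw hww : R -> R -> R) (a M : R) w y :
  0 < a -> a <= y ->
  (forall w y, continuous (h w) y) -> (forall w y, continuous (hw w) y) ->
  (forall w y, a <= y -> Rabs (h w y) * (1 + y) ^ 2 <= M) ->
  (forall w y, a <= y -> Rabs (hw w y) * (1 + y) ^ 2 <= M) ->
  (forall w y, a <= y -> Rabs (hww w y) * (1 + y) ^ 2 <= M) ->
  (forall w y, is_derive (fun s => h s y) w (hw w y)) ->
  (forall w y, is_derive (fun s => hw s y) w (hww w y)) ->
  is_derive (fun s => tail (h s) y) w (tail (hw w) y).
Proof.
  intros Ha Hy Ch Chw B0 B1 B2 D0 D1.
  assert (HM := tail_hyp_nonneg a M (hww w) (B2 w)).
  assert (key : forall k, k <> 0 ->
    Rabs (tail (h (w + k)) y - tail (h w) y - k * tail (hw w) y) <= k ^ 2 * M).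
  { intros k Hk.
    set (g := fun t => minus (minus (h (w + k) t) (h w t)) (scal k (hw w t))).
    assert (Eg : tail g y = tail (h (w + k)) y - tail (h w) y - k * tail (hw w) y).
    { unfold tail at 1. apply (is_RInt_gen_unique (V := R_CompleteNormedModule) g). unfold g.
      apply (is_RInt_gen_minus (V := R_NormedModule) (fun t => minus (h (w + k) t) (h w t))
        (fun t => scal k (hw w t)) (tail (h (w + k)) y - tail (h w) y)).
      - apply (is_RInt_gen_minus (V := R_NormedModule) (h (w + k)) (h w));
          apply is_RInt_gen_tail with a M; auto.
      - apply (is_RInt_gen_scal (V := R_NormedModule) (hw w)). apply is_RInt_gen_tail with a M; auto. }
    rewrite <- Eg.
    eapply Rle_trans.
    - apply tail_bound with (a := a) (M := k ^ 2 * M); try assumption.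
      + intros t. unfold g. apply (continuous_minus (V := R_NormedModule)).
        * apply (continuous_minus (V := R_NormedModule)); apply Ch.
        * apply (continuous_scal_r (V := R_NormedModule)), Chw.
      + intros t Ht. change (g t) with (h (w + k) t - h w t - k * hw w t).
        destruct (mvt_abs (fun s => h s t - s * hw w t) (fun s => hw s t - hw w t) w (w + k))
          as [z [Hz1 Hz2]].
        { intros z _. auto_derive; [now exists (hw z t)|].
          assert (E := is_derive_unique _ _ _ (D0 z t)). simpl in E |- *. rewrite E. ring. }
        destruct (mvt_abs (fun s => hw s t) (fun s => hww s t) w z) as [z' [Hz1' Hz2']].
        { intros z' _. apply D1. }
        (* Two mean values produce the second order remainder: one for [h s t - s * hw w t] at [z],
           one for [hw] between [w] and [z]. *)
        replace (h (w + k) t - h w t - k * hw w t) with (k * (z - w) * hww z' t).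
        2:{ transitivity ((hw z t - hw w t) * (w + k - w)); [|rewrite <- Hz2; ring].
            rewrite Hz2'. ring. }
        rewrite 2!Rabs_mult, Rmult_assoc.
        assert (Hzk : Rabs (z - w) <= Rabs k).
        { unfold Rmin, Rmax in Hz1. unfold Rabs.
          destruct (Rle_dec w (w + k)); destruct (Rcase_abs (z - w)); destruct (Rcase_abs k); lra. }
        rewrite <- (pow2_abs k).
        assert (0 <= Rabs k) by apply Rabs_pos.
        assert (0 <= Rabs (z - w)) by apply Rabs_pos.
        assert (HB := B2 z' t Ht).
        assert (0 <= Rabs (hww z' t) * (1 + t) ^ 2)
          by (apply Rmult_le_pos; [apply Rabs_pos|apply pow2_ge_0]).
        apply Rmult_le_compat; try assumption; [nra|].
        replace (Rabs k ^ 2) with (Rabs k * Rabs k) by ring. now apply Rmult_le_compat_l.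
    - apply Rmult_le_reg_r with (1 + y); [lra|]. unfold Rdiv at 1.
      rewrite Rmult_assoc, Rinv_l, Rmult_1_r by lra.
      assert (0 <= k ^ 2 * M) by (apply Rmult_le_pos; [apply pow2_ge_0|exact HM]). nra. }
  apply is_derive_Reals. intros e He.
  assert (Hd : 0 < e / (M + 1)) by (apply Rdiv_lt_0_compat; lra).
  exists (mkposreal _ Hd). simpl. intros k Hk Hke.
  specialize (key k Hk).
  replace ((tail (h (w + k)) y - tail (h w) y) / k - tail (hw w) y)
    with ((tail (h (w + k)) y - tail (h w) y - k * tail (hw w) y) / k) by (field; exact Hk).
  unfold Rdiv. rewrite Rabs_mult, Rabs_inv.
  assert (Hk0 : 0 < Rabs k) by now apply Rabs_pos_lt.
  apply Rmult_lt_reg_r with (Rabs k); [exact Hk0|].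
  rewrite Rmult_assoc, Rinv_l, Rmult_1_r by lra.
  eapply Rle_lt_trans; [exact key|]. rewrite <- (pow2_abs k).
  assert (Rabs k * (M + 1) < e).
  { replace e with (e / (M + 1) * (M + 1)) by (field; lra). apply Rmult_lt_compat_r; lra. }
  nra.
Qed.

(** * A maximum principle on rectangles *)

(** The extreme value theorem asks for two-sided continuity at the endpoints; composing with this
    projection extends a function constantly beyond the interval. *)
Definition clamp (a b x : R) : R := Rmax a (Rmin x b).

Lemma clamp_in a b x : a <= b -> a <= clamp a b x <= b.
Proof. intros H. unfold clamp, Rmax, Rmin. repeat destruct Rle_dec; lra. Qed.

Lemma clamp_id a b x : a <= x <= b -> clamp a b x = x.
Proof. intros H. unfold clamp, Rmax, Rmin. repeat destruct Rle_dec; lra. Qed.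

Lemma clamp_lip a b x y : Rabs (clamp a b x - clamp a b y) <= Rabs (x - y).
Proof.
  unfold clamp, Rmax, Rmin, Rabs.
  repeat destruct Rle_dec; repeat destruct Rcase_abs; lra.
Qed.

(** One variable at a time: the minimum over [t] depends continuously on [x] because [Z] is
    uniformly continuous on the rectangle, so the one-dimensional extreme value theorem can be
    applied twice. *)
Lemma rectangle_min (Z : R -> R -> R) x0 x1 t0 t1 :
  x0 <= x1 -> t0 <= t1 ->
  (forall x t, x0 <= x <= x1 -> t0 <= t <= t1 -> continuity_2d_pt Z x t) ->
  exists xm tm, x0 <= xm <= x1 /\ t0 <= tm <= t1 /\
    forall x t, x0 <= x <= x1 -> t0 <= t <= t1 -> Z xm tm <= Z x t.
Proof.
  intros Hx Ht Hc.
  set (c := clamp x0 x1).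
  assert (Hmin : forall x, exists tm, t0 <= tm <= t1 /\
            forall t, t0 <= t <= t1 -> Z (c x) tm <= Z (c x) t).
  { intros x. destruct (continuity_ab_min (Z (c x)) t0 t1 Ht) as [tm [H1 H2]].
    - intros t Ht'. apply continuity_pt_filterlim.
      apply continuity_2d_pt_continuous2, Hc; [now apply clamp_in|exact Ht'].
    - now exists tm. }
  (* An infimum defines this function without a choice of minimizers; [Hm] evaluates it at any of
     them. *)
  set (m := fun x => real (Glb_Rbar (fun v => exists t, t0 <= t <= t1 /\ v = Z (c x) t))).
  assert (Hm : forall x tm, t0 <= tm <= t1 ->
            (forall t, t0 <= t <= t1 -> Z (c x) tm <= Z (c x) t) -> m x = Z (c x) tm).
  { intros x tm H1 H2. unfold m.
    rewrite (is_glb_Rbar_unique _ (Finite (Z (c x) tm))); [reflexivity|].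
    split.
    - intros v [t [Ht' ->]]. simpl. now apply H2.
    - intros b Hb. apply Hb. now exists tm. }
  destruct (continuity_ab_min m x0 x1 Hx) as [xm [Hxm1 Hxm2]].
  - intros x _ e He.
    destruct (uniform_continuity_2d Z x0 x1 t0 t1 Hc (mkposreal e He)) as [d Hd].
    exists d. split; [apply cond_pos|]. intros x' [_ Hx']. simpl in Hx' |- *. unfold Rdist in *.
    destruct (Hmin x) as [s [Hs1 Hs2]]. destruct (Hmin x') as [s' [Hs1' Hs2']].
    rewrite (Hm x s Hs1 Hs2), (Hm x' s' Hs1' Hs2').
    assert (H1 := Hs2 s' Hs1'). assert (H2 := Hs2' s Hs1).
    assert (Hcc : Rabs (c x' - c x) < d) by (eapply Rle_lt_trans; [apply clamp_lip|exact Hx']).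
    assert (U : forall t, t0 <= t <= t1 -> Rabs (Z (c x') t - Z (c x) t) < e).
    { intros t Ht'. apply (Hd (c x) t (c x') t); try assumption; try now apply clamp_in.
      rewrite Rminus_diag, Rabs_R0; apply cond_pos. }
    assert (U1 := Rabs_def2 _ _ (U s Hs1)). assert (U2 := Rabs_def2 _ _ (U s' Hs1')).
    apply Rabs_def1; lra.
  - destruct (Hmin xm) as [tm [H1 H2]]. exists xm, tm. repeat split; try lra.
    intros x t Hx' Ht'. destruct (Hmin x) as [s [Hs1 Hs2]].
    assert (E := Hxm1 x Hx'). rewrite (Hm xm tm H1 H2), (Hm x s Hs1 Hs2) in E.
    specialize (Hs2 t Ht'). unfold c in *. rewrite !clamp_id in * by assumption. lra.
Qed.

(** The first derivative vanishes at the minimum. If [l] were negative, it would be negative just to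
    the right, and [f] would drop below its minimum. Only differentiability of [df] at [x] itself
    enters. *)
Lemma second_derivative_min (f df : R -> R) x l a b :
  a < x < b -> (forall z, a < z < b -> is_derive f z (df z)) ->
  is_derive df x l -> (forall z, a < z < b -> f x <= f z) -> 0 <= l.
Proof.
  intros Hx Hf Hdf Hmin.
  assert (H0 : df x = 0).
  { assert (Hfx := Hf x Hx). apply is_derive_Reals in Hfx.
    rewrite <- (deriv_minimum f a b x (exist _ (df x) Hfx)); try lra.
    - reflexivity.
    - intros z Hz1 Hz2. now apply Hmin. }
  destruct (Rle_lt_dec 0 l) as [Hl|Hl]; [exact Hl|exfalso].
  apply is_derive_Reals in Hdf.
  destruct (Hdf (- l)) as [d' Hd']; [lra|].
  assert (Hdp := cond_pos d').
  set (k := Rmin (b - x) d' / 2).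
  assert (Hk : 0 < k < b - x /\ k < d').
  { unfold k. assert (0 < Rmin (b - x) d') by (apply Rmin_glb_lt; lra).
    assert (H1 := Rmin_l (b - x) d'). assert (H2 := Rmin_r (b - x) d'). lra. }
  destruct (MVT_cor2 f df x (x + k)) as [z [Hz1 Hz2]]; [lra| |].
  - intros z Hz. apply is_derive_Reals, Hf. lra.
  - assert (f x <= f (x + k)) by (apply Hmin; lra).
    assert (Hz3 : df z < 0).
    { specialize (Hd' (z - x)).
      assert (Hzx : z - x <> 0) by lra.
      assert (Hzd : Rabs (z - x) < d') by (apply Rabs_def1; lra).
      specialize (Hd' Hzx Hzd). replace (x + (z - x)) with z in Hd' by ring.
      rewrite H0, Rminus_0_r in Hd'. apply Rabs_def2 in Hd'.
      assert (Hq : df z / (z - x) < 0) by lra.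
      replace (df z) with (df z / (z - x) * (z - x)) by (field; lra). nra. }
    nra.
Qed.

(* The comparison function [h] handles a zero order coefficient of either sign:
   it is the quotient [Z / h] that is minimized. *)
Lemma rectangle_comparison (Z : R -> R -> R) (h : R -> R) x0 x1 t0 t1 :
  x0 <= x1 -> t0 <= t1 ->
  (forall x t, x0 <= x <= x1 -> t0 <= t <= t1 -> continuity_2d_pt Z x t) ->
  (forall x, x0 <= x <= x1 -> continuity_pt h x /\ 0 < h x) ->
  (forall t, t0 <= t <= t1 -> 0 <= Z x0 t /\ 0 <= Z x1 t) ->
  (forall x, x0 <= x <= x1 -> 0 <= Z x t0 /\ 0 <= Z x t1) ->
  (forall x t zeta, x0 < x < x1 -> t0 < t < t1 -> zeta < 0 -> Z x t = zeta * h x ->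
     (forall x', x0 <= x' <= x1 -> zeta * h x' <= Z x' t) ->
     (forall t', t0 <= t' <= t1 -> Z x t <= Z x t') -> False) ->
  forall x t, x0 <= x <= x1 -> t0 <= t <= t1 -> 0 <= Z x t.
Proof.
  intros Hx Ht Hc Hh Hs Hb Hint.
  destruct (rectangle_min (fun x t => Z x t / h x) x0 x1 t0 t1 Hx Ht)
    as (xm & tm & Hxm & Htm & Hmin).
  { intros x t Hx' Ht'. apply continuity_2d_pt_div; [now apply Hc| |].
    - now apply continuity_2d_pt_fst, Hh.
    - apply Rgt_not_eq, Hh, Hx'. }
  assert (Hhm := proj2 (Hh xm Hxm)).
  assert (Hgoal : 0 <= Z xm tm / h xm).
  { apply Rnot_lt_le. intros Hneg.
    assert (Hz : Z xm tm < 0).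
    { replace (Z xm tm) with (Z xm tm / h xm * h xm) by (field; lra). nra. }
    apply (Hint xm tm (Z xm tm / h xm)).
    - destruct (Hs tm Htm). split; apply Rnot_le_lt; intros H';
        [replace xm with x0 in Hz by lra | replace xm with x1 in Hz by lra]; lra.
    - destruct (Hb xm Hxm). split; apply Rnot_le_lt; intros H';
        [replace tm with t0 in Hz by lra | replace tm with t1 in Hz by lra]; lra.
    - exact Hneg.
    - field; lra.
    - intros x' Hx'. specialize (Hmin x' tm Hx' Htm). assert (Hh' := proj2 (Hh x' Hx')).
      replace (Z x' tm) with (Z x' tm / h x' * h x') by (field; lra). nra.
    - intros t' Ht'. specialize (Hmin xm t' Hxm Ht').
      replace (Z xm t') with (Z xm t' / h xm * h xm) by (field; lra).
      replace (Z xm tm) with (Z xm tm / h xm * h xm) at 1 by (field; lra). nra. }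
  intros x t Hx' Ht'. specialize (Hmin x t Hx' Ht'). assert (Hh' := proj2 (Hh x Hx')).
  replace (Z x t) with (Z x t / h x * h x) by (field; lra). nra.
Qed.

(** The barrier [A * t + (N + 1) / 2 * (t * (d - t))] dominates the boundary values. Its second
    derivative [- (N + 1)] lies strictly below [- N], which excludes a negative interior minimum of
    the barrier minus [sg * phi]. The sign [sg] treats both bounds at once, and
    [t * (d - t) <= d * t] gives the linear form. *)
Lemma poisson_linear_bound (phi px pxx pt ptt : R -> R -> R) th d A N :
  0 < th -> 0 < d -> 0 <= A -> 0 <= N ->
  (forall x t, continuity_2d_pt phi x t) ->
  (forall x t, is_derive (fun x => phi x t) x (px x t)) ->
  (forall x t, is_derive (fun x => px x t) x (pxx x t)) ->
  (forall x t, is_derive (phi x) t (pt x t)) ->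
  (forall x t, is_derive (pt x) t (ptt x t)) ->
  (forall x t, 0 < x < th -> 0 < t < d -> Rabs (pxx x t + ptt x t) <= N) ->
  (forall x, 0 <= x <= th -> phi x 0 = 0 /\ Rabs (phi x d) <= A * d) ->
  (forall t, 0 <= t <= d -> Rabs (phi 0 t) <= A * t /\ Rabs (phi th t) <= A * t) ->
  forall x t, 0 <= x <= th -> 0 <= t <= d -> Rabs (phi x t) <= (A + (N + 1) / 2 * d) * t.
Proof.
  intros Hth Hd HA HN Hc Dx Dxx Dt Dtt HL Hb Hs.
  assert (key : forall sg, sg = 1 \/ sg = - 1 -> forall x t, 0 <= x <= th -> 0 <= t <= d ->
     0 <= A * t + (N + 1) / 2 * (t * (d - t)) - sg * phi x t).
  { intros sg Hsg.
    apply (rectangle_comparison _ (fun _ => 1)); try lra.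
    - intros x t _ _. apply continuity_2d_pt_minus.
      + apply (continuity_2d_pt_snd (fun t => A * t + (N + 1) / 2 * (t * (d - t)))).
        apply is_derive_continuity_pt with (A + (N + 1) / 2 * (d - 2 * t)).
        auto_derive; [exact I|ring].
      + apply continuity_2d_pt_scal, Hc.
    - intros x _. split; [apply continuity_pt_const; intros ? ?; reflexivity|lra].
    - intros t Ht. destruct (Hs t Ht) as [H1 H2].
      apply Rabs_le_between in H1. apply Rabs_le_between in H2.
      assert (0 <= t * (d - t)) by nra. assert (0 <= (N + 1) / 2 * (t * (d - t))) by nra.
      destruct Hsg as [-> | ->]; lra.
    - intros x Hx. destruct (Hb x Hx) as [H1 H2].
      apply Rabs_le_between in H2. rewrite H1.
      split; [lra|]. replace (d * (d - d)) with 0 by ring. destruct Hsg as [-> | ->]; lra.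
    - intros x t zeta Hx Ht Hz Hzx Hmx Hmt.
      assert (Hxx : 0 <= 0 - sg * pxx x t).
      { apply (second_derivative_min
          (fun x => A * t + (N + 1) / 2 * (t * (d - t)) - sg * phi x t)
          (fun x => 0 - sg * px x t) x _ 0 th Hx).
        - intros z _. apply @is_derive_minus; [apply @is_derive_const|].
          apply is_derive_scal, Dx.
        - apply @is_derive_minus; [apply @is_derive_const|]. apply is_derive_scal, Dxx.
        - intros z Hz'. simpl.
          rewrite Hzx. apply Hmx. lra. }
      assert (Htt : 0 <= - (N + 1) - sg * ptt x t).
      { apply (second_derivative_min
          (fun t => A * t + (N + 1) / 2 * (t * (d - t)) - sg * phi x t)
          (fun t => A + (N + 1) / 2 * (d - 2 * t) - sg * pt x t) t _ 0 d Ht).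
        - intros z _. apply @is_derive_minus; [auto_derive; [exact I|ring]|].
          apply is_derive_scal, Dt.
        - apply @is_derive_minus; [auto_derive; [exact I|field]|]. apply is_derive_scal, Dtt.
        - intros z Hz'. simpl.
          apply Hmt. lra. }
      assert (HL' := HL x t Hx Ht). apply Rabs_le_between in HL'.
      destruct Hsg as [-> | ->]; lra. }
  intros x t Hx Ht.
  assert (K1 := key 1 (or_introl eq_refl) x t Hx Ht).
  assert (K2 := key (- 1) (or_intror eq_refl) x t Hx Ht).
  assert (0 <= (N + 1) / 2 * (t * t)) by nra.
  apply Rabs_le. nra.
Qed.

Lemma is_derive_shift (f : R -> R) (c t l : R) :
  is_derive f (c + t) l -> is_derive (fun s => f (c + s)) t l.
Proof.
  intros H. rewrite <- (Rmult_1_l l). apply (is_derive_comp f (fun s => c + s)); [exact H|].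
  auto_derive; [exact I|reflexivity].
Qed.

Lemma is_derive_reflect (f : R -> R) (c t l : R) :
  is_derive f (c - t) l -> is_derive (fun s => f (c - s)) t (- l).
Proof.
  intros H. replace (- l) with (- 1 * l) by ring.
  apply (is_derive_comp f (fun s => c - s)); [exact H|]. auto_derive; [exact I|reflexivity].
Qed.

Lemma derive_bound_right (f : R -> R) (l B d : R) :
  0 < d -> f 0 = 0 -> is_derive f 0 l -> (forall s, 0 <= s <= d -> Rabs (f s) <= B * s) ->
  Rabs l <= B.
Proof.
  intros Hd H0 Hl HB. apply Rnot_lt_le. intros Hlt.
  apply is_derive_Reals in Hl. destruct (Hl (Rabs l - B)) as [d' Hd']; [lra|].
  assert (Hdp := cond_pos d'). set (s := Rmin d (d' / 2)).
  assert (Hs : 0 < s) by (apply Rmin_glb_lt; lra).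
  assert (Hs1 : s <= d) by apply Rmin_l. assert (Hs2 : s <= d' / 2) by apply Rmin_r.
  specialize (Hd' s ltac:(lra)).
  rewrite Rabs_pos_eq, Rplus_0_l, H0, Rminus_0_r in Hd' by lra.
  specialize (Hd' ltac:(lra)). specialize (HB s ltac:(lra)).
  assert (Hq : Rabs (f s / s) <= B).
  { unfold Rdiv. rewrite Rabs_mult, Rabs_inv, (Rabs_pos_eq s) by lra.
    apply Rmult_le_reg_r with s; [lra|]. rewrite Rmult_assoc, Rinv_l; lra. }
  assert (Ht := Rabs_triang (f s / s) (- (f s / s - l))).
  rewrite Rabs_Ropp in Ht. replace (f s / s + - (f s / s - l)) with l in Ht by ring. lra.
Qed.

(** * Bounds for the Euler correction in logarithmic coordinates *)

Section StripEquation.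

Variables (th t0 beta N0 M1 : R) (b : R -> R) (G0 P Px Pxx Pt Ptt : R -> R -> R).
Hypothesis Hth : 0 < th.
Hypothesis Hsmall : th ^ 2 * (2 + 2 * beta) <= 1.
Hypothesis HN0 : 0 <= N0.
Hypothesis Hc : forall x t, continuity_2d_pt P x t.
Hypothesis Dx : forall x t, is_derive (fun x => P x t) x (Px x t).
Hypothesis Dxx : forall x t, is_derive (fun x => Px x t) x (Pxx x t).
Hypothesis Dt : forall x t, is_derive (P x) t (Pt x t).
Hypothesis Dtt : forall x t, is_derive (Pt x) t (Ptt x t).
Hypothesis Hbeta : forall t, t0 < t -> Rabs (b t) <= beta.
Hypothesis HG0 : forall x t, 0 < x < th -> t0 < t -> Rabs (G0 x t) <= N0.
Hypothesis Heq : forall x t, 0 < x < th -> t0 < t -> Ptt x t + Pxx x t = b t * P x t - G0 x t.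
Hypothesis Hwall : forall x, 0 <= x <= th -> Rabs (P x t0) <= M1.
Hypothesis Hside : forall t, t0 <= t -> Rabs (P 0 t) <= M1 /\ Rabs (P th t) <= M1.
Hypothesis Hinf : forall eta, 0 < eta -> exists T, forall x t,
  0 <= x <= th -> t0 <= t -> T <= t -> Rabs (P x t) <= eta * exp t.

(** [P] will be r v_e as a function of the angle and of t = ln r. The comparison function is
    [(M + eta * exp t) * h x] with [h] between 1 and 2: its concavity [- 2 / th ^ 2] beats, in a
    thin strip, the coefficient [b] of either sign, and also the source, through the summand
    [th ^ 2 * N0] of [M]. The term [eta * exp t] dominates the growth of [P] that is compatible with
    v_e -> 0; [eta] is arbitrary and disappears at the end. *)
Lemma strip_sup_bound x t : 0 <= x <= th -> t0 <= t ->
  Rabs (P x t) <= 2 * (M1 + th ^ 2 * N0).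
Proof.
  assert (Hb0 : 0 <= beta) by (eapply Rle_trans; [apply Rabs_pos|apply (Hbeta (t0 + 1)); lra]).
  assert (HM1 : 0 <= M1) by (eapply Rle_trans; [apply Rabs_pos|apply (Hwall 0); lra]).
  assert (Hth2 : 0 < th ^ 2) by (apply pow_lt; lra).
  set (M := M1 + th ^ 2 * N0).
  assert (HM : M1 <= M) by (unfold M; nra).
  set (h := fun x => 2 - (x / th) ^ 2).
  assert (Hh : forall x, 0 <= x <= th -> 1 <= h x <= 2).
  { intros x' Hx'. unfold h. assert (0 <= x' / th <= 1).
    { split; [apply Rmult_le_pos; [lra|left; apply Rinv_0_lt_compat; lra]|].
      apply Rmult_le_reg_r with th; [lra|]. unfold Rdiv. rewrite Rmult_assoc, Rinv_l; lra. }
    nra. }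
  set (q := / th ^ 2).
  assert (Hq : 2 + 2 * beta <= q).
  { unfold q. apply Rmult_le_reg_l with (th ^ 2); [lra|]. rewrite Rinv_r; lra. }
  assert (HqN : N0 <= M * q).
  { unfold q, M. rewrite Rmult_plus_distr_r, (Rmult_comm (th ^ 2)), Rmult_assoc, Rinv_r by lra.
    assert (0 <= M1 * / th ^ 2); [|lra].
    apply Rmult_le_pos; [lra|left; now apply Rinv_0_lt_compat]. }
  assert (Dh : forall x, is_derive h x (- 2 * q * x)).
  { intros x'. unfold h. auto_derive; [exact I|]. unfold q. field. lra. }
  assert (Dhh : forall x, is_derive (fun x => - 2 * q * x) x (- 2 * q)).
  { intros x'. auto_derive; [exact I|ring]. }
  intros Hx Ht.
  assert (key : forall sg eta, sg = 1 \/ sg = - 1 -> 0 < eta ->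
     0 <= (M + eta * exp t) * h x - sg * P x t).
  { intros sg eta Hsg Heta.
    destruct (Hinf eta Heta) as [T0 HT0].
    set (T := Rmax (Rmax T0 t) (t0 + 1)).
    assert (HT1 : T0 <= T) by (eapply Rle_trans; [apply Rmax_l|apply Rmax_l]).
    assert (HT2 : t <= T) by (eapply Rle_trans; [apply (Rmax_r T0)|apply Rmax_l]).
    assert (HT3 : t0 + 1 <= T) by apply Rmax_r.
    assert (Habs : forall z B, Rabs z <= B -> - B <= sg * z <= B).
    { intros z B Hz. apply Rabs_le_between in Hz. destruct Hsg as [-> | ->]; lra. }
    assert (Hexp : forall s, 0 < eta * exp s) by (intros; apply Rmult_lt_0_compat; [lra|apply exp_pos]).
    assert (Hmul : forall e c, 0 < e -> 1 <= c -> M + e <= (M + e) * c) by (intros; nra).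
    apply (rectangle_comparison (fun x t => (M + eta * exp t) * h x - sg * P x t) h 0 th t0 T);
      try lra.
    - intros x' t' _ _. apply continuity_2d_pt_minus.
      + apply continuity_2d_pt_mult.
        * apply (continuity_2d_pt_snd (fun t => M + eta * exp t)).
          apply is_derive_continuity_pt with (eta * exp t'). auto_derive; [exact I|ring].
        * apply (continuity_2d_pt_fst h), is_derive_continuity_pt with (1 := Dh x').
      + apply continuity_2d_pt_scal, Hc.
    - intros x' Hx'. split; [apply is_derive_continuity_pt with (1 := Dh x')|].
      specialize (Hh x' Hx'). lra.
    - intros t' Ht'. destruct (Hside t' (proj1 Ht')) as [H1 H2].
      apply Habs in H1. apply Habs in H2. specialize (Hexp t').
      assert (h1 : 1 <= h 0 <= 2) by (apply Hh; lra).
      assert (h2 : 1 <= h th <= 2) by (apply Hh; lra).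
      assert (E1 := Hmul _ _ Hexp (proj1 h1)). assert (E2 := Hmul _ _ Hexp (proj1 h2)). lra.
    - intros x' Hx'. assert (H1 := Habs _ _ (Hwall x' Hx')).
      assert (HT4 : t0 <= T) by lra.
      assert (H2 := Habs _ _ (HT0 x' T Hx' HT4 HT1)).
      assert (E1 := Hexp t0). assert (E2 := Hexp T).
      assert (h1 := Hh x' Hx').
      assert (E3 := Hmul _ _ E1 (proj1 h1)). assert (E4 := Hmul _ _ E2 (proj1 h1)). lra.
    - intros x' t' zeta Hx' Ht' Hz Hzx Hmx Hmt.
      assert (h1 : 1 <= h x' <= 2) by (apply Hh; lra). assert (He' := Hexp t').
      assert (Hxx : 0 <= (M + eta * exp t') * (- 2 * q) - sg * Pxx x' t' - zeta * (- 2 * q)).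
      { apply (second_derivative_min
          (fun x => (M + eta * exp t') * h x - sg * P x t' - zeta * h x)
          (fun x => (M + eta * exp t') * (- 2 * q * x) - sg * Px x t' - zeta * (- 2 * q * x))
           x' _ 0 th Hx').
        - intros z _. repeat apply @is_derive_minus; apply is_derive_scal; [apply Dh|apply Dx|apply Dh].
        - repeat apply @is_derive_minus; apply is_derive_scal; [apply Dhh|apply Dxx|apply Dhh].
        - intros z Hz'. simpl.
          assert (H3 : zeta * h z <= (M + eta * exp t') * h z - sg * P z t') by (apply Hmx; lra). simpl in Hzx, H3. lra. }
      assert (Htt : 0 <= eta * exp t' * h x' - sg * Ptt x' t').
      { apply (second_derivative_min
          (fun t => (M + eta * exp t) * h x' - sg * P x' t)
          (fun t => eta * exp t * h x' - sg * Pt x' t) t' _ t0 T Ht').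
        - intros z _. apply @is_derive_minus; [auto_derive; [exact I|ring]|].
          apply is_derive_scal, Dt.
        - apply @is_derive_minus; [auto_derive; [exact I|ring]|]. apply is_derive_scal, Dtt.
        - intros z Hz'. simpl.
          apply Hmt. lra. }
      assert (He := Heq x' t' Hx' (proj1 Ht')).
      assert (HG := Habs _ _ (HG0 x' t' Hx' (proj1 Ht'))).
      assert (Hbt := Hbeta t' (proj1 Ht')). apply Rabs_le_between in Hbt.
      simpl in Hzx.
      assert (E : sg * (Ptt x' t' + Pxx x' t') =
        b t' * ((M + eta * exp t') * h x' - zeta * h x') - sg * G0 x' t').
      { rewrite He, <- Hzx. ring. }
      set (e' := eta * exp t') in *.
      set (bh := b t' * h x') in *.
      assert (Hbh : - (2 * beta) <= bh <= 2 * beta) by (unfold bh; split; nra).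
      assert (E' : sg * (Ptt x' t' + Pxx x' t') = bh * (M + e') - bh * zeta - sg * G0 x' t')
        by (rewrite E; unfold bh; ring).
      (* The two second derivative inequalities and the equation add up to a contradiction: [M * q]
         pays for [G0], and [q >= 2 + 2 * beta] makes the remaining terms positive, strictly so in
         [C3] and [C4]. *)
      assert (C1 : 0 <= M) by lra.
      assert (C2 : 0 <= M * (q + bh)) by (apply Rmult_le_pos; lra).
      assert (C3 : 0 < e' * (2 * q + bh - h x')) by (apply Rmult_lt_0_compat; lra).
      assert (C4 : 0 < - zeta * (2 * q + bh)) by (apply Rmult_lt_0_compat; lra).
      lra. }
  assert (Hhx := Hh x Hx). assert (Ex := exp_pos t).
  apply le_epsilon. intros e He.
  (* Since [h <= 2], the auxiliary barrier costs at most [2 * (eta * exp t)] at the given point,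
     which is [e]. *)
  set (eta := e / (2 * exp t)).
  assert (Heta : 0 < eta) by (apply Rdiv_lt_0_compat; lra).
  assert (K1 := key 1 eta (or_introl eq_refl) Heta).
  assert (K2 := key (- 1) eta (or_intror eq_refl) Heta).
  assert (Ee : 2 * (eta * exp t) = e) by (unfold eta; field; lra).
  apply Rabs_le. fold M. nra.
Qed.

(* Odd reflection in [t] turns bounds of [P] into bounds of [Pt]; close to the
   wall the reflected point lies on it, where the linear barrier is used. *)
Lemma strip_gradient_bound (Q D : R) :
  0 <= Q -> 0 <= D ->
  (forall x, 0 < x < th -> Rabs (Pxx x t0) <= Q) ->
  (forall s t, t0 <= s -> s <= t -> Rabs (P 0 t - P 0 s) <= D * (t - s) /\
                                    Rabs (P th t - P th s) <= D * (t - s)) ->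
  forall x t, 0 <= x <= th -> t0 < t ->
  Rabs (Pt x t) <= D + Q + N0 + 1 + (4 + 2 * beta) * (M1 + th ^ 2 * N0).
Proof.
  intros HQ HD HPQ HPD.
  assert (Hb0 : 0 <= beta) by (eapply Rle_trans; [apply Rabs_pos|apply (Hbeta (t0 + 1)); lra]).
  assert (HM1 : 0 <= M1) by (eapply Rle_trans; [apply Rabs_pos|apply (Hwall 0); lra]).
  set (M := M1 + th ^ 2 * N0).
  assert (HM0 : 0 <= M) by (unfold M; assert (0 <= th ^ 2) by apply pow2_ge_0; nra).
  assert (HM : forall x t, 0 <= x <= th -> t0 <= t -> Rabs (P x t) <= 2 * M)
    by (intros; now apply strip_sup_bound).
  assert (HMM : forall x s t, 0 <= x <= th -> t0 <= s -> t0 <= t -> Rabs (P x t - P x s) <= 4 * M).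
  { intros x s t Hx Hs Ht. assert (H1 := HM x s Hx Hs). assert (H2 := HM x t Hx Ht).
    apply Rabs_le_between in H1. apply Rabs_le_between in H2. apply Rabs_le. lra. }
  set (N := 2 * beta * M + N0).
  assert (HN : 0 <= N) by (unfold N; nra).
  assert (HL : forall x t, 0 < x < th -> t0 < t -> - N <= Ptt x t + Pxx x t <= N).
  { intros x t Hx Ht. apply Rabs_le_between. rewrite Heq by assumption. unfold N.
    eapply Rle_trans; [apply Rabs_triang|]. rewrite Rabs_Ropp, Rabs_mult.
    assert (H1 : Rabs (P x t) <= 2 * M) by (apply HM; lra). assert (H2 := HG0 x t Hx Ht).
    assert (H3 := Hbeta t Ht).
    assert (Rabs (b t) * Rabs (P x t) <= beta * (2 * M))
      by (apply Rmult_le_compat; try apply Rabs_pos; assumption). lra. }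
  assert (Hcid : forall x, continuity_pt (fun x : R => x) x) by apply continuity_pt_id.
  assert (Hcp : forall c t, continuity_pt (fun s => c + s) t)
    by (intros; apply is_derive_continuity_pt with 1; auto_derive; [exact I|ring]).
  assert (Hcm : forall c t, continuity_pt (fun s => c - s) t)
    by (intros; apply is_derive_continuity_pt with (- 1); auto_derive; [exact I|ring]).
  set (A := D + 4 * M + (N + Q + 1) / 2).
  (* Subtracting the wall values, whose second derivative is at most [Q], leaves a function that
     vanishes at [s = 0] with a source of size [N + Q]; the linear barrier of height 1 gives the
     slope [A]. Beyond height 1 the oscillation bound [4 * M <= A] is enough. *)
  assert (wall : forall x s, 0 <= x <= th -> 0 <= s -> Rabs (P x (t0 + s) - P x t0) <= A * s).
  { intros x s Hx Hs. destruct (Rle_dec s 1) as [Hs1|Hs1].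
    - replace A with (D + 4 * M + (N + Q + 1) / 2 * 1) by (unfold A; ring).
      apply (poisson_linear_bound (fun x s => P x (t0 + s) - P x t0)
        (fun x s => Px x (t0 + s) - Px x t0) (fun x s => Pxx x (t0 + s) - Pxx x t0)
        (fun x s => Pt x (t0 + s) - 0) (fun x s => Ptt x (t0 + s) - 0) th 1); try lra.
      + intros x' t'. apply continuity_2d_pt_minus.
        * apply (continuity_2d_pt_comp P (fun x => x) (fun s => t0 + s)); auto.
        * apply (continuity_2d_pt_comp P (fun x => x) (fun _ => t0)); auto.
          apply continuity_pt_const; intros ? ?; reflexivity.
      + intros x' t'. apply @is_derive_minus; apply Dx.
      + intros x' t'. apply @is_derive_minus; apply Dxx.
      + intros x' t'. apply @is_derive_minus; [|apply @is_derive_const].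
        apply (is_derive_shift (P x')), Dt.
      + intros x' t'. apply @is_derive_minus; [|apply @is_derive_const].
        apply (is_derive_shift (Pt x')), Dtt.
      + intros x' t' Hx' Ht'. assert (H1 : - N <= Ptt x' (t0 + t') + Pxx x' (t0 + t') <= N) by (apply HL; lra).
        assert (H2 : Rabs (Pxx x' t0) <= Q) by (apply HPQ; lra). apply Rabs_le_between in H2.
        apply Rabs_le. lra.
      + intros x' Hx'. rewrite Rplus_0_r. split; [ring|].
        eapply Rle_trans; [apply HMM; lra|]. lra.
      + intros t' Ht'. destruct (HPD t0 (t0 + t')) as [H1 H2]; try lra.
        replace (t0 + t' - t0) with t' in * by ring. split; nra.
    - eapply Rle_trans; [apply HMM; lra|]. assert (4 * M <= A) by (unfold A; lra). nra. }
  intros x t Hx Ht.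
  (* The height is limited so that [t - s] stays in the strip. If the limit is [t - t0], the top
     edge compares [t + d] with the wall at distance [2 * d], and the factor [/ 2] of the odd part
     restores the slope [A]. *)
  set (d := Rmin 1 (t - t0)).
  assert (Hd : 0 < d) by (apply Rmin_glb_lt; lra).
  assert (Hd1 : d <= 1) by apply Rmin_l. assert (Hd2 : d <= t - t0) by apply Rmin_r.
  assert (HA : D + 4 * M <= A) by (unfold A; lra).
  assert (Hphi : forall s, 0 <= s <= d ->
    Rabs (/ 2 * (P x (t + s) - P x (t - s))) <= (A + (N + 1) / 2 * d) * s).
  { intros s Hs.
    apply (poisson_linear_bound (fun x s => / 2 * (P x (t + s) - P x (t - s)))
      (fun x s => / 2 * (Px x (t + s) - Px x (t - s)))
      (fun x s => / 2 * (Pxx x (t + s) - Pxx x (t - s)))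
      (fun x s => / 2 * (Pt x (t + s) - - Pt x (t - s)))
      (fun x s => / 2 * (Ptt x (t + s) - - - Ptt x (t - s))) th d); try lra.
    + intros x' t'. apply continuity_2d_pt_mult; [apply continuity_2d_pt_const|].
      apply continuity_2d_pt_minus.
      * apply (continuity_2d_pt_comp P (fun x => x) (fun s => t + s)); auto.
      * apply (continuity_2d_pt_comp P (fun x => x) (fun s => t - s)); auto.
    + intros x' t'. apply is_derive_scal, @is_derive_minus; apply Dx.
    + intros x' t'. apply is_derive_scal, @is_derive_minus; apply Dxx.
    + intros x' t'. apply is_derive_scal, @is_derive_minus;
        [apply (is_derive_shift (P x')), Dt|apply (is_derive_reflect (P x')), Dt].
    + intros x' t'. apply is_derive_scal, @is_derive_minus; [apply (is_derive_shift (Pt x')), Dtt|].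
      apply @is_derive_opp, (is_derive_reflect (Pt x')), Dtt.
    + intros x' t' Hx' Ht'.
      assert (H1 : - N <= Ptt x' (t + t') + Pxx x' (t + t') <= N) by (apply HL; lra).
      assert (H2 : - N <= Ptt x' (t - t') + Pxx x' (t - t') <= N) by (apply HL; lra).
      apply Rabs_le. lra.
    + intros x' Hx'. rewrite Rplus_0_r, Rminus_0_r. split; [ring|].
      rewrite Rabs_mult, (Rabs_pos_eq (/ 2)) by lra.
      destruct (Rle_dec 1 (t - t0)) as [Hdt|Hdt].
      * replace d with 1 by (unfold d; rewrite Rmin_left; lra).
        assert (H1 : Rabs (P x' (t + 1) - P x' (t - 1)) <= 4 * M) by (apply HMM; lra). lra.
      * assert (E : d = t - t0) by (unfold d; rewrite Rmin_right; lra).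
        assert (H1 := wall x' (2 * d) Hx' ltac:(lra)).
        replace (t0 + 2 * d) with (t + d) in H1 by lra.
        replace t0 with (t - d) in H1 by lra. lra.
    + intros t' Ht'. destruct (HPD (t - t') (t + t')) as [H1 H2]; try lra.
      replace (t + t' - (t - t')) with (2 * t') in * by ring.
      rewrite !Rabs_mult, !(Rabs_pos_eq (/ 2)) by lra. split; nra. }
  eapply Rle_trans.
  - apply (derive_bound_right (fun s => / 2 * (P x (t + s) - P x (t - s))) (Pt x t)
      (A + (N + 1) / 2 * d) d Hd).
    + rewrite Rplus_0_r, Rminus_0_r. ring.
    + replace (Pt x t) with (/ 2 * (Pt x t - - Pt x t)) by field.
      apply is_derive_scal, @is_derive_minus.
      * apply (is_derive_shift (P x)). rewrite Rplus_0_r. apply Dt.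
      * apply (is_derive_reflect (P x)). rewrite Rminus_0_r. apply Dt.
    + exact Hphi.
  - assert ((N + 1) / 2 * d <= (N + 1) / 2) by nra.
    apply Rle_trans with (A + (N + 1) / 2); [lra|]. unfold A, N. lra.
Qed.

End StripEquation.

(** * Angular integrals depending on a radius, and the stretched radial variable *)

Lemma continuity_2d_pt_RInt (G : R -> R -> R) w y :
  (forall w y, continuity_2d_pt G w y) ->
  continuity_2d_pt (fun w y => RInt (fun s => G s y) 0 w) w y.
Proof.
  intros HG.
  assert (HGi : forall y a b, ex_RInt (fun s => G s y) a b).
  { intros y' a' b'. apply ex_RInt_cont. intros x _. now apply continuity_2d_pt_continuous1. }
  apply continuity_2d_pt_primitive with G.
  - intros s t. apply (is_derive_RInt (fun s => G s t) (fun w => RInt (fun s => G s t) 0 w) 0).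
    + apply filter_forall. intros x. now apply (RInt_correct (V := R_CompleteNormedModule)).
    + now apply continuity_2d_pt_continuous1.
  - apply HG.
  - assert (Hs : forall a, cont_strip a (fun y s => G s y))
      by (intros a' s t _; apply continuity_2d_pt_swap, HG).
    apply continuity_pt_filterlim.
    change (continuous (fun y => RInt (fun s => G s y) 0 w) y). destruct (Rle_dec 0 w) as [Hw|Hw].
    + now apply (continuous_RInt_param 0 (fun y s => G s y) w y).
    + apply (continuous_ext (fun y => opp (RInt (fun s => G s y) w 0))).
      * intros t. exact (opp_RInt_swap (V := R_CompleteNormedModule) _ _ _ (HGi t w 0)).
      * apply (continuous_opp (V := R_NormedModule)).
        exact (continuous_RInt_param w (fun y s => G s y) 0 y (Hs w) (Rlt_le _ _ (Rnot_le_lt _ _ Hw))).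
Qed.

(** Profiles are extended to all angles, so [w] may be negative; the limits of integration are then
    exchanged, since rectangles have ordered edges. *)
Lemma is_derive_RInt_param_upper (G Gy : R -> R -> R) w y :
  (forall w y, continuity_2d_pt G w y) -> (forall w y, continuity_2d_pt Gy w y) ->
  (forall w y, is_derive (G w) y (Gy w y)) ->
  is_derive (fun y => RInt (fun s => G s y) 0 w) y (RInt (fun s => Gy s y) 0 w).
Proof.
  intros HG HGy HD.
  assert (Hs : forall a, cont_strip a (fun y s => G s y))
    by (intros a' s t _; apply continuity_2d_pt_swap, HG).
  assert (Hsy : forall a, cont_strip a (fun y s => Gy s y))
    by (intros a' s t _; apply continuity_2d_pt_swap, HGy).
  destruct (Rle_dec 0 w) as [Hw|Hw].
  - apply (is_derive_RInt_strip 0 (fun y s => G s y) (fun y s => Gy s y) w y); auto.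
  - rewrite <- (opp_RInt_swap (V := R_CompleteNormedModule)).
    + apply (is_derive_ext (fun y => opp (RInt (fun s => G s y) w 0))).
      * intros t. apply (opp_RInt_swap (V := R_CompleteNormedModule)).
        apply ex_RInt_cont. intros; now apply continuity_2d_pt_continuous1.
      * apply @is_derive_opp.
        apply (is_derive_RInt_strip w (fun y s => G s y) (fun y s => Gy s y) 0 y); auto. lra.
    + apply ex_RInt_cont. intros; now apply continuity_2d_pt_continuous1.
Qed.

Section Rad.

Variables (R0 eps : R).
Hypothesis HR0 : 0 < R0.

Lemma rad_ge y : R0 <= y -> R0 <= rad R0 eps y.
Proof. intros Hy. unfold rad. assert (H := sqrt_pos eps). nra. Qed.

Lemma rad_gt y : 0 < eps -> R0 < y -> R0 < rad R0 eps y.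
Proof. intros He Hy. unfold rad. assert (H := sqrt_lt_R0 eps He). nra. Qed.

Lemma rad_derive y : is_derive (rad R0 eps) y (sqrt eps).
Proof. unfold rad. auto_derive; [exact I|ring]. Qed.

Lemma rad_le y : eps <= 1 -> R0 <= y -> rad R0 eps y <= y.
Proof.
  intros He Hy. unfold rad.
  assert (sqrt eps <= 1) by (rewrite <- sqrt_1; now apply sqrt_le_1_alt). nra.
Qed.

(** Derivatives at [y = R0] are two-sided, so dividing by the radius must also make sense slightly
    below [R0]. *)
Lemma rad_pos_near y : R0 <= y -> locally y (fun t => 0 < rad R0 eps t).
Proof.
  intros Hy. assert (He := sqrt_pos eps).
  assert (Hp : 0 < R0 / (sqrt eps + 1)) by (apply Rdiv_lt_0_compat; lra).
  apply (locally_interval _ (y - R0 / (sqrt eps + 1)) (y + 1)); [lra|]. intros z Hz.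
  assert (E : R0 / (sqrt eps + 1) * (sqrt eps + 1) = R0) by (field; lra).
  unfold rad. nra.
Qed.

Lemma is_derive_rad (h hr : R -> R) y :
  is_derive h (rad R0 eps y) (hr (rad R0 eps y)) ->
  is_derive (fun t => h (rad R0 eps t)) y (sqrt eps * hr (rad R0 eps y)).
Proof. intros H. apply (is_derive_comp h (rad R0 eps)); [exact H|apply rad_derive]. Qed.

Lemma continuity_2d_pt_rad h w y : continuity_2d_pt h w (rad R0 eps y) ->
  continuity_2d_pt (fun w y => h w (rad R0 eps y)) w y.
Proof.
  intros H. apply (continuity_2d_pt_comp h (fun w => w) (rad R0 eps)); [exact H| |].
  - apply continuity_pt_id.
  - apply is_derive_continuity_pt with (1 := rad_derive y).
Qed.

End Rad.

(* [Q] is [u_e^1], [L0] is the [r]-derivative of [u_e^0], [Upy] is [u^0_{pR}],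
   [Vw] is [v^0_{p omega}], and [Z] is [v_e^1 - V_{b1}]. *)
Record profile_bounds (R0 th eps C : R)
  (Us Usw Vs Q Qy L0 Upy Vw Z Zw : R -> R -> R) : Prop := {
  pb_us_w : forall w y, R0 <= y -> is_derive (fun s => Us s y) w (Usw w y);
  pb_us_y : forall w y, R0 <= y ->
    d2 Us w y = sqrt eps * L0 w y + Upy w y + sqrt eps * Qy w y;
  pb_rvs_y : forall w y, R0 <= y ->
    is_derive (fun t => rad R0 eps t * Vs w t) y (- Usw w y);
  pb_vs_w : forall w y, R0 <= y -> d1 Vs w y = Vw w y + Zw w y;
  pb_Q_y : forall w y, R0 <= y -> is_derive (Q w) y (Qy w y);
  pb_Z_w : forall w y, R0 <= y -> is_derive (fun s => Z s y) w (Zw w y);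
  pb_cont : cont_strip R0 Us /\ cont_strip R0 Usw /\ cont_strip R0 Vs /\
    cont_strip R0 Q /\ cont_strip R0 Qy /\ cont_strip R0 Z /\ cont_strip R0 Zw /\
    cont_strip R0 L0 /\ cont_strip R0 Upy /\ cont_strip R0 Vw;
  pb_Z_th : forall y, R0 <= y -> Z th y = 0;
  pb_us_pos : forall y, R0 < y -> 0 <= Us th y;
  pb_bound : forall w y, 0 < w < th -> R0 < y ->
    Rabs (Us w y) <= C /\ Rabs (Usw w y) <= C / th /\ Rabs (Vs w y) <= C /\
    Rabs (Q w y) * rad R0 eps y <= C /\ Rabs (L0 w y) * rad R0 eps y <= C /\
    Rabs (Upy w y) * (1 + y) ^ 2 <= C /\ Rabs (Vw w y) <= C /\ Rabs (Z w y) <= C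
}.

(** * The Prandtl profile *)

Lemma exp_mult_pow x n : exp x ^ n = exp (INR n * x).
Proof.
  induction n as [|n IH]; [now rewrite Rmult_0_l, exp_0|].
  rewrite S_INR, Rmult_plus_distr_r, exp_plus, Rmult_1_l, <- IH. simpl. ring.
Qed.

(** Apply [1 + x <= exp x] to [x = a * r / n] and raise to the power [n]; for [n = 0] the right-hand
    side is 1. *)
Lemma pow_exp_bound a n r : 0 < a -> 0 <= r -> r ^ n * exp (- (a * r)) <= (INR n / a) ^ n.
Proof.
  intros Ha Hr. destruct n as [|n].
  - simpl. rewrite Rmult_1_l, <- exp_0.
    destruct (Req_dec r 0) as [->|H]; [rewrite Rmult_0_r, Ropp_0; lra|].
    left. apply exp_increasing. nra.
  - assert (Hn : 0 < INR (S n)) by (apply lt_0_INR; lia).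
    set (m := INR (S n)) in *.
    assert (H1 : r <= m / a * exp (a * r / m)).
    { assert (H := exp_ineq1_le (a * r / m)).
      apply Rle_trans with (m / a * (a * r / m)); [right; field; lra|].
      apply Rmult_le_compat_l; [|lra]. left; now apply Rdiv_lt_0_compat. }
    apply Rle_trans with ((m / a * exp (a * r / m)) ^ S n * exp (- (a * r))).
    + apply Rmult_le_compat_r; [left; apply exp_pos|]. apply pow_incr. lra.
    + rewrite Rpow_mult_distr, Rmult_assoc.
      replace (exp (a * r / m) ^ S n) with (exp (a * r)).
      * rewrite <- exp_plus, Rplus_opp_r, exp_0. lra.
      * rewrite exp_mult_pow. f_equal. fold m. field. lra.
Qed.

(** The constant involves [f] only through [K] and [a]. This uniformity is essential for the side
    data, which vary with theta0. *)
Lemma decay_bound R0 K a f k n r :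
  0 < R0 -> 0 < a k -> exp_decay_by R0 K a f -> R0 <= r ->
  Rabs (Derive_n f k r) * r ^ n <= Rabs (K k) * (INR n / a k) ^ n.
Proof.
  intros HR Ha Hf Hr.
  assert (H0 := pow_exp_bound (a k) n r Ha ltac:(lra)).
  assert (0 <= r ^ n) by (apply pow_le; lra).
  apply Rle_trans with (Rabs (K k) * exp (- (a k * r)) * r ^ n).
  - apply Rmult_le_compat_r; [assumption|].
    eapply Rle_trans; [now apply Hf|]. apply Rmult_le_compat_r; [left; apply exp_pos|apply RRle_abs].
  - rewrite Rmult_assoc. apply Rmult_le_compat_l; [apply Rabs_pos|]. lra.
Qed.

(** The index counts omega-derivatives: [up_tail up 1] is r v_p^0, and [up_tail up 2],
    [up_tail up 3] are its first two omega-derivatives. Taken at [R0] and divided by [R0], they give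
    the derivatives of the wall trace [vpw]. *)
Definition up_tail (up : R -> R -> R) i w y := tail (partial_derive i 0 up w) y.

Section Prandtl.

Context {R0 ub thetabar : R} {ue0 ubar0 : R -> R} {up : R -> R -> R}.
Hypothesis HR0 : 0 < R0.
Hypothesis Hp : prandtl0 R0 ub thetabar ue0 ubar0 up.

Lemma up_partial_class i k : class_C k (partial_derive i 0 up).
Proof.
  revert k. induction i as [|i IH]; intros k.
  - exact (p0_smooth _ _ _ _ _ _ Hp k).
  - exact (proj1 (class_C_d1 k _ (IH (S k)))).
Qed.

Lemma up_partial_derive i w y :
  is_derive (fun s => partial_derive i 0 up s y) w (partial_derive (S i) 0 up w y).
Proof. exact (proj2 (class_C_d1 0 _ (up_partial_class i 1)) w y). Qed.

Lemma up_partial_bound i j n : exists M, 0 <= M /\ forall w y, R0 <= y ->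
  Rabs (partial_derive i j up w y) * (1 + y) ^ n <= M.
Proof.
  destruct (p0_decay _ _ _ _ _ _ Hp i j n) as [M HM].
  exists M. split; [|exact HM].
  eapply Rle_trans; [|apply (HM 0 R0); lra].
  apply Rmult_le_pos; [apply Rabs_pos|apply pow_le; lra].
Qed.

Lemma up_partial_continuous i w y : continuous (partial_derive i 0 up w) y.
Proof.
  apply (continuity_2d_pt_continuous2 (partial_derive i 0 up)).
  apply (class_C_cont 0), up_partial_class.
Qed.

Lemma up_tail_bound i : exists M, 0 <= M /\ forall w y, R0 <= y -> Rabs (up_tail up i w y) <= M.
Proof.
  destruct (up_partial_bound i 0 2) as [M [HM H]]. exists M. split; [exact HM|].
  intros w y Hy. eapply Rle_trans.
  - apply (tail_bound R0 M (partial_derive i 0 up w)); auto.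
    apply up_partial_continuous.
  - apply Rmult_le_reg_r with (1 + y); [lra|]. unfold Rdiv. rewrite Rmult_assoc, Rinv_l by lra. nra.
Qed.

Lemma up_tail_dy i w y : is_derive (up_tail up i w) y (- partial_derive i 0 up w y).
Proof.
  destruct (up_partial_bound i 0 2) as [M [HM H]].
  apply (is_derive_tail R0 M); auto. apply up_partial_continuous.
Qed.

Lemma up_tail_dw i w y : R0 <= y ->
  is_derive (fun s => up_tail up i s y) w (up_tail up (S i) w y).
Proof.
  intros Hy.
  destruct (up_partial_bound i 0 2) as [M0 [HM0 H0]].
  destruct (up_partial_bound (S i) 0 2) as [M1 [HM1 H1]].
  destruct (up_partial_bound (S (S i)) 0 2) as [M2 [HM2 H2]].
  apply (is_derive_tail_param (partial_derive i 0 up) (partial_derive (S i) 0 up)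
    (partial_derive (S (S i)) 0 up) R0 (M0 + M1 + M2)); auto.
  - apply up_partial_continuous.
  - apply up_partial_continuous.
  - intros w' y' Hy'. specialize (H0 w' y' Hy'). lra.
  - intros w' y' Hy'. specialize (H1 w' y' Hy'). lra.
  - intros w' y' Hy'. specialize (H2 w' y' Hy'). lra.
  - intros; apply up_partial_derive.
  - intros; apply up_partial_derive.
Qed.

(** The [y]-derivative is explicit and continuous, hence the exchange of the variables; in the angle
    differentiability of the tail is enough. *)
Lemma up_tail_cont i : cont_strip R0 (up_tail up i).
Proof.
  intros w y Hy. apply continuity_2d_pt_swap.
  apply continuity_2d_pt_primitive with (fun s t => - partial_derive i 0 up t s).
  - intros s t. apply up_tail_dy.
  - apply continuity_2d_pt_opp, continuity_2d_pt_swap, (class_C_cont 0), up_partial_class.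
  - apply is_derive_continuity_pt with (1 := up_tail_dw i w y Hy).
Qed.

Lemma vpw_derive w : is_derive (vpw R0 up) w (up_tail up 2 w R0 / R0).
Proof.
  apply (is_derive_scal_l (fun s => up_tail up 1 s R0) w (up_tail up 2 w R0) (/ R0)).
  apply up_tail_dw; lra.
Qed.

Lemma vpw_derive2 w : is_derive (fun s => up_tail up 2 s R0 / R0) w (up_tail up 3 w R0 / R0).
Proof.
  apply (is_derive_scal_l (fun s => up_tail up 2 s R0) w (up_tail up 3 w R0) (/ R0)).
  apply up_tail_dw; lra.
Qed.

Lemma vpw_bounds : exists M, 0 < M /\ forall w, Rabs (vpw R0 up w) <= M /\
  Rabs (up_tail up 2 w R0 / R0) <= M /\ Rabs (up_tail up 3 w R0 / R0) <= M.
Proof.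
  destruct (up_tail_bound 1) as [M1 [H1 B1]]. destruct (up_tail_bound 2) as [M2 [H2 B2]].
  destruct (up_tail_bound 3) as [M3 [H3 B3]].
  exists ((M1 + M2 + M3) / R0 + 1).
  assert (HR : 0 < / R0) by now apply Rinv_0_lt_compat.
  split; [assert (0 <= (M1 + M2 + M3) / R0) by (apply Rmult_le_pos; lra); lra|].
  intros w. specialize (B1 w R0 (Rle_refl _)). specialize (B2 w R0 (Rle_refl _)).
  specialize (B3 w R0 (Rle_refl _)).
  change (vpw R0 up w) with (up_tail up 1 w R0 / R0).
  unfold Rdiv. rewrite !Rabs_mult, (Rabs_pos_eq (/ R0)) by lra.
  repeat split; nra.
Qed.

End Prandtl.

(** * The Euler correction *)

Section Euler.

Variables (R0 ub thetabar : R) (ue0 ubar0 ub1 chi0 : R -> R) (up : R -> R -> R).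
Variables (K a : nat -> R).
Hypothesis Hdata : profile_data R0 ub ue0 ubar0 ub1 chi0.
Hypothesis Hp : prandtl0 R0 ub thetabar ue0 ubar0 up.
Hypothesis Hvp0 : vpw R0 up 0 <> 0.
Hypothesis Ha : forall k, 0 < a k.

Let HR0 : 0 < R0 := pd_R0 _ _ _ _ _ _ Hdata.

Definition euler_coef (r : R) : R := r * Derive_n ue0 2 r / ue0 r + Derive ue0 r / ue0 r.

(** In the variable ln r the coefficient appears multiplied by [r]. The decay of the derivatives of
    [ue0] compensates the weights [r ^ 2] and [r], and [ue0] stays away from 0. *)
Lemma euler_coef_bound : exists beta, 0 <= beta /\ forall r, R0 <= r ->
  Rabs (r * euler_coef r) <= beta.
Proof.
  destruct (pd_ue0_decay _ _ _ _ _ _ Hdata) as (Ku & au & Hau & Hu).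
  destruct (pd_ue0_pos _ _ _ _ _ _ Hdata) as (m & Hm & Hum).
  set (c1 := Rabs (Ku 1%nat) * (INR 2 / au 1%nat) ^ 2).
  set (c0 := Rabs (Ku 0%nat) * (INR 1 / au 0%nat) ^ 1).
  assert (B : forall r, R0 <= r -> Rabs (Derive_n ue0 2 r) * r ^ 2 <= c1 /\
                                  Rabs (Derive ue0 r) * r ^ 1 <= c0).
  { intros r Hr. split.
    - exact (decay_bound R0 Ku au (Derive ue0) 1 2 r HR0 (Hau _) Hu Hr).
    - exact (decay_bound R0 Ku au (Derive ue0) 0 1 r HR0 (Hau _) Hu Hr). }
  assert (0 <= c0 /\ 0 <= c1).
  { destruct (B R0 (Rle_refl _)) as [B1 B2].
    split; (eapply Rle_trans; [|eassumption]); (apply Rmult_le_pos; [apply Rabs_pos|apply pow_le; lra]). }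
  assert (Hmi : 0 < / m) by now apply Rinv_0_lt_compat.
  exists ((c1 + c0) / m). split; [apply Rmult_le_pos; lra|].
  intros r Hr. destruct (B r Hr) as [B1 B2]. specialize (Hum r Hr).
  unfold euler_coef.
  replace (r * (r * Derive_n ue0 2 r / ue0 r + Derive ue0 r / ue0 r))
    with ((Derive_n ue0 2 r * r ^ 2 + Derive ue0 r * r ^ 1) * / ue0 r) by (field; lra).
  rewrite Rabs_mult. unfold Rdiv.
  assert (0 < / ue0 r) by (apply Rinv_0_lt_compat; lra).
  apply Rmult_le_compat; try apply Rabs_pos.
  - eapply Rle_trans; [apply Rabs_triang|].
    rewrite !Rabs_mult, (Rabs_pos_eq (r ^ 2)), (Rabs_pos_eq (r ^ 1)) by (apply pow_le; lra). lra.
  - rewrite Rabs_pos_eq by lra. apply Rinv_le_contravar; lra.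
Qed.

Lemma chi0_bound : exists C, 0 <= C /\ forall t, 0 <= t -> Rabs (chi0 t) <= C.
Proof.
  assert (Hc : forall t, 0 <= t <= 1 -> continuity_pt (fun t => Rabs (chi0 t)) t).
  { intros t _. apply (continuity_pt_comp chi0 Rabs).
    - apply is_derive_continuity_pt with (1 := smooth_derive chi0 0 (pd_chi0_smooth _ _ _ _ _ _ Hdata) t).
    - apply Rcontinuity_abs. }
  destruct (continuity_ab_maj _ 0 1 Rle_0_1 Hc) as [tm [H1 H2]].
  exists (Rabs (chi0 tm)). split; [apply Rabs_pos|]. intros t Ht.
  destruct (Rle_dec t 1) as [Ht1|Ht1]; [now apply H1|].
  rewrite (pd_chi0_supp _ _ _ _ _ _ Hdata t) by lra. rewrite Rabs_R0. apply Rabs_pos.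
Qed.


(** The powers of [r] are distributed so that each side datum appears with a weight that its decay
    controls. [A2] and [B2] are the second omega-derivatives of [A] and [B]; their terms with
    [2 / th] are the cross terms of the linear interpolation weights and cause the loss in the
    angle. *)
Lemma eulerF_formula th Vb0 Vb1 w r : 0 < r ->
  smooth Vb0 -> smooth Vb1 -> th <> 0 -> vpw R0 up th <> 0 ->
  let q := vpw R0 up in
  let q' := up_tail up 2 w R0 / R0 in
  let q'' := up_tail up 3 w R0 / R0 in
  let A := (1 - w / th) * (q w / q 0) in
  let B := w / th * (q w / q th) in
  let A2 := (- (2 / th) * q' + (1 - w / th) * q'') / q 0 in
  let B2 := (2 / th * q' + w / th * q'') / q th in
  r ^ 2 * eulerF R0 th ue0 up Vb0 Vb1 w r =
    - (A * (Derive_n Vb0 2 r * r ^ 3) + B * (Derive_n Vb1 2 r * r ^ 3))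
    - 3 * (A * (Derive_n Vb0 1 r * r ^ 2) + B * (Derive_n Vb1 1 r * r ^ 2))
    - (A2 * (Derive_n Vb0 0 r * r ^ 1) + B2 * (Derive_n Vb1 0 r * r ^ 1))
    + (r * euler_coef r - 2)
      * (A * (Derive_n Vb0 0 r * r ^ 1) + B * (Derive_n Vb1 0 r * r ^ 1)).
Proof.
  intros Hr S0 S1 Hth Hq1 q q' q'' A B A2 B2.
  assert (Dq := vpw_derive HR0 Hp).
  assert (Dq2 := vpw_derive2 HR0 Hp).
  assert (EB1 : forall n t, is_derive (fun t => (1 - w / th) * (q w / q 0) * Derive_n Vb0 n t
      + w / th * (q w / q th) * Derive_n Vb1 n t) t (A * Derive_n Vb0 (S n) t + B * Derive_n Vb1 (S n) t)).
  { intros n t. apply @is_derive_plus; apply is_derive_scal; now apply smooth_derive. }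
  assert (E2 : forall t, d2 (eulerB R0 th up Vb0 Vb1) w t = A * Derive_n Vb0 1 t + B * Derive_n Vb1 1 t)
    by (intros t; apply is_derive_unique, (EB1 0%nat)).
  assert (E22 : d2 (d2 (eulerB R0 th up Vb0 Vb1)) w r = A * Derive_n Vb0 2 r + B * Derive_n Vb1 2 r).
  { transitivity (Derive (fun t => A * Derive_n Vb0 1 t + B * Derive_n Vb1 1 t) r);
      [now apply Derive_ext|]. apply is_derive_unique, (EB1 1%nat). }
  set (p := fun s => up_tail up 2 s R0 / R0) in *.
  assert (Eq : forall s, Derive (fun x => q x) s = p s) by (intros; now apply is_derive_unique).
  assert (Ep : forall s, Derive (fun x => p x) s = up_tail up 3 s R0 / R0)
    by (intros; now apply is_derive_unique).
  assert (Xq : forall s, ex_derive (fun x => q x) s) by (intros s; exists (p s); apply Dq).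
  assert (Xp : forall s, ex_derive (fun x => p x) s) by (intros s; eexists; apply Dq2).
  assert (E1 : forall s, d1 (eulerB R0 th up Vb0 Vb1) s r =
     (- / th * q s + (1 - s / th) * p s) / q 0 * Vb0 r
     + (/ th * q s + s / th * p s) / q th * Vb1 r).
  { intros s. apply is_derive_unique. unfold eulerB. fold q. auto_derive.
    - repeat split; exact I || apply Xq.
    - rewrite Eq. field. repeat split; assumption. }
  assert (E11 : d1 (d1 (eulerB R0 th up Vb0 Vb1)) w r = A2 * Vb0 r + B2 * Vb1 r).
  { etransitivity; [now apply Derive_ext, E1|]. apply is_derive_unique. auto_derive.
    - repeat split; exact I || apply Xq || apply Xp.
    - rewrite Eq, Ep. unfold A2, B2. fold q' q''. change (p w) with q'. field. repeat split; assumption. }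
  unfold eulerF, eulerL, laplace_polar. fold (euler_coef r).
  rewrite E2, E22, E11. unfold eulerB. fold q. fold A B. simpl. field. lra.
Qed.

Lemma Rabs_combine A B x y m c : Rabs A <= m -> Rabs B <= m -> Rabs x <= c -> Rabs y <= c ->
  Rabs (A * x + B * y) <= 2 * (m * c).
Proof.
  intros HA HB Hx Hy. eapply Rle_trans; [apply Rabs_triang|]. rewrite !Rabs_mult.
  assert (Rabs A * Rabs x <= m * c) by (apply Rmult_le_compat; try apply Rabs_pos; assumption).
  assert (Rabs B * Rabs y <= m * c) by (apply Rmult_le_compat; try apply Rabs_pos; assumption).
  lra.
Qed.

Lemma side_bound : exists c, 0 <= c /\ forall V, exp_decay_by R0 K a V -> forall r, R0 <= r ->
  Rabs (Derive_n V 0 r * r ^ 0) <= c /\ Rabs (Derive_n V 0 r * r ^ 1) <= c /\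
  Rabs (Derive_n V 1 r * r ^ 2) <= c /\ Rabs (Derive_n V 2 r * r ^ 3) <= c.
Proof.
  set (c := fun k n => Rabs (K k) * (INR n / a k) ^ n).
  assert (Hc : forall k n, 0 <= c k n).
  { intros k n. apply Rmult_le_pos; [apply Rabs_pos|]. apply pow_le.
    apply Rmult_le_pos; [apply pos_INR|left; apply Rinv_0_lt_compat, Ha]. }
  exists (c 0%nat 0%nat + c 0%nat 1%nat + c 1%nat 2%nat + c 2%nat 3%nat).
  assert (C1 := Hc 0%nat 0%nat). assert (C2 := Hc 0%nat 1%nat).
  assert (C3 := Hc 1%nat 2%nat). assert (C4 := Hc 2%nat 3%nat).
  split; [lra|]. intros V HV r Hr.
  assert (B : forall k n, Rabs (Derive_n V k r * r ^ n) <= c k n).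
  { intros k n. rewrite Rabs_mult, (Rabs_pos_eq (r ^ n)) by (apply pow_le; lra).
    now apply decay_bound with R0. }
  repeat split; (eapply Rle_trans; [apply B|lra]).
Qed.

(* The second [omega]-derivative of the corrector costs a factor [1 / theta0]. *)
Lemma eulerE_bound : exists ths C, 0 < ths /\ 0 <= C /\
  forall th eps K1 Vb0 Vb1, 0 < th <= ths -> 0 < eps ->
  euler_side_data R0 th up K a K1 Vb0 Vb1 ->
  forall w r, 0 <= w <= th -> R0 <= r ->
  Rabs (r ^ 2 * eulerE R0 th eps ue0 chi0 up Vb0 Vb1 w r) <= C / th.
Proof.
  destruct (vpw_bounds HR0 Hp) as (Mq & HMq & BMq).
  destruct euler_coef_bound as (beta & Hbeta & Bbeta).
  destruct chi0_bound as (X & HX & BX).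
  destruct side_bound as (c & Hc & Bc).
  set (q := vpw R0 up) in *.
  assert (Hq0 : 0 < Rabs (q 0)) by now apply Rabs_pos_lt.
  set (k := 2 / Rabs (q 0)).
  assert (Hk : 0 < k) by (apply Rdiv_lt_0_compat; lra).
  (* The corrector divides by [q th]. Below this angle the mean value theorem keeps [q th] at least
     half as large as [q 0], so that [k] bounds both inverses. *)
  set (ths := Rmin 1 (Rabs (q 0) / (2 * Mq))).
  assert (Hths : 0 < ths) by (apply Rmin_glb_lt; [lra|apply Rdiv_lt_0_compat; lra]).
  set (S := Mq * k * c).
  assert (HS : 0 <= S) by (unfold S; apply Rmult_le_pos; [nra|lra]).
  (* Term by term: [2 * S] with the weight [r ^ 3], [6 * S] with [r ^ 2], [(beta + 2) * (2 * S)] for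
     the zero order term and [6 * S / th] for the omega-derivatives. *)
  set (F0 := (18 + 2 * beta) * S).
  exists ths, (2 * (X * F0)). split; [exact Hths|].
  assert (HF0 : 0 <= F0) by (unfold F0; nra).
  split; [nra|].
  intros th eps K1 Vb0 Vb1 [Hth Hths1] Heps Hsd w0 r Hw0 Hr.
  assert (Hth1 : th <= 1) by (eapply Rle_trans; [exact Hths1|apply Rmin_l]).
  assert (Hthq : th * Mq <= Rabs (q 0) / 2).
  { assert (H : th <= Rabs (q 0) / (2 * Mq)) by (eapply Rle_trans; [exact Hths1|apply Rmin_r]).
    apply Rmult_le_compat_r with (r := Mq) in H; [|lra].
    replace (Rabs (q 0) / (2 * Mq) * Mq) with (Rabs (q 0) / 2) in H by (field; lra). exact H. }
  assert (Hq1 : Rabs (q 0) / 2 <= Rabs (q th)).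
  { destruct (mvt_abs q (fun s => up_tail up 2 s R0 / R0) 0 th) as [z [_ Hz]].
    { intros z _. exact (vpw_derive HR0 Hp z). }
    assert (Hz2 : Rabs (q th - q 0) <= Mq * th).
    { rewrite Hz, Rabs_mult, (Rabs_pos_eq (th - 0)), Rminus_0_r by lra.
      apply Rmult_le_compat_r; [lra|]. exact (proj1 (proj2 (BMq z))). }
    assert (Ht := Rabs_triang (q th) (- (q th - q 0))). rewrite Rabs_Ropp in Ht.
    replace (q th + - (q th - q 0)) with (q 0) in Ht by ring. lra. }
  assert (Hqth : q th <> 0) by (intros E; rewrite E, Rabs_R0 in Hq1; lra).
  assert (Hk0 : Rabs (/ q 0) <= k).
  { rewrite Rabs_inv. unfold k. assert (0 < / Rabs (q 0)) by now apply Rinv_0_lt_compat. lra. }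
  assert (Hk1 : Rabs (/ q th) <= k).
  { rewrite Rabs_inv. unfold k. replace (2 / Rabs (q 0)) with (/ (Rabs (q 0) / 2)) by (field; lra).
    apply Rinv_le_contravar; lra. }
  assert (Hr0 : 0 < r) by lra.
  destruct Hsd as [S0 S1 D0 D1 _ _ _].
  destruct (Bc Vb0 D0 r Hr) as (_ & V01 & V02 & V03).
  destruct (Bc Vb1 D1 r Hr) as (_ & V11 & V12 & V13).
  assert (Hti : 1 <= / th) by (rewrite <- Rinv_1; apply Rinv_le_contravar; lra).
  assert (HF : forall w, 0 <= w <= th ->
    Rabs (r ^ 2 * eulerF R0 th ue0 up Vb0 Vb1 w r) <= F0 / th).
  { intros w Hw. rewrite eulerF_formula by (assumption || lra).
    destruct (BMq w) as (Q0 & Q1 & Q2). fold q.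
    assert (Hwt : 0 <= w / th <= 1).
    { split; [apply Rmult_le_pos; lra|].
      apply Rmult_le_reg_r with th; [lra|]. unfold Rdiv. rewrite Rmult_assoc, Rinv_l; lra. }
    set (q' := up_tail up 2 w R0 / R0) in *. set (q'' := up_tail up 3 w R0 / R0) in *.
    assert (unit_mult : forall s z, 0 <= s <= 1 -> Rabs z <= Mq -> Rabs (s * z) <= Mq).
    { intros s z Hs Hz. rewrite Rabs_mult, (Rabs_pos_eq s) by lra.
      assert (H0 : 0 <= Rabs z) by apply Rabs_pos.
      apply Rle_trans with (1 * Rabs z); [apply Rmult_le_compat_r; lra|lra]. }
    assert (inv_mult : forall z m p, Rabs z <= m -> Rabs (/ p) <= k -> Rabs (z / p) <= m * k).
    { intros z m p Hz Hpk. unfold Rdiv. rewrite Rabs_mult.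
      apply Rmult_le_compat; try apply Rabs_pos; assumption. }
    assert (A0 : Rabs ((1 - w / th) * (q w / q 0)) <= Mq * k).
    { replace ((1 - w / th) * (q w / q 0)) with ((1 - w / th) * q w / q 0) by (unfold Rdiv; ring).
      apply inv_mult; [|exact Hk0]. apply unit_mult; [lra|exact Q0]. }
    assert (B0 : Rabs (w / th * (q w / q th)) <= Mq * k).
    { replace (w / th * (q w / q th)) with (w / th * q w / q th) by (unfold Rdiv; ring).
      apply inv_mult; [|exact Hk1]. apply unit_mult; [lra|exact Q0]. }
    assert (T2 : Rabs (2 / th * q') <= 2 / th * Mq).
    { rewrite Rabs_mult, Rabs_pos_eq by (apply Rmult_le_pos; lra).
      apply Rmult_le_compat_l; [apply Rmult_le_pos; lra|exact Q1]. }
    assert (Hm : 2 / th * Mq + Mq <= 3 * Mq / th).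
    { assert (Mq * 1 <= Mq * / th) by (apply Rmult_le_compat_l; lra). unfold Rdiv. lra. }
    assert (A2 : Rabs ((- (2 / th) * q' + (1 - w / th) * q'') / q 0) <= 3 * Mq / th * k).
    { apply inv_mult; [|exact Hk0]. eapply Rle_trans; [apply Rabs_triang|].
      replace (- (2 / th) * q') with (- (2 / th * q')) by ring. rewrite Rabs_Ropp.
      assert (H := unit_mult (1 - w / th) q'' ltac:(lra) Q2). lra. }
    assert (B2 : Rabs ((2 / th * q' + w / th * q'') / q th) <= 3 * Mq / th * k).
    { apply inv_mult; [|exact Hk1]. eapply Rle_trans; [apply Rabs_triang|].
      assert (H := unit_mult (w / th) q'' ltac:(lra) Q2). lra. }
    assert (R3 := Rabs_combine _ _ _ _ _ _ A0 B0 V03 V13).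
    assert (R2 := Rabs_combine _ _ _ _ _ _ A0 B0 V02 V12).
    assert (R1 := Rabs_combine _ _ _ _ _ _ A0 B0 V01 V11).
    assert (R0' := Rabs_combine _ _ _ _ _ _ A2 B2 V01 V11).
    fold S in R3, R2, R1.
    replace (3 * Mq / th * k * c) with (3 * S / th) in R0' by (unfold S, Rdiv; ring).
    assert (Hco : Rabs (r * euler_coef r - 2) <= beta + 2).
    { eapply Rle_trans; [apply Rabs_triang|]. rewrite Rabs_Ropp, (Rabs_pos_eq 2) by lra.
      assert (H := Bbeta r Hr). lra. }
    match goal with |- Rabs (- ?x3 - 3 * ?x2 - ?x1 + ?co * ?x0) <= _ =>
      assert (Hx : Rabs (co * x0) <= (beta + 2) * (2 * S))
        by (rewrite Rabs_mult; apply Rmult_le_compat; try apply Rabs_pos; assumption);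
      apply Rabs_le_between in R3; apply Rabs_le_between in R2; apply Rabs_le_between in R0';
      apply Rabs_le_between in Hx;
      assert (Hfin : 8 * S + (beta + 2) * (2 * S) + 2 * (3 * S / th) <= F0 / th);
      [|apply Rabs_le; lra]
    end.
    unfold F0, Rdiv. assert (H0 : 0 <= beta * S) by now apply Rmult_le_pos.
    assert (S * 1 <= S * / th) by (apply Rmult_le_compat_l; lra).
    assert (beta * S * 1 <= beta * S * / th) by (apply Rmult_le_compat_l; lra). lra. }
  unfold eulerE.
  replace (r ^ 2 * (chi0 (w0 / eps) * eulerF R0 th ue0 up Vb0 Vb1 0 r
     + chi0 ((th - w0) / eps) * eulerF R0 th ue0 up Vb0 Vb1 th r))
    with (chi0 (w0 / eps) * (r ^ 2 * eulerF R0 th ue0 up Vb0 Vb1 0 r)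
     + chi0 ((th - w0) / eps) * (r ^ 2 * eulerF R0 th ue0 up Vb0 Vb1 th r)) by ring.
  assert (0 < / eps) by now apply Rinv_0_lt_compat.
  eapply Rle_trans.
  - apply Rabs_combine with (m := X) (c := F0 / th); try (apply HF; lra);
      apply BX; apply Rmult_le_pos; lra.
  - right. unfold Rdiv. ring.
Qed.

(** The wall condition holds on a whole interval of angles, so it can be differentiated twice along
    the wall; this supplies the bound [Q] of the gradient estimate. *)
Lemma euler_wall_d11 th eps Vb0 Vb1 ve x :
  euler1 R0 th eps ue0 chi0 up Vb0 Vb1 ve -> 0 < x < th ->
  d1 (d1 ve) x R0 = - (up_tail up 3 x R0 / R0).
Proof.
  intros He Hx.
  assert (Hw := e1_wall _ _ _ _ _ _ _ _ _ He).
  assert (E1 : forall s, 0 < s < th -> d1 ve s R0 = - (up_tail up 2 s R0 / R0)).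
  { intros s Hs. apply is_derive_unique.
    apply is_derive_ext_loc with (fun w => - vpw R0 up w).
    - apply (locally_interval _ 0 th); [exact Hs|]. intros z Hz. symmetry. apply Hw. lra.
    - apply @is_derive_opp, (vpw_derive HR0 Hp). }
  apply is_derive_unique. apply is_derive_ext_loc with (fun w => - (up_tail up 2 w R0 / R0)).
  - apply (locally_interval _ 0 th); [exact Hx|]. intros z Hz. symmetry. now apply E1.
  - apply @is_derive_opp, (vpw_derive2 HR0 Hp).
Qed.

(** In the variable t = ln r the derivative of r V is r V + r^2 V', which the decay of the side data
    bounds by [2 * c]. *)
Lemma exp_side_lipschitz V c : smooth V ->
  (forall r, R0 <= r -> Rabs (Derive_n V 0 r * r ^ 1) <= c /\ Rabs (Derive_n V 1 r * r ^ 2) <= c) ->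
  forall s t, R0 <= exp s -> s <= t ->
  Rabs (exp t * V (exp t) - exp s * V (exp s)) <= 2 * c * (t - s).
Proof.
  intros HS HV s t Hs Hst.
  destruct (mvt_abs (fun t => exp t * V (exp t))
    (fun t => Derive_n V 0 (exp t) * exp t ^ 1 + Derive_n V 1 (exp t) * exp t ^ 2) s t) as [z [Hz1 Hz2]].
  { intros z _. auto_derive.
    - exists (Derive_n V 1 (exp z)). apply (smooth_derive V 0 HS).
    - simpl. ring. }
  rewrite Rmin_left, Rmax_right in Hz1 by lra.
  rewrite Hz2, Rabs_mult, (Rabs_pos_eq (t - s)) by lra.
  apply Rmult_le_compat_r; [lra|].
  assert (Hze : R0 <= exp z).
  { eapply Rle_trans; [exact Hs|]. destruct (Req_dec s z) as [->|Hne]; [lra|].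
    left. apply exp_increasing. lra. }
  destruct (HV (exp z) Hze) as [H1 H2].
  eapply Rle_trans; [apply Rabs_triang|]. lra.
Qed.

(** The source has size [CE / th]. The sup bound multiplies it by [th ^ 2], so r v_e stays bounded
    uniformly in the angle, whereas the gradient bound keeps the factor [1 / th]. *)
Lemma euler_estimate : exists ths C, 0 < ths <= 1 /\ 0 < C /\
  forall th eps K1 Vb0 Vb1 ve, 0 < th <= ths -> 0 < eps ->
  euler_side_data R0 th up K a K1 Vb0 Vb1 ->
  euler1 R0 th eps ue0 chi0 up Vb0 Vb1 ve ->
  (forall r, R0 <= r -> Rabs (Vb1 r) <= C) /\
  forall w r, 0 <= w <= th -> R0 < r ->
  Rabs (r * ve w r) <= C /\ Rabs (r * (ve w r + r * d2 ve w r)) <= C / th.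
Proof.
  destruct eulerE_bound
    as (ths1 & CE & Hths1 & HCE & BE).
  destruct (vpw_bounds HR0 Hp) as (Mq & HMq & BMq).
  destruct euler_coef_bound as (beta0 & Hbeta0 & Bbeta).
  destruct side_bound as (c & Hc & Bc).
  set (beta := beta0 + 1).
  set (M1 := R0 * Mq + c).
  assert (HM1 : 0 <= M1) by (unfold M1; nra).
  set (B := 2 * c + R0 * Mq + CE + 1 + (4 + 2 * beta) * (M1 + CE)).
  assert (HB : 0 <= (4 + 2 * beta) * (M1 + CE))
    by (apply Rmult_le_pos; unfold beta; lra).
  assert (HRM : 0 < R0 * Mq) by now apply Rmult_lt_0_compat.
  exists (Rmin (Rmin 1 ths1) (/ (2 + 2 * beta))), (B + 2 * (M1 + CE)).
  assert (Hib : 0 < / (2 + 2 * beta)) by (apply Rinv_0_lt_compat; unfold beta; lra).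
  split.
  { split; [repeat apply Rmin_glb_lt; lra|]. eapply Rle_trans; apply Rmin_l. }
  split; [unfold B; lra|].
  intros th eps K1 Vb0 Vb1 ve [Hth Hthle] Heps Hsd He.
  assert (Hth1 : th <= 1 /\ th <= ths1 /\ th <= / (2 + 2 * beta)).
  { assert (H1 := Rmin_l (Rmin 1 ths1) (/ (2 + 2 * beta))).
    assert (H2 := Rmin_r (Rmin 1 ths1) (/ (2 + 2 * beta))).
    assert (H3 := Rmin_l 1 ths1). assert (H4 := Rmin_r 1 ths1). lra. }
  assert (Hsmall : th ^ 2 * (2 + 2 * beta) <= 1).
  { assert (H : th * (2 + 2 * beta) <= 1).
    { apply Rle_trans with (/ (2 + 2 * beta) * (2 + 2 * beta)).
      - apply Rmult_le_compat_r; unfold beta in *; lra.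
      - right. field. unfold beta. lra. }
    replace (th ^ 2 * (2 + 2 * beta)) with (th * (th * (2 + 2 * beta))) by ring.
    apply Rle_trans with (th * 1); [apply Rmult_le_compat_l|]; lra. }
  assert (Hti : 1 <= / th) by (rewrite <- Rinv_1; apply Rinv_le_contravar; lra).
  assert (BEth := BE th eps K1 Vb0 Vb1 (conj Hth (proj1 (proj2 Hth1))) Heps Hsd).
  destruct Hsd as [S0 S1 D0 D1 _ _ _].
  assert (V0 := Bc Vb0 D0). assert (V1 := Bc Vb1 D1).
  split.
  { intros r Hr. destruct (V1 r Hr) as (H & _). simpl in H. rewrite Rmult_1_r in H.
    unfold B, M1. unfold M1 in HB. lra. }
  assert (HC := e1_C2 _ _ _ _ _ _ _ _ _ He).
  destruct (class_C_d1 _ _ HC) as [C1 Dw]. destruct (class_C_d2 _ _ HC) as [C2 Dr].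
  destruct (class_C_d1 _ _ C1) as [_ Dww]. destruct (class_C_d2 _ _ C2) as [_ Drr].
  set (t0 := ln R0).
  assert (Et0 : exp t0 = R0) by now apply exp_ln.
  assert (Hexp : forall t, t0 <= t -> R0 <= exp t).
  { intros t Ht. rewrite <- Et0. destruct (Req_dec t0 t) as [->|Hne]; [lra|].
    left. apply exp_increasing. lra. }
  assert (Hexp' : forall t, t0 < t -> R0 < exp t)
    by (intros t Ht; rewrite <- Et0; now apply exp_increasing).
  (* For r v in the variables (omega, ln r) the first order terms of L cancel: r^2 L v is minus the
     flat Laplacian of [P] plus [(r * euler_coef r - 1) * P]. *)
  set (P := fun x t => exp t * ve x (exp t)).
  set (Px := fun x t => exp t * d1 ve x (exp t)).
  set (Pxx := fun x t => exp t * d1 (d1 ve) x (exp t)).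
  set (Pt := fun x t => exp t * (ve x (exp t) + exp t * d2 ve x (exp t))).
  set (Ptt := fun x t => exp t * (ve x (exp t) + 3 * (exp t * d2 ve x (exp t))
                                + exp t ^ 2 * d2 (d2 ve) x (exp t))).
  set (b := fun t => exp t * euler_coef (exp t) - 1).
  set (G0 := fun x t => exp t ^ 2 * eulerE R0 th eps ue0 chi0 up Vb0 Vb1 x (exp t)).
  assert (Hc1 : forall x t, continuity_2d_pt P x t).
  { intros x t. apply continuity_2d_pt_mult.
    - apply (continuity_2d_pt_snd exp), derivable_continuous_pt, derivable_pt_exp.
    - apply (continuity_2d_pt_comp ve (fun x => x) exp).
      + apply (class_C_cont 2), HC.
      + apply continuity_pt_id.
      + apply derivable_continuous_pt, derivable_pt_exp. }
  assert (HDx : forall x t, is_derive (fun x => P x t) x (Px x t))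
    by (intros; apply is_derive_scal, Dw).
  assert (HDxx : forall x t, is_derive (fun x => Px x t) x (Pxx x t))
    by (intros; apply is_derive_scal, Dww).
  assert (HDt : forall x t, is_derive (P x) t (Pt x t)).
  { intros x t. unfold P, Pt. auto_derive; [eexists; apply Dr|].
    rewrite (is_derive_Derive _ _ _ (Dr x (exp t))). ring. }
  assert (HDtt : forall x t, is_derive (Pt x) t (Ptt x t)).
  { intros x t. unfold Pt, Ptt. auto_derive.
    - split; [eexists; apply Dr|]. split; [eexists; apply Drr|exact I].
    - rewrite (is_derive_Derive _ _ _ (Dr x (exp t))).
      rewrite (is_derive_Derive _ _ _ (Drr x (exp t))). ring. }
  assert (Hbeta : forall t, t0 < t -> Rabs (b t) <= beta).
  { intros t Ht. unfold b, beta. eapply Rle_trans; [apply Rabs_triang|].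
    rewrite Rabs_Ropp, Rabs_R1. assert (H := Bbeta (exp t) (Hexp t ltac:(lra))). lra. }
  assert (HG0 : forall x t, 0 < x < th -> t0 < t -> Rabs (G0 x t) <= CE / th).
  { intros x t Hx Ht. apply BEth; [lra|apply Hexp; lra]. }
  assert (Heq : forall x t, 0 < x < th -> t0 < t ->
    Ptt x t + Pxx x t = b t * P x t - G0 x t).
  { intros x t Hx Ht. unfold G0. assert (Hr := Hexp' t Ht).
    rewrite <- (e1_eq _ _ _ _ _ _ _ _ _ He x (exp t) Hx Hr).
    unfold eulerL, laplace_polar. fold (euler_coef (exp t)).
    unfold Ptt, Pxx, b, P. field. lra. }
  assert (Hwall : forall x, 0 <= x <= th -> Rabs (P x t0) <= M1).
  { intros x Hx. unfold P. rewrite Et0, (e1_wall _ _ _ _ _ _ _ _ _ He x Hx).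
    rewrite Rabs_mult, Rabs_Ropp, (Rabs_pos_eq R0) by lra.
    assert (H := proj1 (BMq x)). unfold M1. nra. }
  assert (Hside : forall t, t0 <= t -> Rabs (P 0 t) <= M1 /\ Rabs (P th t) <= M1).
  { intros t Ht. assert (Hr := Hexp t Ht). unfold P.
    rewrite (e1_side0 _ _ _ _ _ _ _ _ _ He _ Hr), (e1_side1 _ _ _ _ _ _ _ _ _ He _ Hr).
    destruct (V0 _ Hr) as (_ & H0 & _). destruct (V1 _ Hr) as (_ & H1 & _).
    simpl in H0, H1. rewrite Rmult_1_r, Rmult_comm in H0, H1. unfold M1. lra. }
  assert (Hinf : forall eta, 0 < eta -> exists T, forall x t,
    0 <= x <= th -> t0 <= t -> T <= t -> Rabs (P x t) <= eta * exp t).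
  { intros eta Heta. destruct (e1_infty _ _ _ _ _ _ _ _ _ He eta Heta) as [M HM].
    exists M. intros x t Hx Ht HT. unfold P. rewrite Rabs_mult, Rabs_pos_eq by (left; apply exp_pos).
    rewrite Rmult_comm. apply Rmult_le_compat_r; [left; apply exp_pos|].
    apply HM; [exact Hx|now apply Hexp|]. assert (H := exp_ineq1_le t). lra. }
  assert (HCth : 0 <= CE / th) by (apply Rmult_le_pos; lra).
  assert (HthN : th ^ 2 * (CE / th) <= CE).
  { replace (th ^ 2 * (CE / th)) with (th * CE) by (field; lra).
    apply Rle_trans with (1 * CE); [apply Rmult_le_compat_r|]; lra. }
  assert (Hlast : forall r, R0 < r -> exp (ln r) = r /\ t0 < ln r).
  { intros r Hr. split; [apply exp_ln; lra|]. now apply ln_increasing. }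
  intros w r Hw Hr. destruct (Hlast r Hr) as [Er Htr].
  split.
  - assert (H := strip_sup_bound th t0 beta (CE / th) M1 b G0 P Px Pxx Pt Ptt Hth Hsmall HCth
      Hc1 HDx HDxx HDt HDtt Hbeta HG0 Heq Hwall Hside Hinf w (ln r) Hw (Rlt_le _ _ Htr)).
    unfold P in H. rewrite Er in H. unfold B. lra.
  - assert (H := strip_gradient_bound th t0 beta (CE / th) M1 b G0 P Px Pxx Pt Ptt Hth Hsmall HCth
      Hc1 HDx HDxx HDt HDtt Hbeta HG0 Heq Hwall Hside Hinf (R0 * Mq) (2 * c)).
    assert (H' : Rabs (Pt w (ln r)) <= 2 * c + R0 * Mq + CE / th + 1
        + (4 + 2 * beta) * (M1 + th ^ 2 * (CE / th))).
    { apply H; try assumption; try lra.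
      - intros x Hx. unfold Pxx. rewrite Et0, (euler_wall_d11 th eps Vb0 Vb1 ve x He Hx).
        rewrite Rabs_mult, Rabs_Ropp, (Rabs_pos_eq R0) by lra.
        apply Rmult_le_compat_l; [lra|]. exact (proj2 (proj2 (BMq x))).
      - intros s t Hs Hst. assert (Hrs := Hexp s Hs). assert (Hrt := Hexp t (Rle_trans _ _ _ Hs Hst)).
        unfold P. rewrite !(e1_side0 _ _ _ _ _ _ _ _ _ He), !(e1_side1 _ _ _ _ _ _ _ _ _ He) by assumption.
        split; apply exp_side_lipschitz; try assumption; intros r' Hr'.
        + destruct (V0 r' Hr') as (_ & H1 & H2 & _). now split.
        + destruct (V1 r' Hr') as (_ & H1 & H2 & _). now split. }
    unfold Pt in H'. rewrite Er in H'.
    assert (X1 : (4 + 2 * beta) * (M1 + th ^ 2 * (CE / th)) <= (4 + 2 * beta) * (M1 + CE))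
      by (apply Rmult_le_compat_l; unfold beta; lra).
    set (X := (4 + 2 * beta) * (M1 + CE)) in *.
    set (Y := 2 * c + R0 * Mq + 1 + X + 2 * (M1 + CE)).
    assert (HY : Y * 1 <= Y * / th) by (apply Rmult_le_compat_l; unfold Y; lra).
    replace ((B + 2 * (M1 + CE)) / th) with (Y * / th + CE / th) by (unfold B, Y; field; lra).
    unfold Y at 1 in HY. lra.
Qed.

(** There are two regimes. If [sqrt eps * (y - R0) <= s], the radius is close to [R0] and the angle
    close to 0, so the value is close to the inflow profile [ue0 R0 + ubar0 y]. Otherwise [y] is
    large, [up] is small by its decay, and [ue0] alone gives positivity. *)
Lemma inflow_outflow_positive : exists kappa m, 0 < kappa <= 1 /\ 0 < m /\
  forall th eps y, 0 <= th <= kappa -> 0 < eps -> sqrt eps <= kappa -> R0 <= y ->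
  m <= ue0 (rad R0 eps y) + up th y.
Proof.
  destruct (pd_ue0_pos _ _ _ _ _ _ Hdata) as (m1 & Hm1 & Bm1).
  destruct (pd_inflow_pos _ _ _ _ _ _ Hdata) as (m2 & Hm2 & Bm2).
  destruct (pd_ue0_decay _ _ _ _ _ _ Hdata) as (Ku & au & Hau & Hu).
  destruct (up_partial_bound HR0 Hp 0 0 1) as (Mu & HMu & Bu).
  destruct (up_partial_bound HR0 Hp 1 0 0) as (Mw & HMw & Bw).
  set (L := Rabs (Ku 0%nat)).
  assert (HL : 0 <= L) by apply Rabs_pos.
  set (s := m2 / (4 * (L + 1))).
  assert (Hs : 0 < s) by (apply Rdiv_lt_0_compat; lra).
  (* The first threshold keeps the change of [up] across the angle below [m2 / 4], the second makes
     [up] at most [m1 / 2] far from the wall; [s] above keeps the change of [ue0] near the wall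
     below [m2 / 4]. *)
  set (kappa := Rmin 1 (Rmin (m2 / (4 * (Mw + 1))) (m1 * s / (2 * (Mu + 1))))).
  assert (Hk1 : kappa <= 1) by apply Rmin_l.
  assert (Hk2 : kappa <= m2 / (4 * (Mw + 1))) by (eapply Rle_trans; [apply Rmin_r|apply Rmin_l]).
  assert (Hk3 : kappa <= m1 * s / (2 * (Mu + 1))) by (eapply Rle_trans; [apply Rmin_r|apply Rmin_r]).
  assert (Hm1s : 0 < m1 * s) by now apply Rmult_lt_0_compat.
  assert (Hk0 : 0 < kappa).
  { repeat apply Rmin_glb_lt; try lra; apply Rdiv_lt_0_compat; lra. }
  exists kappa, (Rmin (m1 / 2) (m2 / 2)).
  split; [lra|]. split; [apply Rmin_glb_lt; lra|].
  intros th eps y Hth Heps He Hy.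
  assert (Hsq := sqrt_lt_R0 eps Heps).
  assert (Hr := rad_ge R0 eps y Hy).
  destruct (Rle_dec (sqrt eps * (y - R0)) s) as [Hcase|Hcase].
  - eapply Rle_trans; [apply Rmin_r|].
    assert (H0 : m2 <= ue0 R0 + up 0 y) by (rewrite (p0_inflow _ _ _ _ _ _ Hp y Hy); now apply Bm2).
    assert (H1 : Rabs (up th y - up 0 y) <= m2 / 4).
    { destruct (mvt_abs (fun s => up s y) (fun s => partial_derive 1 0 up s y) 0 th) as [z [_ Hz]].
      { intros z _. apply (up_partial_derive Hp 0). }
      rewrite Hz, Rabs_mult, (Rabs_pos_eq (th - 0)), Rminus_0_r by lra.
      assert (Hw := Bw z y Hy). simpl in Hw. rewrite Rmult_1_r in Hw.
      apply Rle_trans with (Mw * (m2 / (4 * (Mw + 1)))).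
      - apply Rmult_le_compat; try lra. apply Rabs_pos.
      - apply Rmult_le_reg_r with (4 * (Mw + 1)); [lra|]. field_simplify; [|lra]. nra. }
    assert (H2 : Rabs (ue0 (rad R0 eps y) - ue0 R0) <= m2 / 4).
    { destruct (mvt_abs ue0 (Derive ue0) R0 (rad R0 eps y)) as [z [Hz1 Hz]].
      { intros z _. apply (smooth_derive ue0 0), (pd_ue0_smooth _ _ _ _ _ _ Hdata). }
      rewrite Rmin_left, Rmax_right in Hz1 by lra.
      rewrite Hz, Rabs_mult.
      assert (Hd := decay_bound R0 Ku au (Derive ue0) 0 0 z HR0 (Hau _) Hu (proj1 Hz1)).
      simpl in Hd. rewrite !Rmult_1_r in Hd. fold L in Hd.
      replace (rad R0 eps y - R0) with (sqrt eps * (y - R0)) by (unfold rad; ring).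
      rewrite (Rabs_pos_eq (sqrt eps * (y - R0))) by (apply Rmult_le_pos; lra).
      apply Rle_trans with (L * s).
      - apply Rmult_le_compat; try lra; [apply Rabs_pos|apply Rmult_le_pos; lra].
      - unfold s. apply Rmult_le_reg_r with (4 * (L + 1)); [lra|]. field_simplify; [|lra]. nra. }
    apply Rabs_le_between in H1. apply Rabs_le_between in H2. lra.
  - eapply Rle_trans; [apply Rmin_l|].
    assert (H1 : Rabs (up th y) <= m1 / 2).
    { assert (Hb := Bu th y Hy). change (partial_derive 0 0 up th y) with (up th y) in Hb.
      assert (Hy1 : s <= sqrt eps * (1 + y)) by nra.
      assert (Hk : (2 * (Mu + 1)) * sqrt eps <= m1 * s).
      { apply Rle_trans with (2 * (Mu + 1) * (m1 * s / (2 * (Mu + 1)))).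
        - apply Rmult_le_compat_l; lra.
        - right. field. lra. }
      apply Rnot_lt_le. intros Hlt.
      assert (H2 : m1 / 2 * s < Mu * sqrt eps); [|nra].
      apply Rlt_le_trans with (Rabs (up th y) * s); [nra|].
      apply Rle_trans with (Rabs (up th y) * (sqrt eps * (1 + y))).
      - apply Rmult_le_compat_l; [apply Rabs_pos|lra].
      - rewrite pow_1 in Hb. nra. }
    apply Rabs_le_between in H1. specialize (Bm1 _ Hr). lra.
Qed.

(** The derivative of [ue0] is at most [k * exp (- (b * r))], so [g] is nonincreasing and its value
    at [R0] is a bound. *)
Lemma ue0_upper_bound : exists C, 0 <= C /\ forall r, R0 <= r -> Rabs (ue0 r) <= C.
Proof.
  destruct (pd_ue0_pos _ _ _ _ _ _ Hdata) as (m1 & Hm1 & Bm1).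
  destruct (pd_ue0_decay _ _ _ _ _ _ Hdata) as (Ku & au & Hau & Hu).
  set (k := Ku 0%nat). set (b := au 0%nat). assert (Hb := Hau 0%nat). fold b in Hb.
  set (g := fun r => ue0 r + k / b * exp (- (b * r))).
  assert (Hk : 0 <= k).
  { assert (H := Hu 0%nat R0 (Rle_refl _)). fold k b in H.
    assert (H0 := Rabs_pos (Derive_n (Derive ue0) 0 R0)).
    assert (H1 := exp_pos (- (b * R0))).
    apply Rnot_lt_le. intros Hneg. nra. }
  assert (Hkb : 0 <= k / b) by (apply Rmult_le_pos; [lra|left; now apply Rinv_0_lt_compat]).
  assert (Hg : forall r, R0 <= r -> g r <= g R0).
  { intros r Hr.
    destruct (mvt_abs g (fun r => Derive ue0 r - k * exp (- (b * r))) R0 r) as [z [Hz1 Hz]].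
    { intros z _. unfold g. auto_derive.
      - eexists. apply (smooth_derive ue0 0), (pd_ue0_smooth _ _ _ _ _ _ Hdata).
      - change (Derive (fun x : R => ue0 x) z) with (Derive ue0 z). field. lra. }
    rewrite Rmin_left, Rmax_right in Hz1 by lra.
    assert (H := Hu 0%nat z (proj1 Hz1)). simpl in H. fold k b in H. apply Rabs_le_between in H.
    assert (0 <= (k * exp (- (b * z)) - Derive ue0 z) * (r - R0)) by (apply Rmult_le_pos; lra).
    lra. }
  exists (Rabs (g R0)). split; [apply Rabs_pos|]. intros r Hr.
  specialize (Hg r Hr). specialize (Bm1 r Hr). unfold g at 1 in Hg.
  assert (0 <= k / b * exp (- (b * r))) by (apply Rmult_le_pos; [lra|left; apply exp_pos]).
  rewrite Rabs_pos_eq by lra. eapply Rle_trans; [|apply RRle_abs]. lra.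
Qed.

(** [C] is fixed before [th] and [eps]. The Euler part is bounded through v_e and (r v_e)_r alone;
    the derivatives [Qy] and [Zw] are provided with their continuity but without a bound. *)
Lemma profile_bounds_uniform : exists ths C, 0 < ths <= 1 /\ 0 < C /\
  forall th eps K1 Vb0 Vb1 ve, 0 < th <= ths -> 0 < eps -> eps <= th ->
  euler_side_data R0 th up K a K1 Vb0 Vb1 ->
  euler1 R0 th eps ue0 chi0 up Vb0 Vb1 ve ->
  exists Usw Q Qy L0 Upy Vw Z Zw, profile_bounds R0 th eps C
    (us R0 eps ue0 ub1 up ve) Usw (vs R0 eps up ve) Q Qy L0 Upy Vw Z Zw.
Proof.
  destruct euler_estimate
    as (ths1 & CE & Hths1 & HCE & BE).
  destruct inflow_outflow_positive as (kappa & m & Hkappa & Hm & Bm).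
  destruct (pd_ue0_decay _ _ _ _ _ _ Hdata) as (Ku & au & Hau & Hu).
  destruct (pd_ub1_decay _ _ _ _ _ _ Hdata) as (Kb & ab & Hab & Hb).
  destruct (up_partial_bound HR0 Hp 0 0 0) as (Mu & HMu & Bu).
  destruct (up_partial_bound HR0 Hp 1 0 0) as (Mw & HMw & Bw).
  destruct (up_partial_bound HR0 Hp 0 1 2) as (My & HMy & By).
  destruct (up_tail_bound HR0 Hp 1) as (T1 & HT1 & BT1).
  destruct (up_tail_bound HR0 Hp 2) as (T2 & HT2 & BT2).
  set (c0 := Rabs (Ku 0%nat) * (INR 1 / au 0%nat) ^ 1).
  set (cb := Rabs (Kb 0%nat) * (INR 1 / ab 0%nat) ^ 1).
  assert (Bc0 : forall r, R0 <= r -> Rabs (Derive ue0 r) * r <= c0).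
  { intros r Hr. rewrite <- (pow_1 r) at 2.
    exact (decay_bound R0 Ku au (Derive ue0) 0 1 r HR0 (Hau _) Hu Hr). }
  assert (Bcb : forall r, R0 <= r -> Rabs (ub1 r) * r <= cb).
  { intros r Hr. rewrite <- (pow_1 r) at 2.
    exact (decay_bound R0 Kb ab ub1 0 1 r HR0 (Hab _) Hb Hr). }
  assert (Hc0 : 0 <= c0 /\ 0 <= cb).
  { split; (eapply Rle_trans; [|eapply (Bc0 R0) || eapply (Bcb R0); lra]);
      apply Rmult_le_pos; (apply Rabs_pos || lra). }
  destruct ue0_upper_bound as (Cu & HCu & BCu).
  assert (HiR : 0 < / R0) by now apply Rinv_0_lt_compat.
  set (CQ := cb + CE).
  (* [k] will bound [sqrt eps], by [eps <= th <= k ^ 2]. The second entry keeps sqrt(eps) u_e^1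
     below [m], the lower bound of the leading part of u_s, so that u_s is nonnegative at the
     outflow. *)
  set (k := Rmin kappa (m * R0 / (CQ + 1))).
  assert (HmR : 0 < m * R0) by now apply Rmult_lt_0_compat.
  assert (Hk : 0 < k).
  { apply Rmin_glb_lt; [lra|]. apply Rdiv_lt_0_compat; unfold CQ; lra. }
  assert (Hk1 : k <= kappa) by apply Rmin_l.
  assert (Hk2 : k <= m * R0 / (CQ + 1)) by apply Rmin_r.
  set (C := Cu + Mu + CQ + CQ / R0 + Mw + CE / R0 + T1 / R0 + c0 + My + T2 / R0 + CE).
  assert (HT : forall x, 0 <= x -> 0 <= x / R0) by (intros; apply Rmult_le_pos; lra).
  assert (P1 := HT CQ ltac:(unfold CQ; lra)). assert (P2 := HT CE ltac:(lra)).
  assert (P3 := HT T1 HT1). assert (P4 := HT T2 HT2).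
  assert (HCQ : 0 <= CQ) by (unfold CQ; lra).
  exists (Rmin ths1 (k ^ 2)), C.
  assert (Hkk : 0 < k ^ 2) by now apply pow_lt.
  split; [split; [apply Rmin_glb_lt; lra|eapply Rle_trans; [apply Rmin_l|lra]]|].
  split; [unfold C; lra|].
  intros th eps K1 Vb0 Vb1 ve [Hth Hthle] Heps Hepsth Hsd He.
  assert (Hth1 : th <= ths1) by (eapply Rle_trans; [exact Hthle|apply Rmin_l]).
  assert (Hth2 : th <= k ^ 2) by (eapply Rle_trans; [exact Hthle|apply Rmin_r]).
  assert (Hthk : th <= kappa).
  { apply Rle_trans with (k * 1); [|lra]. replace (k ^ 2) with (k * k) in Hth2 by ring.
    apply Rle_trans with (k * k); [exact Hth2|]. apply Rmult_le_compat_l; lra. }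
  assert (Hsq := sqrt_lt_R0 eps Heps).
  assert (Hsqk : sqrt eps <= k).
  { rewrite <- (sqrt_pow2 k) by lra. apply sqrt_le_1_alt. lra. }
  assert (Hsq1 : sqrt eps <= 1) by lra.
  set (e := sqrt eps) in *.
  destruct (BE th eps K1 Vb0 Vb1 ve (conj Hth Hth1) Heps Hsd He) as [BV Bve].
  assert (HC := e1_C2 _ _ _ _ _ _ _ _ _ He).
  destruct (class_C_d1 _ _ HC) as [C1 Dw]. destruct (class_C_d2 _ _ HC) as [C2 Dr].
  destruct (class_C_d2 _ _ C2) as [C22 Drr].
  assert (Cve := class_C_cont _ _ HC). assert (Cve1 := class_C_cont _ _ C1).
  assert (Cve2 := class_C_cont _ _ C2). assert (Cve22 := class_C_cont _ _ C22).
  set (S := fun w r => ve w r + r * d2 ve w r).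
  set (Sr := fun w r => 2 * d2 ve w r + r * d2 (d2 ve) w r).
  assert (CS : forall w r, continuity_2d_pt S w r).
  { intros w r. apply continuity_2d_pt_plus; [apply Cve|].
    apply continuity_2d_pt_mult; [apply continuity_2d_pt_id2|apply Cve2]. }
  assert (CSr : forall w r, continuity_2d_pt Sr w r).
  { intros w r. apply continuity_2d_pt_plus.
    - apply continuity_2d_pt_scal, Cve2.
    - apply continuity_2d_pt_mult; [apply continuity_2d_pt_id2|apply Cve22]. }
  assert (DS : forall w r, is_derive (S w) r (Sr w r)).
  { intros w r. unfold S, Sr. auto_derive.
    - split; [eexists; apply Dr|]. split; [eexists; apply Drr|exact I].
    - rewrite (is_derive_Derive _ _ _ (Dr w r)).
      rewrite (is_derive_Derive _ _ _ (Drr w r)). ring. }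
  set (J := fun w r => RInt (fun s => S s r) 0 w).
  assert (Eue1 : forall w r, ue1 ub1 ve w r = ub1 r - J w r).
  { intros w r. unfold ue1, J. f_equal. apply RInt_ext. intros s _.
    apply is_derive_unique. unfold S. auto_derive; [eexists; apply Dr|].
    rewrite (is_derive_Derive _ _ _ (Dr s r)). ring. }
  assert (CJ : forall w r, continuity_2d_pt J w r) by (intros; now apply continuity_2d_pt_RInt).
  set (Jr := fun w r => RInt (fun s => Sr s r) 0 w).
  assert (CJr : forall w r, continuity_2d_pt Jr w r) by (intros; now apply continuity_2d_pt_RInt).
  assert (DJr : forall w r, is_derive (J w) r (Jr w r))
    by (intros; now apply is_derive_RInt_param_upper).
  assert (DJw : forall w r, is_derive (fun s => J s r) w (S w r)).
  { intros w r. apply (is_derive_RInt (fun s => S s r) (fun w => J w r) 0).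
    - apply filter_forall. intros x. apply (RInt_correct (V := R_CompleteNormedModule)).
      apply ex_RInt_cont. intros; now apply continuity_2d_pt_continuous1.
    - now apply continuity_2d_pt_continuous1. }
  assert (Sub1 := pd_ub1_smooth _ _ _ _ _ _ Hdata).
  assert (Sue0 := pd_ue0_smooth _ _ _ _ _ _ Hdata).
  assert (Csm : forall f n x, smooth f -> continuity_pt (Derive_n f n) x).
  { intros f n x Hf. apply is_derive_continuity_pt with (1 := smooth_derive f n Hf x). }
  assert (Cup : forall i w y, continuity_2d_pt (partial_derive i 0 up) w y).
  { intros. apply (class_C_cont 0), (up_partial_class Hp). }
  set (rd := rad R0 eps).
  assert (Hrd : forall y, R0 <= y -> R0 <= rd y) by (intros; now apply rad_ge).
  assert (Crd : forall w y, continuity_2d_pt (fun _ y => rd y) w y).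
  { intros. apply (continuity_2d_pt_snd rd), is_derive_continuity_pt with (1 := rad_derive R0 eps y). }
  set (Q := fun w y => ub1 (rd y) - J w (rd y)).
  set (Qy := fun w y => e * (Derive ub1 (rd y) - Jr w (rd y))).
  set (Usw := fun w y => partial_derive 1 0 up w y - e * S w (rd y)).
  assert (Eus : forall w y, us R0 eps ue0 ub1 up ve w y = ue0 (rd y) + up w y + e * Q w y).
  { intros w y. unfold us. rewrite Eue1. reflexivity. }
  assert (Evs : forall w y, vs R0 eps up ve w y = up_tail up 1 w y / rd y + ve w (rd y))
    by reflexivity.
  exists Usw, Q, Qy, (fun w y => Derive ue0 (rd y)), (d2 up),
    (fun w y => up_tail up 2 w y / rd y), (fun w y => ve w (rd y) - Vb1 (rd y)),
    (fun w y => d1 ve w (rd y)).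
  assert (DQ : forall w y, is_derive (Q w) y (Qy w y)).
  { intros w y. unfold Q, Qy.
    apply (is_derive_rad R0 eps (fun r => ub1 r - J w r) (fun r => Derive ub1 r - Jr w r)).
    apply @is_derive_minus; [apply (smooth_derive ub1 0 Sub1)|apply DJr]. }
  (* The integrand [r * S] has size [CE / th] over an angle of at most [th]; the loss [1 / th]
     disappears and u_e^1 is bounded by [CQ / r]. *)
  assert (BQ : forall w y, 0 <= w <= th -> R0 < y -> Rabs (Q w y) * rd y <= CQ).
  { intros w y Hw Hy. assert (Hr : R0 < rd y) by now apply rad_gt.
    assert (HJ : Rabs (rd y * J w (rd y)) <= CE).
    { replace (rd y * J w (rd y)) with (RInt (fun s => rd y * S s (rd y)) 0 w).
      2:{ apply (RInt_scal (V := R_CompleteNormedModule) (fun s => S s (rd y))).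
          apply ex_RInt_cont. intros; now apply continuity_2d_pt_continuous1. }
      eapply Rle_trans.
      - apply abs_RInt_le_const with (M := CE / th); [lra| |].
        + apply (ex_RInt_scal (V := R_NormedModule) (fun s => S s (rd y))).
          apply ex_RInt_cont. intros; now apply continuity_2d_pt_continuous1.
        + intros s Hs. apply Bve; lra.
      - apply Rle_trans with (th * (CE / th)); [|right; field; lra].
        apply Rmult_le_compat_r; [|lra]. apply Rmult_le_pos; [lra|].
        left; now apply Rinv_0_lt_compat. }
    rewrite Rabs_mult, (Rabs_pos_eq (rd y)), Rmult_comm in HJ by lra.
    assert (Hb' := Bcb (rd y) ltac:(lra)).
    unfold Q. assert (Ht := Rabs_triang (ub1 (rd y)) (- J w (rd y))). rewrite Rabs_Ropp in Ht.
    apply Rle_trans with ((Rabs (ub1 (rd y)) + Rabs (J w (rd y))) * rd y).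
    - apply Rmult_le_compat_r; [lra|exact Ht].
    - unfold CQ. lra. }
  assert (Dt1 : forall w y, R0 <= y -> is_derive (fun s => up_tail up 1 s y) w (up_tail up 2 w y))
    by (intros; now apply (up_tail_dw HR0 Hp)).
  assert (DUs : forall w y, is_derive (fun s => us R0 eps ue0 ub1 up ve s y) w (Usw w y)).
  { intros w y. apply is_derive_ext with (fun s => ue0 (rd y) + up s y + e * (ub1 (rd y) - J s (rd y))).
    - intros s. now rewrite Eus.
    - evar_last.
      + apply @is_derive_plus.
        * apply @is_derive_plus; [apply @is_derive_const|].
          apply (up_partial_derive Hp 0).
        * apply is_derive_scal, @is_derive_minus; [apply @is_derive_const|apply DJw].
      + unfold Usw, minus, plus, opp, zero; simpl. ring. }
  constructor.
  - intros w y _. apply DUs.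
  - intros w y _. apply is_derive_unique.
    apply is_derive_ext with (fun t => ue0 (rd t) + up w t + e * Q w t).
    { intros t. now rewrite Eus. }
    apply @is_derive_plus; [apply @is_derive_plus|].
    + apply (is_derive_rad R0 eps ue0 (Derive ue0)), (smooth_derive ue0 0 Sue0).
    + apply (proj2 (class_C_d2 0 up (p0_smooth _ _ _ _ _ _ Hp 1))).
    + apply is_derive_scal, DQ.
  (* The profile is divergence free part by part: the tail gives minus the omega-derivative of [up],
     the Euler part gives [e * S] because the radius has slope [e] in [y]. *)
  - intros w y Hy. assert (Hr := Hrd y Hy).
    apply is_derive_ext_loc with (fun t => up_tail up 1 w t + rd t * ve w (rd t)).
    { apply (filter_imp _ _) with (2 := rad_pos_near R0 eps HR0 y Hy). intros t Ht. fold (rd t) in Ht.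
      assert (E : up_tail up 1 w t + rd t * ve w (rd t) = rd t * (up_tail up 1 w t / rd t + ve w (rd t)))
        by (field; lra).
      exact E. }
    replace (- Usw w y) with (- partial_derive 1 0 up w y + e * S w (rd y)) by (unfold Usw; ring).
    apply @is_derive_plus.
    + apply (up_tail_dy HR0 Hp 1).
    + apply (is_derive_rad R0 eps (fun r => r * ve w r) (S w)). unfold S.
      change (rad R0 eps y) with (rd y). auto_derive; [eexists; apply Dr|].
      rewrite (is_derive_Derive _ _ _ (Dr w (rd y))). ring.
  - intros w y Hy. apply is_derive_unique.
    apply is_derive_ext with (fun s => / rd y * up_tail up 1 s y + ve s (rd y)).
    { intros s. rewrite Evs. unfold Rdiv. now rewrite Rmult_comm. }
    apply @is_derive_plus; [|apply Dw]. unfold Rdiv. rewrite Rmult_comm.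
    now apply is_derive_scal, Dt1.
  - intros w y _. apply DQ.
  - intros w y _. rewrite <- (Rminus_0_r (d1 ve w (rd y))).
    apply @is_derive_minus; [apply Dw|apply @is_derive_const].
  - assert (Crad : forall h w y, (forall w r, continuity_2d_pt h w r) ->
      continuity_2d_pt (fun w y => h w (rd y)) w y)
      by (intros h w y Hh; apply (continuity_2d_pt_rad R0 eps h), Hh).
    assert (Crad1 : forall f n w y, smooth f -> continuity_2d_pt (fun _ y => Derive_n f n (rd y)) w y).
    { intros f n w y Hf. apply (Crad (fun _ r => Derive_n f n r)). intros.
      now apply continuity_2d_pt_snd, Csm. }
    assert (CQ1 : forall w y, continuity_2d_pt Q w y).
    { intros w y. apply continuity_2d_pt_minus; [apply (Crad1 ub1 0%nat w y Sub1)|apply (Crad J), CJ]. }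
    repeat split; intros w y Hy.
    + apply continuity_2d_pt_ext with (fun w y => ue0 (rd y) + up w y + e * Q w y).
      { intros. now rewrite Eus. }
      apply continuity_2d_pt_plus; [apply continuity_2d_pt_plus|].
      * apply (Crad1 ue0 0%nat w y Sue0).
      * apply (Cup 0%nat).
      * apply continuity_2d_pt_scal, CQ1.
    + apply continuity_2d_pt_minus; [apply Cup|].
      apply continuity_2d_pt_scal, (Crad S), CS.
    + assert (Hr := Hrd y Hy).
      apply continuity_2d_pt_plus; [|apply (Crad ve), Cve].
      apply continuity_2d_pt_div; [|apply Crd|fold rd; lra].
      now apply (up_tail_cont HR0 Hp 1).
    + apply CQ1.
    + apply continuity_2d_pt_mult; [apply continuity_2d_pt_const|].
      apply continuity_2d_pt_minus; [apply (Crad1 ub1 1%nat w y Sub1)|apply (Crad Jr), CJr].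
    + apply continuity_2d_pt_minus; [apply (Crad ve), Cve|].
      apply (Crad1 Vb1 0%nat w y). apply (sd_smooth1 _ _ _ _ _ _ _ _ Hsd).
    + apply (Crad (d1 ve)), Cve1.
    + apply (Crad1 ue0 1%nat w y Sue0).
    + apply (class_C_cont 0), (proj1 (class_C_d2 0 up (p0_smooth _ _ _ _ _ _ Hp 1))).
    + assert (Hr := Hrd y Hy). apply continuity_2d_pt_div; [|apply Crd|fold rd; lra].
      now apply (up_tail_cont HR0 Hp 2).
  - intros y Hy. rewrite (e1_side1 _ _ _ _ _ _ _ _ _ He _ (Hrd y Hy)). ring.
  - intros y Hy. assert (Hr : R0 < rd y) by now apply rad_gt.
    assert (Hpos := Bm th eps y ltac:(lra) Heps ltac:(fold e; lra) ltac:(lra)).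
    rewrite Eus. change (rad R0 eps y) with (rd y) in Hpos.
    assert (HQ := BQ th y ltac:(lra) Hy).
    assert (He1 : e * (CQ + 1) <= m * R0).
    { apply Rle_trans with (m * R0 / (CQ + 1) * (CQ + 1)); [|right; field; lra].
      apply Rmult_le_compat_r; lra. }
    assert (He2 : e * Rabs (Q th y) <= m).
    { apply Rmult_le_reg_r with R0; [exact HR0|].
      assert (Rabs (Q th y) * R0 <= Rabs (Q th y) * rd y)
        by (apply Rmult_le_compat_l; [apply Rabs_pos|lra]).
      rewrite Rmult_assoc. apply Rle_trans with (e * (CQ + 1)); [|exact He1].
      apply Rmult_le_compat_l; lra. }
    assert (HQ' := Rabs_pos (Q th y)).
    assert (HQ2 := RRle_abs (- Q th y)). rewrite Rabs_Ropp in HQ2.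
    assert (e * - Q th y <= e * Rabs (Q th y)) by (apply Rmult_le_compat_l; lra). lra.
  - intros w y Hw Hy. assert (Hr : R0 < rd y) by now apply rad_gt.
    destruct (Bve w (rd y) ltac:(lra) Hr) as [B1 B2].
    assert (Hir : / rd y <= / R0) by (apply Rinv_le_contravar; lra).
    assert (Hir0 : 0 < / rd y) by (apply Rinv_0_lt_compat; lra).
    assert (Hti : 1 <= / th) by (rewrite <- Rinv_1; apply Rinv_le_contravar; lra).
    assert (Hdiv : forall x M, 0 <= M -> Rabs (rd y * x) <= M -> Rabs x <= M / R0).
    { intros x M HM Hx. replace x with (rd y * x * / rd y) by (field; lra).
      rewrite Rabs_mult, (Rabs_pos_eq (/ rd y)) by lra. unfold Rdiv.
      apply Rmult_le_compat; try lra. apply Rabs_pos. }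
    assert (Hve : Rabs (ve w (rd y)) <= CE / R0) by (apply Hdiv; lra).
    assert (HS : Rabs (S w (rd y)) <= CE / th / R0).
    { apply Hdiv; [|exact B2]. apply Rmult_le_pos; lra. }
    assert (HQ := BQ w y ltac:(lra) Hy).
    assert (Htail : forall i M, 0 <= M -> Rabs (up_tail up i w y) <= M ->
       Rabs (up_tail up i w y / rd y) <= M / R0).
    { intros i M HM Hx. unfold Rdiv. rewrite Rabs_mult, (Rabs_pos_eq (/ rd y)) by lra.
      apply Rmult_le_compat; try lra. apply Rabs_pos. }
    assert (HT1' := Htail 1%nat T1 HT1 (BT1 w y ltac:(lra))).
    assert (HT2' := Htail 2%nat T2 HT2 (BT2 w y ltac:(lra))).
    assert (Hu0 := Bu w y ltac:(lra)). assert (Hu1 := Bw w y ltac:(lra)).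
    simpl pow in Hu0, Hu1. rewrite Rmult_1_r in Hu0, Hu1.
    change (partial_derive 0 0 up w y) with (up w y) in Hu0.
    repeat split.
    + rewrite Eus. eapply Rle_trans; [apply Rabs_triang|].
      assert (H1 := Rabs_triang (ue0 (rd y)) (up w y)). assert (H2 := BCu (rd y) ltac:(lra)).
      assert (HQ' : Rabs (Q w y) <= CQ / R0)
        by (apply Hdiv; [lra|]; rewrite Rabs_mult, (Rabs_pos_eq (rd y)), Rmult_comm; lra).
      rewrite Rabs_mult, (Rabs_pos_eq e) by lra.
      assert (e * Rabs (Q w y) <= 1 * (CQ / R0)) by (apply Rmult_le_compat; try lra; apply Rabs_pos).
      unfold C. lra.
    + unfold Usw. eapply Rle_trans; [apply Rabs_triang|].
      rewrite Rabs_Ropp, Rabs_mult, (Rabs_pos_eq e) by lra.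
      assert (e * Rabs (S w (rd y)) <= 1 * (CE / th / R0)) by (apply Rmult_le_compat; try lra; apply Rabs_pos).
      apply Rle_trans with ((Mw + CE / R0) * / th).
      * replace (CE / th / R0) with (CE / R0 * / th) in H by (field; lra).
        assert (Mw * 1 <= Mw * / th) by (apply Rmult_le_compat_l; lra). lra.
      * apply Rmult_le_compat_r; [lra|]. unfold C. lra.
    + rewrite Evs. eapply Rle_trans; [apply Rabs_triang|]. unfold C. lra.
    + change (rad R0 eps y) with (rd y). unfold C. lra.
    + change (rad R0 eps y) with (rd y). assert (H := Bc0 (rd y) ltac:(lra)). unfold C. lra.
    + assert (H := By w y ltac:(lra)). change (partial_derive 0 1 up w y) with (d2 up w y) in H.
      unfold C. lra.
    + unfold C. lra.
    + eapply Rle_trans; [apply Rabs_triang|]. rewrite Rabs_Ropp.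
      assert (H := BV (rd y) ltac:(lra)). unfold C. lra.
Qed.

End Euler.

(** * The weighted energy identity *)

(** Here [e] is sqrt(eps) and [rho] is r^delta. All arguments are numbers, so that the energy
    identity becomes a rational identity for [field]; differentiability is checked separately. The
    last term integrates v^1_{e omega} u v by parts. *)
Definition flux_w (e r rho u uw uy v vw p Us Z : R) : R :=
  / 2 * Us * (u ^ 2 + e ^ 2 * v ^ 2) * rho + p * u * rho - 2 * e ^ 2 * uw * u * rho / r
  - e ^ 4 * vw * v * rho / r - e ^ 2 * uy * v * rho + e ^ 2 * Z * u * v * rho.

Definition flux_w_dw (e r rho u uw uy uww uwy v vw vww p pw Us Usw Z Zw : R) : R :=
  / 2 * (Usw * (u ^ 2 + e ^ 2 * v ^ 2) + Us * (2 * u * uw + e ^ 2 * (2 * v * vw))) * rho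
  + (pw * u + p * uw) * rho - 2 * e ^ 2 * (uww * u + uw ^ 2) * rho / r
  - e ^ 4 * (vww * v + vw ^ 2) * rho / r - e ^ 2 * (uwy * v + uy * vw) * rho
  + e ^ 2 * (Zw * u * v + Z * uw * v + Z * u * vw) * rho.

(** The term [e * Q * u * v] integrates the derivative of u_e^1 by parts. The last two terms are the
    partners of those added to [flux_w]: by the divergence condition the second derivatives cancel
    between them. *)
Definition flux_y (e r rho u uy v vw vy p Vs Q : R) : R :=
  / 2 * (r * Vs) * rho * (u ^ 2 + e ^ 2 * v ^ 2)
  + (p * v - uy * u - e ^ 2 * vy * v + e * Q * u * v) * (r * rho)
  - e ^ 2 * vw * u * rho - e ^ 2 * (e * v + r * vy) * v * rho.

Definition flux_y_dy (e r rho d u uy uyy v vw vy vwy vyy p py Usw Vs Q Qy : R) : R :=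
  let rhoy := d * e * rho / r in
  / 2 * ((- Usw * rho + r * Vs * rhoy) * (u ^ 2 + e ^ 2 * v ^ 2)
     + r * Vs * rho * (2 * u * uy + e ^ 2 * (2 * v * vy)))
  + (py * v + p * vy - uyy * u - uy ^ 2 - e ^ 2 * (vyy * v + vy ^ 2)
     + e * (Qy * u * v + Q * uy * v + Q * u * vy)) * (r * rho)
  + (p * v - uy * u - e ^ 2 * vy * v + e * Q * u * v) * (e * rho + r * rhoy)
  - e ^ 2 * ((vwy * u + vw * uy) * rho + vw * u * rhoy)
  - e ^ 2 * ((2 * e * vy + r * vyy) * v * rho + (e * v + r * vy) * (vy * rho + v * rhoy)).

Definition momentum_w (e r u uw uy uww uyy v vw pw Us Usw Usy Vs : R) : R :=
  / r * Us * uw + / r * Usw * u + Usy * v + Vs * uy + e / r * Vs * u + e / r * Us * v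
  + / r * pw - uyy - e / r * uy - e ^ 2 / r ^ 2 * uww + e ^ 2 / r ^ 2 * u
  - 2 * e ^ 3 / r ^ 2 * vw.

Definition momentum_y (e r u uw v vw vy vww vyy py Us Vs Vsw Vsy : R) : R :=
  / r * Us * vw + / r * Vsw * u + Vs * vy + Vsy * v - 2 / r * / e * Us * u + / e ^ 2 * py
  - vyy - e / r * vy - e ^ 2 / r ^ 2 * vww + 2 * e / r ^ 2 * uw + e ^ 2 / r ^ 2 * v.

Lemma is_derive_flux_w (e r rho x : R) (u uw uy v vw p Us Z : R -> R)
  (du uww uwy dv vww pw Usw Zw : R) : r <> 0 ->
  is_derive u x du -> is_derive uw x uww -> is_derive uy x uwy -> is_derive v x dv ->
  is_derive vw x vww -> is_derive p x pw -> is_derive Us x Usw -> is_derive Z x Zw ->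
  du = uw x -> dv = vw x ->
  is_derive (fun s => flux_w e r rho (u s) (uw s) (uy s) (v s) (vw s) (p s) (Us s) (Z s)) x
    (flux_w_dw e r rho (u x) (uw x) (uy x) uww uwy (v x) (vw x) vww (p x) pw (Us x) Usw (Z x) Zw).
Proof.
  intros Hr Du Duw Duy Dv Dvw Dp DUs DZ Eu Ev. unfold flux_w, flux_w_dw.
  auto_derive.
  - repeat split; try exact I; eexists; eassumption.
  - rewrite (is_derive_Derive _ _ _ Du), (is_derive_Derive _ _ _ Duw),
      (is_derive_Derive _ _ _ Duy), (is_derive_Derive _ _ _ Dv),
      (is_derive_Derive _ _ _ Dvw), (is_derive_Derive _ _ _ Dp),
      (is_derive_Derive _ _ _ DUs), (is_derive_Derive _ _ _ DZ).
    rewrite Eu, Ev. field. exact Hr.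
Qed.

Lemma is_derive_flux_y (e d x : R) (r rho u uy v vw vy p Vs Q : R -> R)
  (du uyy dv vwy vyy py Usw Vsy Qy : R) : r x <> 0 ->
  is_derive r x e -> is_derive rho x (d * e * rho x / r x) ->
  is_derive u x du -> is_derive uy x uyy -> is_derive v x dv -> is_derive vw x vwy ->
  is_derive vy x vyy -> is_derive p x py -> is_derive Vs x Vsy -> is_derive Q x Qy ->
  du = uy x -> dv = vy x -> Vsy = (- Usw - e * Vs x) / r x ->
  is_derive (fun t => flux_y e (r t) (rho t) (u t) (uy t) (v t) (vw t) (vy t) (p t) (Vs t) (Q t)) x
    (flux_y_dy e (r x) (rho x) d (u x) (uy x) uyy (v x) (vw x) (vy x) vwy vyy (p x) py Usw (Vs x)
      (Q x) Qy).
Proof.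
  intros Hr Dr Drho Du Duy Dv Dvw Dvy Dp DVs DQ Eu Ev EV. unfold flux_y, flux_y_dy.
  auto_derive.
  - repeat split; try exact I; eexists; eassumption.
  - rewrite (is_derive_Derive _ _ _ Dr), (is_derive_Derive _ _ _ Drho),
      (is_derive_Derive _ _ _ Du), (is_derive_Derive _ _ _ Duy),
      (is_derive_Derive _ _ _ Dv), (is_derive_Derive _ _ _ Dvw),
      (is_derive_Derive _ _ _ Dvy), (is_derive_Derive _ _ _ Dp),
      (is_derive_Derive _ _ _ DVs), (is_derive_Derive _ _ _ DQ).
    rewrite Eu, Ev, EV. field. exact Hr.
Qed.

(* The first equation times [u r rho] plus the second one times [eps v r rho] is
   an exact divergence plus [r rho u_R^2] plus terms without second derivatives.
   The terms [2 e^2 uw u rho / r] and [e^2 uy v rho] of [flux_w] make it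
   nonnegative at the outflow boundary [omega = theta0]; they are traded for
   interior terms by differentiating the divergence condition. *)
Lemma energy_identity (e r rho d u uw uy uww uwy uyy v vw vy vww vwy vyy p pw py : R)
  (Us Usw Usy Vs Vsw Vsy Q Qy L0 Upy Vw Z Zw : R) :
  r <> 0 -> e <> 0 ->
  uw = - (e * v + r * vy) -> uww = - (e * vw + r * vwy) -> uwy = - (2 * e * vy + r * vyy) ->
  Usy = e * L0 + Upy + e * Qy -> Vsw = Vw + Zw -> Vsy = (- Usw - e * Vs) / r ->
  let f := momentum_w e r u uw uy uww uyy v vw pw Us Usw Usy Vs in
  let g := momentum_y e r u uw v vw vy vww vyy py Us Vs Vsw Vsy in
  let q := e ^ 2 / r in
  let b2 := e * vw in
  let b3 := e * v in
  flux_w_dw e r rho u uw uy uww uwy v vw vww p pw Us Usw Z Zw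
  + flux_y_dy e r rho d u uy uyy v vw vy vwy vyy p py Usw Vs Q Qy + r * rho * uy ^ 2 = rho *
    (- (Usw + e * (1 - d / 2) * Vs + q) * u ^ 2
     + (Usw + e * (1 + d / 2) * Vs - (2 - d) * q) * b3 ^ 2
     + (Us - L0 * r + d * (e * Q) - e * Vw) * (u * b3)
     - e * Q * (u * uw) + Q * r * (b3 * uy)
     + (e * Z - (5 - 2 * d) * q) * (uw * b3) + (e * Z + (3 - d) * q) * (u * b2)
     + d * (p * b3) - d * e * (u * uy) - 2 * e * (b2 * uy)
     - 4 * q * uw ^ 2 - q * b2 ^ 2 - Upy * (r * v) * u
     + r * f * u + e * r * g * b3).
Proof.
  intros Hr He Euw Euww Euwy EUsy EVsw EVsy f g q b2 b3.
  unfold f, g, momentum_w, momentum_y, flux_w_dw, flux_y_dy.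
  rewrite EUsy, EVsw, EVsy.
  unfold q, b2, b3. rewrite Euww, Euwy, Euw. field. split; assumption.
Qed.

Lemma young k K s x y : Rabs k <= K -> 0 < s -> k * (x * y) <= K / 2 * (s * x ^ 2 + y ^ 2 / s).
Proof.
  intros Hk Hs. assert (HK : 0 <= K) by (eapply Rle_trans; [apply Rabs_pos|exact Hk]).
  assert (H1 : k * (x * y) <= K * Rabs (x * y)).
  { eapply Rle_trans; [apply RRle_abs|]. rewrite Rabs_mult.
    apply Rmult_le_compat_r; [apply Rabs_pos|exact Hk]. }
  assert (H2 : Rabs (x * y) <= / 2 * (s * x ^ 2 + y ^ 2 / s)).
  { assert (H : 0 <= (s * x - y) ^ 2 / s)
      by (apply Rmult_le_pos; [apply pow2_ge_0|left; now apply Rinv_0_lt_compat]).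
    assert (H' : 0 <= (s * x + y) ^ 2 / s)
      by (apply Rmult_le_pos; [apply pow2_ge_0|left; now apply Rinv_0_lt_compat]).
    replace ((s * x - y) ^ 2 / s) with (s * x ^ 2 + y ^ 2 / s - 2 * (x * y)) in H by (field; lra).
    replace ((s * x + y) ^ 2 / s) with (s * x ^ 2 + y ^ 2 / s + 2 * (x * y)) in H' by (field; lra).
    apply Rabs_le. lra. }
  apply Rle_trans with (K * (/ 2 * (s * x ^ 2 + y ^ 2 / s))); [|right; field; lra].
  eapply Rle_trans; [exact H1|]. now apply Rmult_le_compat_l.
Qed.

(** Young's inequality puts the weight [th] on the omega-derivatives and [1 / th] on [u] and [b3];
    Poincare gains [th ^ 2] on the latter, so everything ends up of order [th]. This leaves room for
    [Usw], of size [C / th]. The product with [Upy] keeps the factor [W], which stands for r v, for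
    Hardy's inequality. The viscous squares with the factor [q] have the good sign and are
    dropped. *)
Lemma energy_remainder_bound (R0 C th e r d u uw uy b2 b3 p f g : R)
  (Us Usw Vs Q L0 Upy Vw Z W : R) :
  0 < R0 -> 0 <= C -> 0 < th <= 1 -> 0 < e -> e ^ 2 <= th -> R0 <= r -> 0 <= d <= 1 ->
  Rabs Us <= C -> Rabs Usw <= C / th -> Rabs Vs <= C -> Rabs Q * r <= C -> Rabs L0 * r <= C ->
  Rabs Vw <= C -> Rabs Z <= C ->
  let q := e ^ 2 / r in
  let K := 10 * (C + C / R0 + / R0 + 1) in
  - (Usw + e * (1 - d / 2) * Vs + q) * u ^ 2
  + (Usw + e * (1 + d / 2) * Vs - (2 - d) * q) * b3 ^ 2
  + (Us - L0 * r + d * (e * Q) - e * Vw) * (u * b3)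
  - e * Q * (u * uw) + Q * r * (b3 * uy)
  + (e * Z - (5 - 2 * d) * q) * (uw * b3) + (e * Z + (3 - d) * q) * (u * b2)
  + d * (p * b3) - d * e * (u * uy) - 2 * e * (b2 * uy)
  - 4 * q * uw ^ 2 - q * b2 ^ 2 - Upy * W * u
  + r * f * u + e * r * g * b3
  <= / 2 * (r * uy ^ 2)
     + (5 * K + 2 * K ^ 2 / R0) * (th * (uw ^ 2 + b2 ^ 2) + (u ^ 2 + b3 ^ 2) / th)
     + d * (th * p ^ 2) + (r * f) ^ 2 + (e * (r * g)) ^ 2 + th * (Upy * W) ^ 2.
Proof.
  intros HR0 HC [Hth Hth1] He Heth Hr [Hd0 Hd1] BUs BUsw BVs BQ BL0 BVw BZ q K.
  assert (He1 : e <= 1) by (apply Rnot_lt_le; intros H; assert (1 < e ^ 2) by nra; lra).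
  assert (HiR : 0 < / R0) by now apply Rinv_0_lt_compat.
  assert (Hti : 1 <= / th) by (rewrite <- Rinv_1; apply Rinv_le_contravar; lra).
  assert (Hir : 0 < / r <= / R0)
    by (split; [apply Rinv_0_lt_compat; lra|apply Rinv_le_contravar; lra]).
  assert (HCR : 0 <= C / R0) by (apply Rmult_le_pos; lra).
  assert (Hq0 : 0 <= q) by (apply Rmult_le_pos; [apply pow2_ge_0|lra]).
  assert (Hq1 : q <= / R0).
  { unfold q. apply Rle_trans with (1 * / R0); [|lra]. apply Rmult_le_compat; try lra. apply pow2_ge_0. }
  assert (HQ : Rabs Q <= C / R0).
  { replace (Rabs Q) with (Rabs Q * r * / r) by (field; lra).
    unfold Rdiv. assert (H := Rabs_pos Q). apply Rmult_le_compat; try lra. apply Rmult_le_pos; lra. }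
  assert (Hmul : forall s x M, 0 <= s <= 1 -> Rabs x <= M -> Rabs (s * x) <= M).
  { intros s x M Hs Hx. rewrite Rabs_mult, (Rabs_pos_eq s) by lra.
    assert (H := Rabs_pos x). apply Rle_trans with (1 * Rabs x); [apply Rmult_le_compat_r; lra|lra]. }
  assert (BeQ := Hmul e Q _ ltac:(lra) HQ). assert (BdeQ := Hmul d _ _ ltac:(lra) BeQ).
  assert (BeVw := Hmul e Vw _ ltac:(lra) BVw). assert (BeVs := Hmul e Vs _ ltac:(lra) BVs).
  assert (BeZ := Hmul e Z _ ltac:(lra) BZ).
  assert (Bde := Hmul d e 1 ltac:(lra) ltac:(rewrite Rabs_pos_eq; lra)).
  assert (BL0r : Rabs (L0 * r) <= C) by (rewrite Rabs_mult, (Rabs_pos_eq r); lra).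
  assert (BQr : Rabs (Q * r) <= C) by (rewrite Rabs_mult, (Rabs_pos_eq r); lra).
  assert (Bdq : 0 <= d * q <= / R0).
  { split; [apply Rmult_le_pos; lra|]. apply Rle_trans with (1 * q); [|lra].
    apply Rmult_le_compat_r; lra. }
  assert (BVs1 : Rabs (e * Vs * (d / 2)) <= C).
  { rewrite Rmult_comm. apply Hmul; lra. }
  assert (HCt : C <= C / th) by (apply Rle_trans with (C * 1); [lra|apply Rmult_le_compat_l; lra]).
  assert (HRt : / R0 <= / R0 * / th)
    by (apply Rle_trans with (/ R0 * 1); [lra|apply Rmult_le_compat_l; lra]).
  assert (HK0 : 10 <= K) by (unfold K; lra).
  apply Rabs_le_between in BUs. apply Rabs_le_between in BUsw.
  apply Rabs_le_between in BeQ. apply Rabs_le_between in BdeQ. apply Rabs_le_between in BeVw.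
  apply Rabs_le_between in BeVs. apply Rabs_le_between in BeZ. apply Rabs_le_between in BL0r.
  apply Rabs_le_between in BVs1.
  assert (HKt : K / th = 10 * (C / th + C / R0 / th + / R0 * / th + / th)) by (unfold K; field; lra).
  assert (HCRt : 0 <= C / R0 / th) by (apply Rmult_le_pos; lra).
  assert (Y_u : - (Usw + e * (1 - d / 2) * Vs + q) * u ^ 2 <= K / th * u ^ 2).
  { apply Rmult_le_compat_r; [apply pow2_ge_0|].
    replace (e * (1 - d / 2) * Vs) with (e * Vs - e * Vs * (d / 2)) by ring. lra. }
  assert (Y_3 : (Usw + e * (1 + d / 2) * Vs - (2 - d) * q) * b3 ^ 2 <= K / th * b3 ^ 2).
  { apply Rmult_le_compat_r; [apply pow2_ge_0|].
    replace (e * (1 + d / 2) * Vs) with (e * Vs + e * Vs * (d / 2)) by ring. lra. }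
  assert (Y_u3 := young (Us - L0 * r + d * (e * Q) - e * Vw) K 1 u b3
    ltac:(apply Rabs_le; unfold K; lra) Rlt_0_1).
  assert (Y_uw := young (- (e * Q)) K th uw u ltac:(apply Rabs_le; unfold K; lra) Hth).
  (* With this parameter [Y_3y] and [Y_yu] each cost [R0 * uy ^ 2 / 6]; together with [Y_2y] they
     make up the [/ 2 * (r * uy ^ 2)] of the claim. *)
  assert (Hs : 0 < R0 / (3 * K)) by (apply Rdiv_lt_0_compat; lra).
  assert (Y_3y := young (Q * r) K (R0 / (3 * K)) uy b3 ltac:(unfold K; lra) Hs).
  assert (Y_w3 := young (e * Z - (5 - 2 * d) * q) K th uw b3
    ltac:(apply Rabs_le; unfold K; lra) Hth).
  assert (Y_2u := young (e * Z + (3 - d) * q) K th b2 u ltac:(apply Rabs_le; unfold K; lra) Hth).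
  assert (Y_p := young d d th p b3 ltac:(rewrite Rabs_pos_eq; lra) Hth).
  assert (Y_yu := young (- (d * e)) K (R0 / (3 * K)) uy u
    ltac:(rewrite Rabs_Ropp; lra) Hs).
  (* [b2] occurs with a factor [e], and [e ^ 2 <= th] supplies the weight [th] that [b2 ^ 2] has to
     carry. *)
  assert (Y_2y : - 2 * e * (b2 * uy) <= R0 / 6 * uy ^ 2 + K / R0 * (th * b2 ^ 2)).
  { assert (H1 := young (- 2) 2 (R0 / 6) uy (e * b2) ltac:(apply Rabs_le; lra) ltac:(lra)).
    replace ((e * b2) ^ 2 / (R0 / 6)) with (6 * / R0 * (e ^ 2 * b2 ^ 2)) in H1 by (field; lra).
    assert (H2 : e ^ 2 * b2 ^ 2 <= th * b2 ^ 2) by (apply Rmult_le_compat_r; [apply pow2_ge_0|lra]).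
    assert (H3 : 0 <= e ^ 2 * b2 ^ 2) by (apply Rmult_le_pos; apply pow2_ge_0).
    assert (H4 : 6 * / R0 * (e ^ 2 * b2 ^ 2) <= K / R0 * (th * b2 ^ 2)).
    { apply Rmult_le_compat; try lra. unfold Rdiv. apply Rmult_le_compat_r; lra. }
    replace (2 / 2) with 1 in H1 by field. lra. }
  assert (Y_U := young (- 1) 2 th (Upy * W) u ltac:(apply Rabs_le; lra) Hth).
  assert (Y_f := young 1 2 1 (r * f) u ltac:(apply Rabs_le; lra) Rlt_0_1).
  assert (Y_g := young 1 2 1 (e * (r * g)) b3 ltac:(apply Rabs_le; lra) Rlt_0_1).
  assert (P0 : 0 <= q * uw ^ 2) by (apply Rmult_le_pos; [lra|apply pow2_ge_0]).
  assert (P1 : 0 <= q * b2 ^ 2) by (apply Rmult_le_pos; [lra|apply pow2_ge_0]).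
  assert (P2 : R0 * uy ^ 2 <= r * uy ^ 2) by (apply Rmult_le_compat_r; [apply pow2_ge_0|lra]).
  set (B1 := u ^ 2 / th) in *. set (B3 := b3 ^ 2 / th) in *.
  set (A1 := th * uw ^ 2) in *. set (A2 := th * b2 ^ 2) in *.
  assert (Q0 : 0 <= uy ^ 2) by apply pow2_ge_0.
  assert (Q1 : 0 <= u ^ 2 <= B1).
  { split; [apply pow2_ge_0|]. unfold B1, Rdiv. rewrite <- (Rmult_1_r (u ^ 2)) at 1.
    apply Rmult_le_compat_l; [apply pow2_ge_0|lra]. }
  assert (Q3 : 0 <= b3 ^ 2 <= B3).
  { split; [apply pow2_ge_0|]. unfold B3, Rdiv. rewrite <- (Rmult_1_r (b3 ^ 2)) at 1.
    apply Rmult_le_compat_l; [apply pow2_ge_0|lra]. }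
  assert (QA1 : 0 <= A1) by (apply Rmult_le_pos; [lra|apply pow2_ge_0]).
  assert (QA2 : 0 <= A2) by (apply Rmult_le_pos; [lra|apply pow2_ge_0]).
  set (K2 := K ^ 2 / R0) in *.
  replace (2 * K ^ 2 / R0) with (2 * K2) by (unfold K2; field; lra).
  assert (HK2 : K / R0 <= K2).
  { unfold K2, Rdiv. apply Rmult_le_compat_r; [lra|]. replace (K ^ 2) with (K * K) by ring.
    rewrite <- (Rmult_1_r K) at 1. apply Rmult_le_compat_l; lra. }
  assert (HKR : 0 <= K / R0) by (apply Rmult_le_pos; lra).
  replace (K / th * u ^ 2) with (K * B1) in Y_u by (unfold B1; field; lra).
  replace (K / th * b3 ^ 2) with (K * B3) in Y_3 by (unfold B3; field; lra).
  replace (K / 2 * (R0 / (3 * K) * uy ^ 2 + b3 ^ 2 / (R0 / (3 * K))))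
    with (R0 * uy ^ 2 / 6 + 3 / 2 * (K2 * b3 ^ 2)) in Y_3y by (unfold K2; field; lra).
  replace (K / 2 * (R0 / (3 * K) * uy ^ 2 + u ^ 2 / (R0 / (3 * K))))
    with (R0 * uy ^ 2 / 6 + 3 / 2 * (K2 * u ^ 2)) in Y_yu by (unfold K2; field; lra).
  replace (R0 / 6 * uy ^ 2) with (R0 * uy ^ 2 / 6) in Y_2y by field.
  replace ((u ^ 2 + b3 ^ 2) / th) with (B1 + B3) by (unfold B1, B3; field; lra).
  replace (th * (uw ^ 2 + b2 ^ 2)) with (A1 + A2) by (unfold A1, A2; ring).
  assert (R1 : K2 * u ^ 2 <= K2 * B1) by (apply Rmult_le_compat_l; lra).
  assert (R3 : K2 * b3 ^ 2 <= K2 * B3) by (apply Rmult_le_compat_l; lra).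
  assert (R4 : K / R0 * A2 <= K2 * A2) by (apply Rmult_le_compat_r; lra).
  assert (S1 : K * u ^ 2 <= K * B1) by (apply Rmult_le_compat_l; lra).
  assert (S3 : K * b3 ^ 2 <= K * B3) by (apply Rmult_le_compat_l; lra).
  assert (T1 : 10 * B1 <= K * B1) by (apply Rmult_le_compat_r; lra).
  assert (T3 : 10 * B3 <= K * B3) by (apply Rmult_le_compat_r; lra).
  assert (T4 : 0 <= K * A1) by (apply Rmult_le_pos; lra).
  assert (T5 : 0 <= K * A2) by (apply Rmult_le_pos; lra).
  assert (T6 : 0 <= K2 * A1) by (apply Rmult_le_pos; lra).
  assert (T7 : 0 <= K2 * B1) by (apply Rmult_le_pos; lra).
  assert (T8 : 0 <= K2 * B3) by (apply Rmult_le_pos; lra).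
  assert (T9 : 0 <= K2 * A2) by (apply Rmult_le_pos; lra).
  assert (dB : d * B3 <= 1 * B3) by (apply Rmult_le_compat_r; lra).
  assert (dp : 0 <= d * (th * p ^ 2))
    by (apply Rmult_le_pos; [lra|apply Rmult_le_pos; [lra|apply pow2_ge_0]]).
  assert (W1 := pow2_ge_0 (r * f)). assert (W2 := pow2_ge_0 (e * (r * g))).
  assert (W3 : 0 <= th * (Upy * W) ^ 2) by (apply Rmult_le_pos; [lra|apply pow2_ge_0]).
  lra.
Qed.

(** * Weighted inequalities on rectangles *)

Ltac solve_cont2 := repeat first
  [ assumption
  | apply continuity_2d_pt_const
  | apply continuity_2d_pt_id1
  | apply continuity_2d_pt_id2
  | match goal with
    | H : forall w y, continuity_2d_pt ?h w y |- continuity_2d_pt ?h _ _ => apply H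
    | H : forall w y, continuity_2d_pt ?h w y |- continuity_2d_pt (fun w y => ?h w y) _ _ => apply H
    | H : cont_strip _ ?h |- continuity_2d_pt ?h _ _ => apply H; assumption
    | H : cont_strip _ ?h |- continuity_2d_pt (fun w y => ?h w y) _ _ => apply H; assumption
    end
  | apply continuity_2d_pt_opp
  | apply continuity_2d_pt_pow
  | apply continuity_2d_pt_div
  | apply continuity_2d_pt_inv
  | apply continuity_2d_pt_mult
  | apply continuity_2d_pt_minus
  | apply continuity_2d_pt_plus ].

Lemma rint2_lin th a N k g h :
  cont_strip a g -> cont_strip a h -> a <= N ->
  rint2 th a N (fun w y => k * g w y + h w y) = k * rint2 th a N g + rint2 th a N h.
Proof.
  intros Hg Hh HN. rewrite (rint2_plus th a N (fun w y => k * g w y)), rint2_scal; try assumption.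
  - reflexivity.
  - intros w y Hy. now apply continuity_2d_pt_scal, Hg.
Qed.

Lemma cont_strip_lin a k g h :
  cont_strip a g -> cont_strip a h -> cont_strip a (fun w y => k * g w y + h w y).
Proof.
  intros Hg Hh w y Hy. apply continuity_2d_pt_plus; [|now apply Hh].
  now apply continuity_2d_pt_scal, Hg.
Qed.

(** The factor [w - th] vanishes at the outflow and [h] at the inflow, so the [w]-derivative of
    [(w - th) * (rho y * h w y ^ 2)] has zero integral; expanding it expresses [h ^ 2] through
    [h * hw] with a coefficient of size [th]. *)
Lemma rint2_poincare (h hw : R -> R -> R) (rho : R -> R) th a N :
  0 <= th -> a <= N ->
  (forall w y, is_derive (fun s => h s y) w (hw w y)) ->
  cont_strip a h -> cont_strip a hw -> cont_strip a (fun _ y => rho y) ->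
  (forall y, a <= y -> 0 <= rho y) -> (forall y, a <= y -> h 0 y = 0) ->
  rint2 th a N (fun w y => rho y * h w y ^ 2)
  <= 4 * th ^ 2 * rint2 th a N (fun w y => rho y * hw w y ^ 2).
Proof.
  intros Hth HN Hd Ch Chw Crho Hrho H0.
  set (F := fun w y => (w - th) * (rho y * h w y ^ 2)).
  set (Fw := fun w y => rho y * (h w y ^ 2 + (w - th) * (2 * h w y * hw w y))).
  assert (E : rint2 th a N Fw = 0).
  { rewrite (rint2_dw th a N F Fw).
    - rewrite !RInt_zero; try exact HN; [ring| |]; intros y Hy; unfold F; [|ring].
      rewrite H0 by lra. ring.
    - intros w y Hy. unfold F, Fw. auto_derive; [repeat split; try exact I; eexists; apply Hd|].
      rewrite (is_derive_Derive _ _ _ (Hd w y)). ring.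
    - intros w y Hy. unfold F. solve_cont2.
    - intros w y Hy. unfold Fw. solve_cont2.
    - exact HN. }
  assert (C1 : cont_strip a (fun w y => rho y * h w y ^ 2)) by (intros w y Hy; solve_cont2).
  assert (C2 : cont_strip a (fun w y => rho y * hw w y ^ 2)) by (intros w y Hy; solve_cont2).
  assert (H : rint2 th a N (fun w y => / 2 * (rho y * h w y ^ 2))
              <= rint2 th a N (fun w y => Fw w y + 2 * th ^ 2 * (rho y * hw w y ^ 2))).
  { apply rint2_le; try assumption.
    - intros w y Hy. solve_cont2.
    - intros w y Hy. unfold Fw. solve_cont2.
    - intros w y Hw Hy. unfold Fw. assert (Hr := Hrho y ltac:(lra)).
      assert (H1 : 0 <= / 2 * h w y ^ 2 + (w - th) * (2 * h w y * hw w y) + 2 * th ^ 2 * hw w y ^ 2).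
      { assert (Hsq := pow2_ge_0 (/ 2 * h w y + (w - th) * hw w y)).
        assert ((w - th) ^ 2 * hw w y ^ 2 <= th ^ 2 * hw w y ^ 2)
          by (apply Rmult_le_compat_r; [apply pow2_ge_0|nra]). nra. }
      assert (H2 := Rmult_le_pos _ _ Hr H1). lra. }
  rewrite rint2_scal in H by assumption.
  rewrite (rint2_plus th a N Fw), E in H.
  2: intros w y Hy; unfold Fw; solve_cont2.
  2: intros w y Hy; solve_cont2.
  2: exact HN.
  rewrite rint2_scal in H by assumption. lra.
Qed.

(** The [y]-derivative of [W ^ 2 / (1 + y)] has a nonnegative integral: the boundary term vanishes
    at [a] and has the good sign at [N], so nothing is asked of [W] at infinity. Completing a square
    then gives the constant 4. *)
Lemma rint2_hardy (W Wy : R -> R -> R) th a N :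
  0 <= th -> 0 < a -> a <= N ->
  (forall w y, a <= y -> is_derive (W w) y (Wy w y)) ->
  cont_strip a W -> cont_strip a Wy -> (forall w, 0 <= w <= th -> W w a = 0) ->
  rint2 th a N (fun w y => W w y ^ 2 / (1 + y) ^ 2) <= 4 * rint2 th a N (fun w y => Wy w y ^ 2).
Proof.
  intros Hth Ha HN Hd CW CWy H0.
  set (F := fun w y => W w y ^ 2 / (1 + y)).
  set (Fy := fun w y => 2 * W w y * Wy w y / (1 + y) - W w y ^ 2 / (1 + y) ^ 2).
  assert (CF : cont_strip a F) by (intros w y Hy; unfold F; solve_cont2; lra).
  assert (CFy : cont_strip a Fy).
  { intros w y Hy. unfold Fy. solve_cont2; try lra. apply pow_nonzero; lra. }
  assert (C1 : cont_strip a (fun w y => W w y ^ 2 / (1 + y) ^ 2)).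
  { intros w y Hy. solve_cont2; apply pow_nonzero; lra. }
  assert (C2 : cont_strip a (fun w y => Wy w y ^ 2)) by (intros w y Hy; solve_cont2).
  assert (E : 0 <= rint2 th a N Fy).
  { rewrite (rint2_dy th a N F Fy); try assumption.
    - rewrite (RInt_zero (fun w => F w a)), Rminus_0_r; [|exact Hth|].
      + apply RInt_ge_0; [exact Hth| |].
        * apply ex_RInt_cont. intros x _. now apply continuity_2d_pt_continuous1, CF.
        * intros w Hw. unfold F. apply Rmult_le_pos; [apply pow2_ge_0|].
          left; apply Rinv_0_lt_compat; lra.
      + intros w Hw. unfold F. rewrite H0 by lra. field. lra.
    - intros w y Hy. unfold F, Fy. auto_derive.
      + split; [eexists; now apply Hd|]. split; [lra|exact I].
      + rewrite (is_derive_Derive _ _ _ (Hd w y Hy)). field. lra. }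
  assert (H : rint2 th a N (fun w y => / 2 * (W w y ^ 2 / (1 + y) ^ 2))
              <= rint2 th a N (fun w y => - 1 * Fy w y + 2 * Wy w y ^ 2)).
  { apply rint2_le; try assumption.
    - intros w y Hy. solve_cont2; apply pow_nonzero; lra.
    - intros w y Hy. apply continuity_2d_pt_plus; [|solve_cont2].
      now apply continuity_2d_pt_scal, CFy.
    - intros w y Hw Hy. unfold Fy. set (k := W w y / (1 + y)).
      replace (W w y ^ 2 / (1 + y) ^ 2) with (k ^ 2) by (unfold k; field; lra).
      replace (2 * W w y * Wy w y / (1 + y)) with (2 * k * Wy w y) by (unfold k; field; lra).
      assert (Hs := pow2_ge_0 (k - 2 * Wy w y)). lra. }
  rewrite rint2_scal in H by assumption.
  rewrite (rint2_plus th a N (fun w y => - 1 * Fy w y) (fun w y => 2 * Wy w y ^ 2)) in H.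
  - rewrite !rint2_scal in H by assumption. lra.
  - intros w y Hy. now apply continuity_2d_pt_scal, CFy.
  - intros w y Hy. solve_cont2.
  - exact HN.
Qed.

(* Otherwise [k' >= eta / N] near infinity, and [k] would grow like a logarithm. *)
Lemma small_boundary_flux (k kd : R -> R) a M eta N0 :
  0 < a -> 0 < eta -> (forall N, a < N -> is_derive k N (kd N)) -> (forall N, a < N -> k N <= M) ->
  exists N, N0 <= N /\ a < N /\ N * kd N <= eta.
Proof.
  intros Ha Heta Hd HM.
  apply Classical_Prop.NNPP. intros Hno.
  assert (Hlow : forall N, N0 <= N -> a < N -> eta / N <= kd N).
  { intros N H0 H1. apply Rnot_lt_le. intros Hlt. apply Hno. exists N. repeat split; try assumption.
    apply Rmult_lt_compat_l with (r := N) in Hlt; [|lra].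
    replace (N * (eta / N)) with eta in Hlt by (field; lra). lra. }
  set (N1 := Rmax N0 (a + 1)).
  assert (H1 : N0 <= N1) by apply Rmax_l. assert (H2 : a + 1 <= N1) by apply Rmax_r.
  (* [N2] lies so far out that [eta * ln (N2 / N1)] exceeds [M - k N1] by at least [eta]. *)
  set (L := (M - k N1) / eta + 1).
  set (N2 := N1 * exp (Rmax 0 L)).
  assert (HL := Rmax_l 0 L). assert (HL2 := Rmax_r 0 L).
  assert (He : 1 <= exp (Rmax 0 L)) by (assert (H := exp_ineq1_le (Rmax 0 L)); lra).
  assert (HN2 : N1 <= N2) by (unfold N2; rewrite <- (Rmult_1_r N1) at 1; apply Rmult_le_compat_l; lra).
  destruct (mvt_abs (fun N => k N - eta * ln N) (fun N => kd N - eta / N) N1 N2) as [z [Hz1 Hz2]].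
  { intros z Hz. rewrite Rmin_left in Hz by lra. auto_derive.
    - split; [eexists; apply Hd; lra|]. split; [lra|exact I].
    - rewrite (is_derive_unique (fun x : R => k x) z (kd z)) by (apply Hd; lra). field. lra. }
  rewrite Rmin_left, Rmax_right in Hz1 by lra.
  assert (Hz := Hlow z ltac:(lra) ltac:(lra)).
  assert (0 <= (kd z - eta / z) * (N2 - N1)) by (apply Rmult_le_pos; lra).
  assert (HN2M := HM N2 ltac:(lra)).
  assert (Eln : ln N2 = ln N1 + Rmax 0 L) by (unfold N2; rewrite ln_mult, ln_exp; [reflexivity|lra|apply exp_pos]).
  rewrite Eln in Hz2.
  assert (eta * L <= eta * Rmax 0 L) by (apply Rmult_le_compat_l; lra).
  assert (EL : eta * L = M - k N1 + eta) by (unfold L; field; lra). lra.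
Qed.

(** The integrand [h] is prescribed by a norm and may contain [f] or [g], which are arbitrary
    outside the open domain; [h'] is a continuous function that agrees with it inside. *)
Lemma iint_rectangle_le R0 th (h h' : R -> R -> R) N :
  0 <= th -> R0 <= N -> cont_strip R0 h' ->
  (forall w y, 0 < w < th -> R0 < y -> h w y = h' w y) ->
  (forall w y, 0 < w < th -> R0 < y -> 0 <= h' w y) ->
  is_finite (iint R0 th h) -> rint2 th R0 N h' <= real (iint R0 th h).
Proof.
  intros Hth HN Ch E H0 Hfin.
  assert (Eq : forall M, R0 <= M -> rint2 th R0 M h = rint2 th R0 M h').
  { intros M HM. apply rint2_ext; try assumption. intros; apply E; lra. }
  rewrite <- Eq by exact HN.
  apply (le_Lim_mono (fun N => rint2 th R0 N h) R0 N); [|exact Hfin|exact HN].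
  intros x y Hx Hy. rewrite !Eq by lra. apply rint2_mono; assumption.
Qed.

Lemma iint_le_bound R0 th (h h' : R -> R -> R) B :
  0 <= th -> (forall w y, 0 < w < th -> R0 < y -> h w y = h' w y) ->
  (forall N, R0 <= N -> rint2 th R0 N h' <= B) ->
  is_finite (iint R0 th h) -> real (iint R0 th h) <= B.
Proof.
  intros Hth E HB Hfin.
  apply (Lim_le_bound (fun N => rint2 th R0 N h) R0 B); [|exact Hfin].
  intros N HN. rewrite (rint2_ext th R0 N h h'); try assumption; [now apply HB|].
  intros; apply E; lra.
Qed.

(** * The energy estimate *)

Section Energy.

Variables (R0 th eps e C d : R).
Variables (Us Usw Vs Q Qy L0 Upy Vw Z Zw u v P f g : R -> R -> R).
Hypothesis HR0 : 0 < R0.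
Hypothesis Hth : 0 < th <= 1.
Hypothesis He : 0 < e.
Hypothesis Ee : sqrt eps = e.
Hypothesis Ee2 : eps = e ^ 2.
Hypothesis Heth : e ^ 2 <= th.
Hypothesis HC : 0 <= C.
Hypothesis Hd : 0 <= d <= 1.
Hypothesis HB : profile_bounds R0 th eps C Us Usw Vs Q Qy L0 Upy Vw Z Zw.
Hypothesis HL : linearized_system R0 th eps Us Vs u v P f g.

Let rd := rad R0 eps.
Let rho y := Rpower (rd y) d.
Let Vsy w y := (- Usw w y - e * Vs w y) / rd y.
(** [f] and [g] carry no regularity of their own; inside the domain they equal the left-hand sides
    of the equations, which are continuous up to the boundary. *)
Let fe w y := momentum_w e (rd y) (u w y) (d1 u w y) (d2 u w y) (d1 (d1 u) w y) (d2 (d2 u) w y)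
  (v w y) (d1 v w y) (d1 P w y) (Us w y) (Usw w y) (e * L0 w y + Upy w y + e * Qy w y) (Vs w y).
Let ge w y := momentum_y e (rd y) (u w y) (d1 u w y) (v w y) (d1 v w y) (d2 v w y)
  (d1 (d1 v) w y) (d2 (d2 v) w y) (d2 P w y) (Us w y) (Vs w y) (Vw w y + Zw w y) (Vsy w y).

Lemma energy_e_le_1 : e <= 1.
Proof. apply Rnot_lt_le. intros H. assert (1 < e ^ 2) by nra. lra. Qed.

Lemma energy_rd_ge y : R0 <= y -> R0 <= rd y.
Proof. intros; now apply rad_ge. Qed.

Lemma energy_rd_derive y : is_derive rd y e.
Proof. rewrite <- Ee. apply rad_derive. Qed.

Lemma energy_rd_le y : R0 <= y -> rd y <= y.
Proof. intros. apply rad_le; [|assumption]. lra. Qed.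

Lemma energy_rho_pos y : 0 < rho y.
Proof. apply exp_pos. Qed.

Lemma energy_rho_derive y : R0 <= y -> is_derive rho y (d * e * rho y / rd y).
Proof.
  intros Hy. assert (Hr := energy_rd_ge y Hy). unfold rho, Rpower.
  assert (D := energy_rd_derive y).
  auto_derive.
  - split; [now exists e|]. split; [lra|exact I].
  - rewrite (is_derive_Derive _ _ _ D). field. lra.
Qed.

(** As [d] lies in [0, 1], the weight lies between 1 and the radius, whichever of the two is larger;
    the upper bound also uses that the radius is at most [y]. *)
Lemma energy_rho_bounds y : R0 <= y -> Rmin 1 R0 <= rho y <= 1 + y.
Proof.
  intros Hy. assert (Hr := energy_rd_ge y Hy). assert (Hr2 := energy_rd_le y Hy).
  unfold rho. destruct (Rle_dec 1 (rd y)) as [H|H].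
  - assert (H0 := Rmin_l 1 R0). split.
    + apply Rle_trans with (Rpower (rd y) 0); [rewrite Rpower_O; lra|]. apply Rle_Rpower; lra.
    + apply Rle_trans with (Rpower (rd y) 1); [apply Rle_Rpower; lra|rewrite Rpower_1; lra].
  - assert (Hln : ln (rd y) < 0) by (rewrite <- ln_1; apply ln_increasing; lra).
    assert (H1 : rd y <= Rpower (rd y) d).
    { rewrite <- (Rpower_1 (rd y)) at 1 by lra. unfold Rpower.
      destruct (Req_dec d 1) as [->|Hne]; [lra|]. left. apply exp_increasing. nra. }
    assert (H2 : Rpower (rd y) d <= 1).
    { unfold Rpower. rewrite <- exp_0. destruct (Req_dec d 0) as [->|Hne]; [rewrite Rmult_0_l; lra|].
      left. apply exp_increasing. nra. }
    assert (H0 := Rmin_r 1 R0). split; lra.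
Qed.

Lemma energy_weights y : R0 <= y ->
  Rpower (rd y) (1 + d) = rd y * rho y /\ Rpower (rd y) (-1 + d) = rho y / rd y /\
  Rpower (rd y) (2 + d) = rd y ^ 2 * rho y.
Proof.
  intros Hy. assert (Hr := energy_rd_ge y Hy). rewrite !Rpower_plus. fold (rho y).
  replace (-1) with (- (1)) by ring. rewrite Rpower_Ropp, Rpower_1 by lra. split; [reflexivity|]. split; [field; lra|].
  replace 2 with (INR 2) by (simpl; ring). rewrite Rpower_pow by lra. reflexivity.
Qed.

Lemma energy_Vs_derive w y : R0 <= y -> is_derive (Vs w) y (Vsy w y).
Proof.
  intros Hy. assert (Hr := energy_rd_ge y Hy).
  apply is_derive_ext_loc with (fun t => rd t * Vs w t / rd t).
  { apply (filter_imp _ _) with (2 := rad_pos_near R0 eps HR0 y Hy). intros t Ht. fold (rd t) in Ht.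
    assert (E : rd t * Vs w t / rd t = Vs w t) by (field; lra). exact E. }
  assert (D := pb_rvs_y _ _ _ _ _ _ _ _ _ _ _ _ _ _ HB w y Hy).
  change (rad R0 eps) with rd in D. assert (Dr := energy_rd_derive y).
  set (RV := fun t => rd t * Vs w t) in *.
  change (is_derive (fun t => RV t / rd t) y (Vsy w y)).
  auto_derive.
  - split; [now eexists; apply D|]. split; [now exists e|]. split; [lra|exact I].
  - rewrite (is_derive_Derive RV _ _ D), (is_derive_Derive _ _ _ Dr).
    unfold Vsy, RV. field. lra.
Qed.

Lemma energy_forces w y : 0 < w < th -> R0 < y -> f w y = fe w y /\ g w y = ge w y.
Proof.
  intros Hw Hy. assert (Hr := energy_rd_ge y ltac:(lra)).
  assert (E1 := pb_us_w _ _ _ _ _ _ _ _ _ _ _ _ _ _ HB w y ltac:(lra)).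
  assert (E2 := pb_us_y _ _ _ _ _ _ _ _ _ _ _ _ _ _ HB w y ltac:(lra)).
  assert (E3 := pb_vs_w _ _ _ _ _ _ _ _ _ _ _ _ _ _ HB w y ltac:(lra)).
  assert (E4 := energy_Vs_derive w y ltac:(lra)).
  apply is_derive_unique in E1. apply is_derive_unique in E4.
  change (d1 Us w y = Usw w y) in E1. change (d2 Vs w y = Vsy w y) in E4.
  split.
  - rewrite <- (ls_eq_u _ _ _ _ _ _ _ _ _ _ HL w y Hw Hy).
    unfold fe, momentum_w. cbv zeta. rewrite E1, E2, Ee.
    change (rad R0 eps y) with (rd y). generalize dependent (rd y). intros r Hr.
    rewrite Ee2. field. lra.
  - rewrite <- (ls_eq_v _ _ _ _ _ _ _ _ _ _ HL w y Hw Hy).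
    unfold ge, momentum_y. cbv zeta. rewrite E3, E4, Ee.
    change (rad R0 eps y) with (rd y). generalize (Vsy w y). generalize dependent (rd y). intros r Hr z.
    rewrite Ee2. field. lra.
Qed.

Lemma energy_class :
  (forall w y, continuity_2d_pt u w y) /\ (forall w y, continuity_2d_pt v w y) /\
  (forall w y, continuity_2d_pt P w y) /\
  (forall w y, continuity_2d_pt (d1 u) w y) /\ (forall w y, continuity_2d_pt (d2 u) w y) /\
  (forall w y, continuity_2d_pt (d1 v) w y) /\ (forall w y, continuity_2d_pt (d2 v) w y) /\
  (forall w y, continuity_2d_pt (d1 P) w y) /\ (forall w y, continuity_2d_pt (d2 P) w y) /\
  (forall w y, continuity_2d_pt (d1 (d1 u)) w y) /\ (forall w y, continuity_2d_pt (d1 (d2 u)) w y) /\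
  (forall w y, continuity_2d_pt (d2 (d2 u)) w y) /\ (forall w y, continuity_2d_pt (d1 (d1 v)) w y) /\
  (forall w y, continuity_2d_pt (d2 (d1 v)) w y) /\ (forall w y, continuity_2d_pt (d2 (d2 v)) w y).
Proof.
  assert (Hu := ls_u _ _ _ _ _ _ _ _ _ _ HL). assert (Hv := ls_v _ _ _ _ _ _ _ _ _ _ HL).
  assert (HP := ls_P _ _ _ _ _ _ _ _ _ _ HL).
  destruct (class_C_d1 _ _ Hu) as [u1 _]. destruct (class_C_d2 _ _ Hu) as [u2 _].
  destruct (class_C_d1 _ _ Hv) as [v1 _]. destruct (class_C_d2 _ _ Hv) as [v2 _].
  exact (conj (class_C_cont _ _ Hu) (conj (class_C_cont _ _ Hv) (conj (class_C_cont _ _ HP)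
    (conj (class_C_cont _ _ u1) (conj (class_C_cont _ _ u2)
    (conj (class_C_cont _ _ v1) (conj (class_C_cont _ _ v2)
    (conj (class_C_cont _ _ (proj1 (class_C_d1 _ _ HP)))
    (conj (class_C_cont _ _ (proj1 (class_C_d2 _ _ HP)))
    (conj (class_C_cont _ _ (proj1 (class_C_d1 _ _ u1)))
    (conj (class_C_cont _ _ (proj1 (class_C_d1 _ _ u2)))
    (conj (class_C_cont _ _ (proj1 (class_C_d2 _ _ u2)))
    (conj (class_C_cont _ _ (proj1 (class_C_d1 _ _ v1)))
    (conj (class_C_cont _ _ (proj1 (class_C_d2 _ _ v1)))
          (class_C_cont _ _ (proj1 (class_C_d2 _ _ v2))))))))))))))))).
Qed.

(** The divergence condition holds near every interior point and can be differentiated there;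
    Schwarz's theorem puts the mixed derivatives into the order used in the fluxes. *)
Lemma energy_divergence w y : 0 < w < th -> R0 < y ->
  d1 u w y = - (e * v w y + rd y * d2 v w y) /\
  d1 (d1 u) w y = - (e * d1 v w y + rd y * d2 (d1 v) w y) /\
  d1 (d2 u) w y = - (2 * e * d2 v w y + rd y * d2 (d2 v) w y).
Proof.
  assert (Hu := ls_u _ _ _ _ _ _ _ _ _ _ HL). assert (Hv := ls_v _ _ _ _ _ _ _ _ _ _ HL).
  assert (Ediv : forall w y, 0 < w < th -> R0 < y -> d1 u w y = - (e * v w y + rd y * d2 v w y)).
  { intros s t Hs Ht. assert (Hr := energy_rd_ge t ltac:(lra)).
    assert (H := ls_div _ _ _ _ _ _ _ _ _ _ HL s t Hs Ht). cbv zeta in H. rewrite Ee in H.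
    change (rad R0 eps t) with (rd t) in H.
    apply Rmult_eq_reg_l with (/ rd t); [|apply Rinv_neq_0_compat; lra].
    transitivity (- (e / rd t * v s t + d2 v s t)); [lra|field; lra]. }
  intros Hw Hy.
  destruct (class_C_d1 _ _ Hv) as [Cv1 Dv1]. destruct (class_C_d2 _ _ Hv) as [Cv2 Dv2].
  destruct (class_C_d1 _ _ Cv2) as [_ Dv21]. destruct (class_C_d2 _ _ Cv2) as [_ Dv22].
  split; [now apply Ediv|]. split.
  - rewrite <- (class_C_Schwarz v Hv). apply is_derive_unique.
    apply is_derive_ext_loc with (fun s => - (e * v s y + rd y * d2 v s y)).
    + apply (locally_interval _ 0 th); [exact Hw|]. intros z Hz. symmetry. now apply Ediv.
    + apply @is_derive_opp, @is_derive_plus; apply is_derive_scal; [apply Dv1|apply Dv21].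
  - rewrite (class_C_Schwarz u Hu). apply is_derive_unique.
    apply is_derive_ext_loc with (fun t => - (e * v w t + rd t * d2 v w t)).
    + apply (locally_interval _ R0 (y + 1)); [lra|]. intros z Hz. symmetry. apply Ediv; lra.
    + assert (Dr := energy_rd_derive y). auto_derive.
      * split; [eexists; apply Dv2|]. split; [now exists e|]. split; [eexists; apply Dv22|exact I].
      * rewrite (is_derive_Derive _ _ _ (Dv2 w y)),
          (is_derive_Derive _ _ _ (Dv22 w y)),
          (is_derive_Derive _ _ _ Dr). ring.
Qed.

Let X w y := flux_w e (rd y) (rho y) (u w y) (d1 u w y) (d2 u w y) (v w y) (d1 v w y)
  (P w y) (Us w y) (Z w y).
Let Xw w y := flux_w_dw e (rd y) (rho y) (u w y) (d1 u w y) (d2 u w y) (d1 (d1 u) w y)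
  (d1 (d2 u) w y) (v w y) (d1 v w y) (d1 (d1 v) w y) (P w y) (d1 P w y) (Us w y) (Usw w y)
  (Z w y) (Zw w y).
Let Y w y := flux_y e (rd y) (rho y) (u w y) (d2 u w y) (v w y) (d1 v w y) (d2 v w y)
  (P w y) (Vs w y) (Q w y).
Let Yy w y := flux_y_dy e (rd y) (rho y) d (u w y) (d2 u w y) (d2 (d2 u) w y) (v w y)
  (d1 v w y) (d2 v w y) (d2 (d1 v) w y) (d2 (d2 v) w y) (P w y) (d2 P w y) (Usw w y) (Vs w y)
  (Q w y) (Qy w y).

Lemma energy_X_derive w y : R0 <= y -> is_derive (fun s => X s y) w (Xw w y).
Proof.
  intros Hy. assert (Hr := energy_rd_ge y Hy).
  destruct (class_C_d1 _ _ (ls_u _ _ _ _ _ _ _ _ _ _ HL)) as [C1 Du].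
  destruct (class_C_d2 _ _ (ls_u _ _ _ _ _ _ _ _ _ _ HL)) as [C2 _].
  destruct (class_C_d1 _ _ (ls_v _ _ _ _ _ _ _ _ _ _ HL)) as [C3 Dv].
  exact (is_derive_flux_w e (rd y) (rho y) w (fun s => u s y) (fun s => d1 u s y) (fun s => d2 u s y)
    (fun s => v s y) (fun s => d1 v s y) (fun s => P s y) (fun s => Us s y) (fun s => Z s y)
    _ _ _ _ _ _ _ _ (Rgt_not_eq _ _ (Rlt_le_trans _ _ _ HR0 Hr))
    (Du w y) (proj2 (class_C_d1 _ _ C1) w y) (proj2 (class_C_d1 _ _ C2) w y)
    (Dv w y) (proj2 (class_C_d1 _ _ C3) w y)
    (proj2 (class_C_d1 _ _ (ls_P _ _ _ _ _ _ _ _ _ _ HL)) w y)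
    (pb_us_w _ _ _ _ _ _ _ _ _ _ _ _ _ _ HB w y Hy)
    (pb_Z_w _ _ _ _ _ _ _ _ _ _ _ _ _ _ HB w y Hy) eq_refl eq_refl).
Qed.

Lemma energy_Y_derive w y : R0 <= y -> is_derive (Y w) y (Yy w y).
Proof.
  intros Hy. assert (Hr := energy_rd_ge y Hy).
  destruct (class_C_d2 _ _ (ls_u _ _ _ _ _ _ _ _ _ _ HL)) as [C1 Du].
  destruct (class_C_d2 _ _ (ls_v _ _ _ _ _ _ _ _ _ _ HL)) as [C2 Dv].
  destruct (class_C_d1 _ _ (ls_v _ _ _ _ _ _ _ _ _ _ HL)) as [C3 _].
  exact (is_derive_flux_y e d y rd rho (u w) (d2 u w) (v w) (d1 v w) (d2 v w) (P w) (Vs w) (Q w)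
    _ _ _ _ _ _ (Usw w y) _ _ (Rgt_not_eq _ _ (Rlt_le_trans _ _ _ HR0 Hr))
    (energy_rd_derive y) (energy_rho_derive y Hy)
    (Du w y) (proj2 (class_C_d2 _ _ C1) w y) (Dv w y) (proj2 (class_C_d2 _ _ C3) w y)
    (proj2 (class_C_d2 _ _ C2) w y)
    (proj2 (class_C_d2 _ _ (ls_P _ _ _ _ _ _ _ _ _ _ HL)) w y)
    (energy_Vs_derive w y Hy)
    (pb_Q_y _ _ _ _ _ _ _ _ _ _ _ _ _ _ HB w y Hy) eq_refl eq_refl eq_refl).
Qed.

Lemma energy_cont :
  cont_strip R0 (fun _ y => rd y) /\ cont_strip R0 (fun _ y => rho y) /\
  cont_strip R0 X /\ cont_strip R0 Xw /\ cont_strip R0 Y /\ cont_strip R0 Yy /\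
  cont_strip R0 fe /\ cont_strip R0 ge.
Proof.
  destruct energy_class as (c1 & c2 & c3 & c4 & c5 & c6 & c7 & c8 & c9 & c10 & c11 & c12 & c13 & c14 & c15).
  destruct (pb_cont _ _ _ _ _ _ _ _ _ _ _ _ _ _ HB) as (b1 & b2 & b3 & b4 & b5 & b6 & b7 & b8 & b9 & b10).
  assert (Crd : cont_strip R0 (fun _ y => rd y)).
  { intros w y _. apply continuity_2d_pt_snd, is_derive_continuity_pt with (1 := energy_rd_derive y). }
  assert (Crho : cont_strip R0 (fun _ y => rho y)).
  { intros w y Hy. apply continuity_2d_pt_snd, is_derive_continuity_pt with (1 := energy_rho_derive y Hy). }
  split; [exact Crd|]. split; [exact Crho|].
  assert (Hnz : forall y, R0 <= y -> rd y <> 0 /\ rd y ^ 2 <> 0).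
  { intros y Hy. assert (Hr := energy_rd_ge y Hy). split; [lra|apply pow_nonzero; lra]. }
  assert (He0 : e <> 0 /\ e ^ 2 <> 0) by (split; [lra|apply pow_nonzero; lra]).
  repeat split; intros w y Hy; destruct (Hnz y Hy) as [z1 z2]; destruct He0 as [z3 z4];
    [unfold X, flux_w|unfold Xw, flux_w_dw|unfold Y, flux_y|unfold Yy, flux_y_dy
    |unfold fe, momentum_w|unfold ge, momentum_y, Vsy]; cbv zeta; solve_cont2.
Qed.

(** The normal stress condition cancels [p * u] against [2 * e ^ 2 * uw * u / r], the shear
    condition cancels [e ^ 4 * vw * v / r] against [e ^ 2 * uy * v], and [Z] vanishes; only the
    convective term remains. *)
Lemma energy_X_sign y : R0 < y -> 0 <= X th y /\ X 0 y = 0.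
Proof.
  intros Hy. assert (Hr := energy_rd_ge y ltac:(lra)).
  assert (Hs := ls_outflow_shear _ _ _ _ _ _ _ _ _ _ HL y ltac:(lra)).
  assert (Hn := ls_outflow_normal _ _ _ _ _ _ _ _ _ _ HL y ltac:(lra)).
  destruct (ls_inflow _ _ _ _ _ _ _ _ _ _ HL y ltac:(lra)) as [Hu0 Hv0].
  assert (HU := pb_us_pos _ _ _ _ _ _ _ _ _ _ _ _ _ _ HB y Hy).
  assert (HZ := pb_Z_th _ _ _ _ _ _ _ _ _ _ _ _ _ _ HB y ltac:(lra)).
  change (rad R0 eps y) with (rd y) in *. assert (Hk := energy_rho_pos y).
  unfold X, flux_w. split.
  - assert (Hp : P th y = 2 * e ^ 2 * d1 u th y / rd y)
      by (rewrite Ee2 in Hn; apply Rmult_eq_reg_r with (rd y); [rewrite Hn; field|]; lra).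
    assert (Huy : d2 u th y = - (e ^ 2 * d1 v th y) / rd y)
      by (rewrite Ee2 in Hs; apply Rmult_eq_reg_l with (rd y); [field_simplify|]; lra).
    rewrite Hp, Huy, HZ.
    replace (_ - _ + _) with (/ 2 * Us th y * (u th y ^ 2 + e ^ 2 * v th y ^ 2) * rho y) by (field; lra).
    repeat apply Rmult_le_pos; try lra.
    apply Rplus_le_le_0_compat; [|apply Rmult_le_pos]; apply pow2_ge_0.
  - rewrite Hu0, Hv0. field. lra.
Qed.

Lemma energy_Y_wall w : 0 <= w <= th -> Y w R0 = 0.
Proof.
  intros Hw. destruct (ls_wall _ _ _ _ _ _ _ _ _ _ HL w Hw) as [Hu0 Hv0].
  unfold Y, flux_y. rewrite Hu0, Hv0. ring.
Qed.

Let a1 w y := rd y * rho y * d2 u w y ^ 2.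
Let a2 w y := rho y * d1 u w y ^ 2.
Let a3 w y := rho y * u w y ^ 2.
Let a4 w y := rho y * (e * d1 v w y) ^ 2.
Let a5 w y := rho y * (e * v w y) ^ 2.
Let a6 w y := rho y * P w y ^ 2.
Let a7 w y := rho y * (rd y * fe w y) ^ 2.
Let a8 w y := rho y * (e * (rd y * ge w y)) ^ 2.
Let a9 w y := (rd y * v w y) ^ 2 / (1 + y) ^ 2.

Lemma energy_density_cont :
  cont_strip R0 a1 /\ cont_strip R0 a2 /\ cont_strip R0 a3 /\ cont_strip R0 a4 /\
  cont_strip R0 a5 /\ cont_strip R0 a6 /\ cont_strip R0 a7 /\ cont_strip R0 a8 /\ cont_strip R0 a9.
Proof.
  destruct energy_class as (c1 & c2 & c3 & c4 & c5 & c6 & c7 & c8 & c9 & c10 & c11 & c12 & c13 & c14 & c15).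
  destruct energy_cont as (Crd & Crho & _ & _ & _ & _ & Cf & Cg).
  repeat split; intros w y Hy;
    [unfold a1|unfold a2|unfold a3|unfold a4|unfold a5|unfold a6|unfold a7|unfold a8|unfold a9];
    solve_cont2; apply pow_nonzero; lra.
Qed.

Definition energy_K1 := 5 * (10 * (C + C / R0 + / R0 + 1)) + 2 * (10 * (C + C / R0 + / R0 + 1)) ^ 2 / R0.

(** The 5 is 1 plus the constant 4 of Poincare's inequality. The last summand collects the bound [C]
    of [Upy], Hardy's constant and the lower bound of the weight. *)
Definition energy_K := 5 * energy_K1 + 4 * C ^ 2 / Rmin 1 R0.

Lemma energy_K_nonneg : 0 <= energy_K1 <= energy_K.
Proof.
  assert (0 < / R0) by now apply Rinv_0_lt_compat.
  assert (0 <= C / R0) by (apply Rmult_le_pos; lra).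
  assert (0 < / Rmin 1 R0) by (apply Rinv_0_lt_compat, Rmin_glb_lt; lra).
  assert (0 <= 2 * (10 * (C + C / R0 + / R0 + 1)) ^ 2 / R0)
    by (apply Rmult_le_pos; [apply Rmult_le_pos; [lra|apply pow2_ge_0]|lra]).
  assert (0 <= 4 * C ^ 2 / Rmin 1 R0)
    by (apply Rmult_le_pos; [apply Rmult_le_pos; [lra|apply pow2_ge_0]|lra]).
  unfold energy_K, energy_K1. lra.
Qed.

Lemma energy_pointwise w y : 0 < w < th -> R0 < y ->
  Xw w y + Yy w y + / 2 * a1 w y <=
  energy_K1 * (th * (a2 w y + a4 w y) + (a3 w y + a5 w y) / th) + d * th * a6 w y
  + a7 w y + a8 w y + th * C ^ 2 * a9 w y.
Proof.
  intros Hw Hy. assert (Hy' : R0 <= y) by lra. assert (Hr := energy_rd_ge y Hy').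
  destruct (energy_divergence w y Hw Hy) as (Eu & Euw & Euy).
  destruct (pb_bound _ _ _ _ _ _ _ _ _ _ _ _ _ _ HB w y Hw Hy)
    as (B1 & B2 & B3 & B4 & B5 & B6 & B7 & B8).
  change (rad R0 eps y) with (rd y) in B4, B5.
  assert (Hk := energy_rho_pos y). destruct (energy_rho_bounds y Hy') as [_ Hk2].
  assert (ID := energy_identity e (rd y) (rho y) d (u w y) (d1 u w y) (d2 u w y) (d1 (d1 u) w y)
    (d1 (d2 u) w y) (d2 (d2 u) w y) (v w y) (d1 v w y) (d2 v w y) (d1 (d1 v) w y) (d2 (d1 v) w y)
    (d2 (d2 v) w y) (P w y) (d1 P w y) (d2 P w y) (Us w y) (Usw w y)
    (e * L0 w y + Upy w y + e * Qy w y) (Vs w y) (Vw w y + Zw w y) (Vsy w y) (Q w y) (Qy w y)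
    (L0 w y) (Upy w y) (Vw w y) (Z w y) (Zw w y)
    ltac:(lra) ltac:(lra) Eu Euw Euy eq_refl eq_refl eq_refl).
  assert (BD := energy_remainder_bound R0 C th e (rd y) d (u w y) (d1 u w y) (d2 u w y)
    (e * d1 v w y) (e * v w y) (P w y) (fe w y) (ge w y) (Us w y) (Usw w y) (Vs w y) (Q w y)
    (L0 w y) (Upy w y) (Vw w y) (Z w y) (rd y * v w y)
    HR0 HC Hth He Heth Hr Hd B1 B2 B3 B4 B5 B7 B8).
  cbv zeta in ID, BD. fold (fe w y) (ge w y) in ID.
  change (flux_w_dw _ _ _ _ _ _ _ _ _ _ _ _ _ _ _ _ _) with (Xw w y) in ID.
  change (flux_y_dy _ _ _ _ _ _ _ _ _ _ _ _ _ _ _ _ _ _) with (Yy w y) in ID.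
  apply Rmult_le_compat_l with (r := rho y) in BD; [|lra].
  rewrite <- ID in BD. fold energy_K1 in BD.
  (* [Upy ^ 2] decays like [(1 + y) ^ (- 4)]: one half of this dominates the weight, the other half
     is Hardy's weight. *)
  assert (HU : rho y * (Upy w y * (rd y * v w y)) ^ 2 <= C ^ 2 * a9 w y).
  { unfold a9.
    replace (rho y * (Upy w y * (rd y * v w y)) ^ 2) with ((rho y * Upy w y ^ 2) * (rd y * v w y) ^ 2) by ring.
    replace (C ^ 2 * ((rd y * v w y) ^ 2 / (1 + y) ^ 2)) with (C ^ 2 / (1 + y) ^ 2 * (rd y * v w y) ^ 2)
      by (field; lra).
    apply Rmult_le_compat_r; [apply pow2_ge_0|].
    assert (Hy2 : 0 < (1 + y) ^ 2) by (apply pow_lt; lra).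
    apply Rmult_le_reg_r with ((1 + y) ^ 2); [lra|].
    replace (C ^ 2 / (1 + y) ^ 2 * (1 + y) ^ 2) with (C ^ 2) by (field; lra).
    assert (HU2 : (Rabs (Upy w y) * (1 + y) ^ 2) ^ 2 <= C ^ 2).
    { apply pow_incr. split; [apply Rmult_le_pos; [apply Rabs_pos|lra]|exact B6]. }
    rewrite Rpow_mult_distr, pow2_abs in HU2.
    eapply Rle_trans; [|exact HU2].
    assert (0 <= Upy w y ^ 2) by apply pow2_ge_0.
    replace (rho y * Upy w y ^ 2 * (1 + y) ^ 2) with (Upy w y ^ 2 * (rho y * (1 + y) ^ 2)) by ring.
    apply Rmult_le_compat_l; [assumption|].
    replace (((1 + y) ^ 2) ^ 2) with ((1 + y) ^ 2 * (1 + y) ^ 2) by ring.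
    apply Rmult_le_compat_r; [lra|]. nra. }
  apply Rmult_le_compat_l with (r := th) in HU; [|lra].
  apply Rle_trans with (rho y * (/ 2 * (rd y * d2 u w y ^ 2)
     + energy_K1 * (th * (d1 u w y ^ 2 + (e * d1 v w y) ^ 2) + (u w y ^ 2 + (e * v w y) ^ 2) / th)
     + d * (th * P w y ^ 2) + (rd y * fe w y) ^ 2 + (e * (rd y * ge w y)) ^ 2
     + th * (Upy w y * (rd y * v w y)) ^ 2) - / 2 * a1 w y).
  - unfold a1 in *. lra.
  - unfold a1, a2, a3, a4, a5, a6, a7, a8 in *.
    apply Rle_trans with (energy_K1 * (th * (rho y * d1 u w y ^ 2 + rho y * (e * d1 v w y) ^ 2)
       + (rho y * u w y ^ 2 + rho y * (e * v w y) ^ 2) / th) + d * th * (rho y * P w y ^ 2)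
       + rho y * (rd y * fe w y) ^ 2 + rho y * (e * (rd y * ge w y)) ^ 2
       + th * (rho y * (Upy w y * (rd y * v w y)) ^ 2)).
    + right. field. lra.
    + lra.
Qed.

(** The density whose integrability makes the outer flux small. The factors [/ e ^ 2] undo the
    scaling in [a4] and [a5]; they are harmless because [D] only serves to select good radii. *)
Let D w y := / R0 * a1 w y + (1 * a2 w y + (1 * a3 w y + (/ e ^ 2 * a4 w y
  + (/ e ^ 2 * a5 w y + 1 * a6 w y)))).

(** The flux is at most the radius times quadratic terms, and linear growth in [y] is what
    [small_boundary_flux] can absorb. The derivative [vy] does not occur in [D]; the divergence
    condition turns [r * vy] into [- uw - e * v]. *)
Lemma energy_flux_bound w y : 0 < w < th -> R0 < y ->
  - Y w y <= (C + C / R0 + 1 + 2 / R0) * y * D w y.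
Proof.
  intros Hw Hy. assert (Hy' : R0 <= y) by lra. assert (Hr := energy_rd_ge y Hy').
  assert (Hry := energy_rd_le y Hy').
  destruct (energy_divergence w y Hw Hy) as (Eu & _ & _).
  destruct (pb_bound _ _ _ _ _ _ _ _ _ _ _ _ _ _ HB w y Hw Hy) as (_ & _ & B3 & B4 & _).
  change (rad R0 eps y) with (rd y) in B4.
  assert (Hk := energy_rho_pos y). assert (He1 := energy_e_le_1).
  assert (HiR : 0 < / R0) by now apply Rinv_0_lt_compat.
  assert (HCR : 0 <= C / R0) by (apply Rmult_le_pos; lra).
  assert (ED : D w y = rho y * (rd y / R0 * d2 u w y ^ 2 + d1 u w y ^ 2 + u w y ^ 2
    + d1 v w y ^ 2 + v w y ^ 2 + P w y ^ 2))
    by (unfold D, a1, a2, a3, a4, a5, a6; field; lra).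
  rewrite ED. unfold Y, flux_y.
  generalize dependent (rho y). generalize dependent (rd y). intros r Hr Hry Eu B4 k Hk _.
  generalize dependent (d1 u w y). generalize (u w y) (v w y) (d2 u w y) (d1 v w y) (d2 v w y) (P w y).
  intros a v' uy vw vy p uw Eu.
  assert (HQ : Rabs (Q w y) <= C / R0).
  { apply Rmult_le_reg_r with r; [lra|]. eapply Rle_trans; [exact B4|].
    replace (C / R0 * r) with (C * (r * / R0)) by (unfold Rdiv; ring).
    rewrite <- (Rmult_1_r C) at 1. apply Rmult_le_compat_l; [lra|].
    apply Rmult_le_reg_r with R0; [lra|]. rewrite Rmult_assoc, Rinv_l; lra. }
  assert (HeQ : Rabs (- (e * Q w y)) <= C / R0).
  { rewrite Rabs_Ropp, Rabs_mult, (Rabs_pos_eq e) by lra. assert (H := Rabs_pos (Q w y)).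
    apply Rle_trans with (1 * Rabs (Q w y)); [apply Rmult_le_compat_r; lra|lra]. }
  assert (Hee : 0 <= e ^ 2 <= 1) by (split; [apply pow2_ge_0|lra]).
  apply Rabs_le_between in B3.
  assert (Y1 : - / 2 * Vs w y * a ^ 2 <= C / 2 * a ^ 2) by (apply Rmult_le_compat_r; [apply pow2_ge_0|lra]).
  assert (Y2 : - / 2 * (Vs w y) * (e ^ 2 * v' ^ 2) <= C / 2 * v' ^ 2).
  { apply Rle_trans with (C / 2 * (e ^ 2 * v' ^ 2)).
    - apply Rmult_le_compat_r; [apply Rmult_le_pos; apply pow2_ge_0|lra].
    - apply Rmult_le_compat_l; [lra|].
      apply Rle_trans with (1 * v' ^ 2); [apply Rmult_le_compat_r; [apply pow2_ge_0|lra]|lra]. }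
  assert (Y3 := young (- 1) 1 1 p v' ltac:(apply Rabs_le; lra) Rlt_0_1).
  assert (Y4 := young 1 1 1 uy a ltac:(apply Rabs_le; lra) Rlt_0_1).
  assert (Y5 := young (- (e * Q w y)) (C / R0) 1 a v' HeQ Rlt_0_1).
  assert (Y6 := young (- 2 * e ^ 2) 2 1 v' uw ltac:(apply Rabs_le; lra) Rlt_0_1).
  assert (Y7 := young (e ^ 2) 1 1 vw a ltac:(apply Rabs_le; lra) Rlt_0_1).
  assert (Y8 : 0 <= e * (e ^ 2 * v' ^ 2))
    by (apply Rmult_le_pos; [lra|apply Rmult_le_pos; apply pow2_ge_0]).
  assert (q1 := pow2_ge_0 a). assert (q2 := pow2_ge_0 v'). assert (q3 := pow2_ge_0 p).
  assert (q4 := pow2_ge_0 uy). assert (q5 := pow2_ge_0 uw). assert (q6 := pow2_ge_0 vw).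
  set (S := uy ^ 2 + uw ^ 2 + a ^ 2 + vw ^ 2 + v' ^ 2 + p ^ 2).
  assert (HS : 0 <= S) by (unfold S; lra).
  assert (HS' : S <= r / R0 * uy ^ 2 + uw ^ 2 + a ^ 2 + vw ^ 2 + v' ^ 2 + p ^ 2).
  { assert (uy ^ 2 <= r / R0 * uy ^ 2); [|unfold S; lra].
    rewrite <- (Rmult_1_l (uy ^ 2)) at 1. apply Rmult_le_compat_r; [lra|].
    apply Rmult_le_reg_r with R0; [lra|]. unfold Rdiv. rewrite Rmult_assoc, Rinv_l; lra. }
  assert (I1 : - / 2 * Vs w y * a ^ 2 + - / 2 * Vs w y * (e ^ 2 * v' ^ 2) - p * v' + uy * a
    - e * Q w y * (a * v') <= (C + 1 + C / R0) * S).
  { assert (0 <= C * S) by (apply Rmult_le_pos; lra).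
    assert (C / 2 * a ^ 2 + C / 2 * v' ^ 2 <= C * S) by (unfold S in *; nra).
    assert (C / R0 / 2 * (1 * a ^ 2 + v' ^ 2) <= C / R0 * S).
    { replace (C / R0 / 2 * (1 * a ^ 2 + v' ^ 2)) with (C / R0 * (/ 2 * (a ^ 2 + v' ^ 2))) by (field; lra).
      apply Rmult_le_compat_l; [lra|]. unfold S; lra. }
    assert (/ 2 * (p ^ 2 + v' ^ 2 + uy ^ 2 + a ^ 2) <= S) by (unfold S; lra).
    lra. }
  assert (I2 : - 2 * e ^ 2 * (v' * uw) - e * (e ^ 2 * v' ^ 2) + e ^ 2 * (vw * a) <= 2 * S)
    by (unfold S; lra).
  assert (I3 : 2 * S <= r * (2 / R0 * S)).
  { replace (r * (2 / R0 * S)) with (r / R0 * (2 * S)) by (field; lra).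
    rewrite <- (Rmult_1_l (2 * S)) at 1. apply Rmult_le_compat_r; [lra|].
    apply Rmult_le_reg_r with R0; [lra|]. unfold Rdiv. rewrite Rmult_assoc, Rinv_l; lra. }
  apply Rmult_le_compat_l with (r := r) in I1; [|lra].
  assert (I4 : r * ((C + C / R0 + 1 + 2 / R0) * S) <= y * ((C + C / R0 + 1 + 2 / R0) * S)).
  { apply Rmult_le_compat_r; [|lra]. apply Rmult_le_pos; lra. }
  assert (I5 : y * ((C + C / R0 + 1 + 2 / R0) * S) <= y * ((C + C / R0 + 1 + 2 / R0)
      * (r / R0 * uy ^ 2 + uw ^ 2 + a ^ 2 + vw ^ 2 + v' ^ 2 + p ^ 2))).
  { apply Rmult_le_compat_l; [lra|]. apply Rmult_le_compat_l; lra. }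
  match goal with |- ?L <= _ * (k * ?T) =>
    replace L with (k * (r * (- / 2 * Vs w y * a ^ 2 + - / 2 * Vs w y * (e ^ 2 * v' ^ 2) - p * v' + uy * a
      - e * Q w y * (a * v')) + (- 2 * e ^ 2 * (v' * uw) - e * (e ^ 2 * v' ^ 2) + e ^ 2 * (vw * a))));
    [apply Rle_trans with (k * (y * ((C + C / R0 + 1 + 2 / R0) * T)));
      [apply Rmult_le_compat_l; lra|right; ring]|]
  end.
  rewrite Eu. field.
Qed.

(** The third bound is Hardy's inequality for r v, which vanishes at the wall and has the
    [y]-derivative - u_omega; the weight is then inserted through its lower bound. *)
Lemma energy_poincare N : R0 <= N ->
  rint2 th R0 N a3 <= 4 * th ^ 2 * rint2 th R0 N a2 /\
  rint2 th R0 N a5 <= 4 * th ^ 2 * rint2 th R0 N a4 /\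
  rint2 th R0 N a9 <= 4 / Rmin 1 R0 * rint2 th R0 N a2.
Proof.
  intros HN.
  destruct energy_class as (c1 & c2 & c3 & c4 & c5 & c6 & c7 & _).
  destruct energy_cont as (Crd & Crho & _).
  destruct energy_density_cont as (A1 & A2 & A3 & A4 & A5 & A6 & A7 & A8 & A9).
  destruct (class_C_d1 _ _ (ls_u _ _ _ _ _ _ _ _ _ _ HL)) as [_ Du].
  destruct (class_C_d1 _ _ (ls_v _ _ _ _ _ _ _ _ _ _ HL)) as [_ Dv].
  destruct (class_C_d2 _ _ (ls_v _ _ _ _ _ _ _ _ _ _ HL)) as [_ Dv2].
  assert (H0 := ls_inflow _ _ _ _ _ _ _ _ _ _ HL).
  split; [|split].
  - apply (rint2_poincare u (d1 u) rho th R0 N); try assumption; try lra.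
    + intros w y _. apply c1.
    + intros w y _. apply c4.
    + intros y _. left. apply energy_rho_pos.
    + intros y Hy. now apply H0.
  - apply (rint2_poincare (fun w y => e * v w y) (fun w y => e * d1 v w y) rho th R0 N);
      try assumption; try lra.
    + intros w y. apply is_derive_scal, Dv.
    + intros w y _. solve_cont2.
    + intros w y _. solve_cont2.
    + intros y _. left. apply energy_rho_pos.
    + intros y Hy. rewrite (proj2 (H0 y Hy)). ring.
  - set (Wy := fun w y => e * v w y + rd y * d2 v w y).
    assert (CWy : cont_strip R0 Wy) by (intros w y Hy; unfold Wy; solve_cont2).
    assert (Hm : 0 < Rmin 1 R0) by (apply Rmin_glb_lt; lra).
    assert (Hmi : 0 < / Rmin 1 R0) by now apply Rinv_0_lt_compat.
    apply Rle_trans with (4 * rint2 th R0 N (fun w y => Wy w y ^ 2)).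
    + apply (rint2_hardy (fun w y => rd y * v w y) Wy th R0 N); try assumption; try lra.
      * intros w y Hy. assert (Dr := energy_rd_derive y). unfold Wy. auto_derive.
        -- split; [now exists e|]. split; [eexists; apply Dv2|exact I].
        -- rewrite (is_derive_Derive _ _ _ (Dv2 w y)),
             (is_derive_Derive _ _ _ Dr). ring.
      * intros w y Hy. solve_cont2.
      * intros w Hw. rewrite (proj2 (ls_wall _ _ _ _ _ _ _ _ _ _ HL w Hw)). ring.
    + unfold Rdiv. rewrite Rmult_assoc. apply Rmult_le_compat_l; [lra|].
      rewrite <- rint2_scal by assumption.
      apply rint2_le; try assumption; try lra.
      * intros w y Hy. solve_cont2.
      * intros w y Hy. now apply continuity_2d_pt_scal, A2.
      * intros w y Hw Hy. destruct (energy_divergence w y Hw ltac:(lra)) as (Eu & _ & _).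
        replace (Wy w y) with (- d1 u w y) by (unfold Wy; rewrite Eu; ring).
        unfold a2. destruct (energy_rho_bounds y ltac:(lra)) as [Hk _].
        assert (E : (- d1 u w y) ^ 2 = / Rmin 1 R0 * (Rmin 1 R0 * d1 u w y ^ 2)) by (field; lra).
        rewrite E.
        apply Rmult_le_compat_l; [lra|]. apply Rmult_le_compat_r; [apply pow2_ge_0|exact Hk].
Qed.

(** Of the four edges only the outer one survives: [X] vanishes at the inflow and is nonnegative at
    the outflow, and [Y] vanishes at the wall. *)
Lemma energy_rectangle N : R0 <= N ->
  / 2 * rint2 th R0 N a1 <=
  energy_K * th * (rint2 th R0 N a2 + rint2 th R0 N a4)
  + d * th * rint2 th R0 N a6 + rint2 th R0 N a7 + rint2 th R0 N a8
  + RInt (fun w => - Y w N) 0 th.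
Proof.
  intros HN.
  destruct energy_cont as (Crd & Crho & CX & CXw & CY & CYy & _ & _).
  destruct energy_density_cont as (A1 & A2 & A3 & A4 & A5 & A6 & A7 & A8 & A9).
  destruct (energy_poincare N HN) as (P3 & P5 & P9).
  assert (Hti : 0 < / th) by (apply Rinv_0_lt_compat; lra).
  set (k := energy_K1).
  assert (Hk : 0 <= k) by apply energy_K_nonneg.
  assert (Hm : 0 < Rmin 1 R0) by (apply Rmin_glb_lt; lra).
  assert (Hmi : 0 < / Rmin 1 R0) by now apply Rinv_0_lt_compat.
  assert (CL := cont_strip_lin R0).
  assert (Hle : rint2 th R0 N (fun w y => 1 * Xw w y + (/ 2 * a1 w y + Yy w y)) <=
    rint2 th R0 N (fun w y => k * th * a2 w y + (k * th * a4 w y + (k / th * a3 w y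
      + (k / th * a5 w y + (d * th * a6 w y + (1 * a7 w y + (th * C ^ 2 * a9 w y + a8 w y)))))))).
  { apply rint2_le; try assumption; try lra.
    - repeat (apply CL; [assumption|]). assumption.
    - repeat (apply CL; [assumption|]). assumption.
    - intros w y Hw Hy. assert (H := energy_pointwise w y Hw (proj1 Hy)). fold k in H.
      replace (k * (th * (a2 w y + a4 w y) + (a3 w y + a5 w y) / th)) with
        (k * th * a2 w y + (k * th * a4 w y + (k / th * a3 w y + k / th * a5 w y))) in H by (field; lra).
      lra. }
  rewrite !rint2_lin in Hle; try assumption; repeat (apply CL; [assumption|]); try assumption.
  assert (HX : 0 <= rint2 th R0 N Xw).
  { rewrite (rint2_dw th R0 N X Xw); try assumption.
    - rewrite (RInt_zero (X 0)), Rminus_0_r; [|exact HN|intros y Hy; now apply energy_X_sign].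
      apply RInt_ge_0; [exact HN|apply (cont_strip_ex_RInt R0); (assumption || lra)|].
      intros y Hy. now apply energy_X_sign.
    - intros w y Hy. now apply energy_X_derive. }
  assert (HY : rint2 th R0 N Yy = - RInt (fun w => - Y w N) 0 th).
  { rewrite (rint2_dy th R0 N Y Yy); try assumption.
    - rewrite (RInt_zero (fun w => Y w R0)), Rminus_0_r;
        [|lra|intros w Hw; apply energy_Y_wall; lra].
      assert (Hex : ex_RInt (fun w => Y w N) 0 th).
      { apply ex_RInt_cont. intros x _. now apply continuity_2d_pt_continuous1, CY. }
      assert (E := RInt_opp (V := R_CompleteNormedModule) (fun w => Y w N) 0 th Hex).
      change (RInt (fun w => - Y w N) 0 th = - RInt (fun w => Y w N) 0 th) in E. lra.
    - intros w y Hy. now apply energy_Y_derive. }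
  assert (H3 : k / th * rint2 th R0 N a3 <= 4 * k * th * rint2 th R0 N a2).
  { replace (4 * k * th * rint2 th R0 N a2) with (k / th * (4 * th ^ 2 * rint2 th R0 N a2)) by (field; lra).
    apply Rmult_le_compat_l; [apply Rmult_le_pos; lra|exact P3]. }
  assert (H5 : k / th * rint2 th R0 N a5 <= 4 * k * th * rint2 th R0 N a4).
  { replace (4 * k * th * rint2 th R0 N a4) with (k / th * (4 * th ^ 2 * rint2 th R0 N a4)) by (field; lra).
    apply Rmult_le_compat_l; [apply Rmult_le_pos; lra|exact P5]. }
  assert (HC2 : 0 <= th * C ^ 2) by (apply Rmult_le_pos; [lra|apply pow2_ge_0]).
  assert (H9 : th * C ^ 2 * rint2 th R0 N a9 <= 4 * C ^ 2 / Rmin 1 R0 * th * rint2 th R0 N a2).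
  { replace (4 * C ^ 2 / Rmin 1 R0 * th * rint2 th R0 N a2)
      with (th * C ^ 2 * (4 / Rmin 1 R0 * rint2 th R0 N a2)) by (field; lra).
    now apply Rmult_le_compat_l. }
  assert (H4 : 0 <= rint2 th R0 N a4).
  { apply rint2_nonneg; try assumption; try lra. intros w y _ _. unfold a4.
    apply Rmult_le_pos; [left; apply energy_rho_pos|apply pow2_ge_0]. }
  assert (H4' : 0 <= 4 * C ^ 2 / Rmin 1 R0 * th * rint2 th R0 N a4).
  { apply Rmult_le_pos; [|exact H4]. apply Rmult_le_pos; [|lra].
    apply Rmult_le_pos; [|lra]. apply Rmult_le_pos; [lra|apply pow2_ge_0]. }
  unfold energy_K. fold k. lra.
Qed.

(** [A] makes the flux small at suitable radii and then disappears. The integral of [a1] grows with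
    the rectangle, so its bound at a distant good radius also holds at the given one. *)
Lemma energy_limit (A B Pn F G : R) :
  (forall N, R0 <= N -> rint2 th R0 N a1 <= A) ->
  (forall N, R0 <= N -> rint2 th R0 N a2 + rint2 th R0 N a4 + rint2 th R0 N a5 <= B) ->
  (forall N, R0 <= N -> rint2 th R0 N a6 <= Pn) ->
  (forall N, R0 <= N -> rint2 th R0 N a7 <= F) ->
  (forall N, R0 <= N -> rint2 th R0 N a8 <= G) ->
  forall N, R0 <= N ->
  rint2 th R0 N a1 <= 2 * (energy_K * th * B + d * th * Pn + F + G).
Proof.
  intros HA HBn HPn HF HG N1 HN1.
  destruct energy_cont as (_ & _ & _ & _ & CY & _).
  destruct energy_density_cont as (A1 & A2 & A3 & A4 & A5 & A6 & A7 & A8 & A9).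
  assert (HiR : 0 < / R0) by now apply Rinv_0_lt_compat.
  assert (HCR : 0 <= C / R0) by (apply Rmult_le_pos; lra).
  assert (Hm : 0 < Rmin 1 R0) by (apply Rmin_glb_lt; lra).
  assert (Hmi : 0 < / Rmin 1 R0) by now apply Rinv_0_lt_compat.
  assert (CL := cont_strip_lin R0).
  assert (Hie : 0 < / e ^ 2) by (apply Rinv_0_lt_compat, pow_lt, He).
  assert (nn : forall h, (forall w y, R0 <= y -> 0 <= h w y) -> cont_strip R0 h ->
     forall N, R0 <= N -> 0 <= rint2 th R0 N h).
  { intros h Hh Ch N HN. apply rint2_nonneg; try assumption; try lra. intros; apply Hh; lra. }
  assert (sq : forall y x, 0 <= rho y * x ^ 2)
    by (intros; apply Rmult_le_pos; [left; apply energy_rho_pos|apply pow2_ge_0]).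
  assert (a1_nn : forall w y, R0 <= y -> 0 <= a1 w y).
  { intros w y Hy. unfold a1. rewrite Rmult_assoc. assert (Hr := energy_rd_ge y Hy).
    apply Rmult_le_pos; [lra|apply sq]. }
  assert (CD : cont_strip R0 D).
  { unfold D. repeat (apply CL; [assumption|]). intros w y Hy.
    now apply continuity_2d_pt_scal, A6. }
  set (ky := C + C / R0 + 1 + 2 / R0).
  assert (Hky : 0 < ky) by (unfold ky; lra).
  set (M := ky * (/ R0 * A + (B + (4 * th ^ 2 * B + (/ e ^ 2 * B + (/ e ^ 2 * B + Pn)))))).
  assert (HM : forall N, R0 < N -> ky * rint2 th R0 N D <= M).
  { intros N HN'. assert (HN : R0 <= N) by lra.
    unfold M. apply Rmult_le_compat_l; [lra|].
    assert (C6 : cont_strip R0 (fun w y => 1 * a6 w y)).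
    { intros w y Hy. now apply continuity_2d_pt_scal, A6. }
    unfold D. rewrite !rint2_lin, rint2_scal;
      try assumption; repeat (apply CL; [assumption|]); try assumption.
    destruct (energy_poincare N HN) as (P3 & _ & _).
    assert (n2 := nn a2 ltac:(intros; apply sq) A2 N HN).
    assert (n4 := nn a4 ltac:(intros; apply sq) A4 N HN).
    assert (n5 := nn a5 ltac:(intros; apply sq) A5 N HN).
    specialize (HBn N HN). specialize (HA N HN). specialize (HPn N HN).
    assert (/ R0 * rint2 th R0 N a1 <= / R0 * A) by (apply Rmult_le_compat_l; lra).
    assert (/ e ^ 2 * rint2 th R0 N a4 <= / e ^ 2 * B) by (apply Rmult_le_compat_l; lra).
    assert (/ e ^ 2 * rint2 th R0 N a5 <= / e ^ 2 * B) by (apply Rmult_le_compat_l; lra).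
    assert (4 * th ^ 2 * rint2 th R0 N a2 <= 4 * th ^ 2 * B)
      by (apply Rmult_le_compat_l; [apply Rmult_le_pos; [lra|apply pow2_ge_0]|lra]).
    lra. }
  apply le_epsilon. intros eta Heta.
  (* A flux of [eta / 2] is allowed because the energy inequality controls half of the integral of
     [a1]. *)
  destruct (small_boundary_flux (fun N => ky * rint2 th R0 N D)
    (fun N => ky * RInt (fun w => D w N) 0 th) R0 M (eta / 2) N1) as (N & HN & HN' & Hflux);
    try assumption; try lra.
  { intros N HN. apply is_derive_scal, is_derive_rint2; try assumption; lra. }
  assert (HN0 : R0 <= N) by lra.
  assert (Hmono : rint2 th R0 N1 a1 <= rint2 th R0 N a1).
  { apply rint2_mono; try assumption; try lra. intros; apply a1_nn; lra. }
  assert (HY : RInt (fun w => - Y w N) 0 th <= eta / 2).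
  { eapply Rle_trans; [|exact Hflux].
    assert (ED : ex_RInt (fun w => D w N) 0 th).
    { apply ex_RInt_cont. intros x _. now apply continuity_2d_pt_continuous1, CD. }
    replace (N * (ky * RInt (fun w => D w N) 0 th)) with (RInt (fun w => ky * N * D w N) 0 th).
    - apply RInt_le; try lra.
      + apply ex_RInt_cont. intros x _. apply (continuous_opp (V := R_NormedModule)).
        now apply continuity_2d_pt_continuous1, CY.
      + now apply (ex_RInt_scal (V := R_NormedModule)).
      + intros w Hw. now apply energy_flux_bound.
    - assert (E := RInt_scal (V := R_CompleteNormedModule) (fun w => D w N) 0 th (ky * N) ED).
      change (RInt (fun w => ky * N * D w N) 0 th = ky * N * RInt (fun w => D w N) 0 th) in E.
      assert (E' : ky * N * RInt (fun w => D w N) 0 th = N * (ky * RInt (fun w => D w N) 0 th)) by ring.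
      rewrite <- E'. exact E. }
  assert (HR := energy_rectangle N HN0).
  assert (n5 := nn a5 ltac:(intros; apply sq) A5 N HN0).
  specialize (HBn N HN0). specialize (HPn N HN0). specialize (HF N HN0). specialize (HG N HN0).
  assert (Hkk : 0 <= energy_K * th) by (apply Rmult_le_pos; [apply Rle_trans with energy_K1; apply energy_K_nonneg|lra]).
  assert (energy_K * th * (rint2 th R0 N a2 + rint2 th R0 N a4) <= energy_K * th * B)
    by (apply Rmult_le_compat_l; lra).
  assert (d * th * rint2 th R0 N a6 <= d * th * Pn)
    by (apply Rmult_le_compat_l; [apply Rmult_le_pos; lra|lra]).
  lra.
Qed.

Definition energy_constant := 2 * energy_K + 5 / R0 + 2.

Lemma energy_constant_pos : 0 < energy_constant.
Proof.
  assert (0 < / R0) by now apply Rinv_0_lt_compat. assert (HK := energy_K_nonneg).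
  unfold energy_constant. lra.
Qed.

Lemma energy_estimate :
  is_finite (normA2 R0 th eps d u) -> is_finite (normB2 R0 th eps d v) ->
  is_finite (normL2 R0 th eps d P) -> is_finite (normL2 R0 th eps (2 + d) f) ->
  is_finite (normL2 R0 th eps (2 + d) g) ->
  real (normA2 R0 th eps d u) <= energy_constant *
    (th * real (normB2 R0 th eps d v) + d * th * real (normL2 R0 th eps d P)
     + real (normL2 R0 th eps (2 + d) f) + eps * real (normL2 R0 th eps (2 + d) g)).
Proof.
  intros FA FB FP FF FG.
  destruct energy_class as (c1 & c2 & c3 & c4 & c5 & c6 & c7 & _).
  destruct energy_cont as (Crd & Crho & _ & _ & _ & _ & Cf & Cg).
  destruct energy_density_cont as (A1 & A2 & A3 & A4 & A5 & A6 & A7 & A8 & _).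
  assert (HiR : 0 < / R0) by now apply Rinv_0_lt_compat.
  assert (CL := cont_strip_lin R0).
  assert (sq : forall y x, 0 <= rho y * x ^ 2)
    by (intros; apply Rmult_le_pos; [left; apply energy_rho_pos|apply pow2_ge_0]).
  (* The part of the A-norm with the factor eps. It is at most [/ R0 * e ^ 2] times [a2 + a3];
     Poincare with [th <= 1] turns this sum into [1 + 4 = 5] times the B-norm, and [e ^ 2 <= th]
     gives the factor [th]. *)
  set (b := fun w y => e ^ 2 * (rho y / rd y) * (d1 u w y ^ 2 + u w y ^ 2)).
  assert (Cb : cont_strip R0 b).
  { intros w y Hy. assert (Hr := energy_rd_ge y Hy). unfold b. solve_cont2. lra. }
  assert (Hb : forall w y, R0 <= y -> 0 <= b w y <= / R0 * e ^ 2 * (a2 w y + a3 w y)).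
  { intros w y Hy. assert (Hr := energy_rd_ge y Hy). assert (Hk := energy_rho_pos y).
    assert (He2 : 0 <= e ^ 2) by apply pow2_ge_0.
    assert (Hs : 0 <= d1 u w y ^ 2 + u w y ^ 2) by (apply Rplus_le_le_0_compat; apply pow2_ge_0).
    assert (Hir : 0 < / rd y <= / R0)
      by (split; [apply Rinv_0_lt_compat; lra|apply Rinv_le_contravar; lra]).
    assert (Ht : 0 <= e ^ 2 * (rho y * (d1 u w y ^ 2 + u w y ^ 2)))
      by (apply Rmult_le_pos; [lra|apply Rmult_le_pos; lra]).
    replace (b w y) with (/ rd y * (e ^ 2 * (rho y * (d1 u w y ^ 2 + u w y ^ 2)))) by (unfold b; field; lra).
    replace (/ R0 * e ^ 2 * (a2 w y + a3 w y))
      with (/ R0 * (e ^ 2 * (rho y * (d1 u w y ^ 2 + u w y ^ 2)))) by (unfold a2, a3; ring).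
    split; [apply Rmult_le_pos; lra|apply Rmult_le_compat_r; lra]. }
  assert (a1_nn : forall w y, R0 <= y -> 0 <= a1 w y).
  { intros w y Hy. unfold a1. rewrite Rmult_assoc. assert (Hr := energy_rd_ge y Hy).
    apply Rmult_le_pos; [lra|apply sq]. }
  set (nA := normA2 R0 th eps d u) in *. set (nB := normB2 R0 th eps d v) in *.
  set (nP := normL2 R0 th eps d P) in *. set (nF := normL2 R0 th eps (2 + d) f) in *.
  set (nG := normL2 R0 th eps (2 + d) g) in *.
  assert (EA : forall w y, 0 < w < th -> R0 < y ->
    (let r := rad R0 eps y in d2 u w y ^ 2 * Rpower r (1 + d)
      + eps * d1 u w y ^ 2 * Rpower r (-1 + d) + eps * u w y ^ 2 * Rpower r (-1 + d))
    = 1 * a1 w y + b w y).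
  { intros w y Hw Hy. cbv zeta. change (rad R0 eps y) with (rd y).
    assert (Hr := energy_rd_ge y ltac:(lra)).
    destruct (energy_weights y ltac:(lra)) as (W1 & W2 & _). rewrite W1, W2, Ee2.
    unfold a1, b. field. lra. }
  assert (LA : forall N, R0 <= N -> rint2 th R0 N a1 <= real nA).
  { intros N HN. apply Rle_trans with (rint2 th R0 N (fun w y => 1 * a1 w y + b w y)).
    - apply rint2_le; try assumption; try lra; [now apply CL|].
      intros w y Hw Hy. destruct (Hb w y ltac:(lra)). lra.
    - apply (iint_rectangle_le R0 th _ _ N) with (4 := EA); try assumption; try lra; [now apply CL|].
      intros w y Hw Hy. destruct (Hb w y ltac:(lra)). specialize (a1_nn w y ltac:(lra)). lra. }
  assert (LB : forall N, R0 <= N ->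
    rint2 th R0 N a2 + rint2 th R0 N a4 + rint2 th R0 N a5 <= real nB).
  { intros N HN.
    assert (Hle : rint2 th R0 N (fun w y => 1 * a2 w y + (1 * a4 w y + a5 w y)) <= real nB).
    { apply (iint_rectangle_le R0 th); try assumption; try lra.
      - repeat (apply CL; [assumption|]). assumption.
      - intros w y Hw Hy. cbv zeta. change (rad R0 eps y) with (rd y).
        destruct (energy_divergence w y Hw Hy) as (Eu & _ & _).
        destruct (class_C_d2 _ _ (ls_v _ _ _ _ _ _ _ _ _ _ HL)) as [_ Dv2].
        assert (E : d2 (fun w' y' => rad R0 eps y' * v w' y') w y = - d1 u w y).
        { rewrite Eu, Ropp_involutive. apply is_derive_unique.
          change (is_derive (fun t => rd t * v w t) y (e * v w y + rd y * d2 v w y)).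
          assert (Dr := energy_rd_derive y). auto_derive.
          - split; [now exists e|]. split; [eexists; apply Dv2|exact I].
          - rewrite (is_derive_Derive _ _ _ (Dv2 w y)),
              (is_derive_Derive _ _ _ Dr). ring. }
        rewrite E, Ee2. fold (rd y). unfold a2, a4, a5. fold (rho y). ring.
      - intros w y Hw Hy. assert (H2 := sq y (d1 u w y)). assert (H4 := sq y (e * d1 v w y)).
        assert (H5 := sq y (e * v w y)). unfold a2, a4, a5. lra. }
    rewrite !rint2_lin in Hle; try assumption; try (now apply CL). lra. }
  assert (LP : forall N, R0 <= N -> rint2 th R0 N a6 <= real nP).
  { intros N HN. apply (iint_rectangle_le R0 th); try assumption; try lra.
    - intros w y Hw Hy. unfold a6, rho, rd. ring.
    - intros w y Hw Hy. apply sq. }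
  assert (LF : forall N, R0 <= N -> rint2 th R0 N a7 <= real nF).
  { intros N HN. apply (iint_rectangle_le R0 th); try assumption; try lra.
    - intros w y Hw Hy. destruct (energy_weights y ltac:(lra)) as (_ & _ & W3).
      change (rad R0 eps y) with (rd y). rewrite W3, (proj1 (energy_forces w y Hw Hy)). unfold a7. ring.
    - intros w y Hw Hy. apply sq. }
  assert (LG : forall N, R0 <= N -> rint2 th R0 N a8 <= eps * real nG).
  { intros N HN. set (h := fun w y => rho y * (rd y * ge w y) ^ 2).
    assert (Ch : cont_strip R0 h) by (intros w y Hy; unfold h; solve_cont2).
    apply Rle_trans with (rint2 th R0 N (fun w y => e ^ 2 * h w y)).
    - right. apply rint2_ext; try lra. intros w y _ _. unfold a8, h. ring.
    - rewrite rint2_scal, Ee2 by assumption. apply Rmult_le_compat_l; [apply pow2_ge_0|].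
      apply (iint_rectangle_le R0 th); try assumption; try lra.
      + intros w y Hw Hy. destruct (energy_weights y ltac:(lra)) as (_ & _ & W3).
        change (rad R0 eps y) with (rd y). rewrite W3, (proj2 (energy_forces w y Hw Hy)). unfold h. ring.
      + intros w y Hw Hy. apply sq. }
  assert (Hlim := energy_limit (real nA) (real nB) (real nP) (real nF) (eps * real nG) LA LB LP LF LG).
  assert (Hth2 : th ^ 2 <= 1).
  { replace (th ^ 2) with (th * th) by ring. apply Rle_trans with (1 * 1); [apply Rmult_le_compat; lra|lra]. }
  assert (nn : forall h, (forall w y, R0 <= y -> 0 <= h w y) -> cont_strip R0 h -> 0 <= rint2 th R0 R0 h).
  { intros h Hh Ch. apply rint2_nonneg; try assumption; try lra. intros; apply Hh; lra. }
  assert (GP : 0 <= real nP) by (eapply Rle_trans; [|apply (LP R0); lra]; apply nn; [intros; apply sq|exact A6]).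
  assert (GF : 0 <= real nF) by (eapply Rle_trans; [|apply (LF R0); lra]; apply nn; [intros; apply sq|exact A7]).
  assert (GG : 0 <= eps * real nG) by (eapply Rle_trans; [|apply (LG R0); lra]; apply nn; [intros; apply sq|exact A8]).
  assert (fin : real nA <= 2 * (energy_K * th * real nB + d * th * real nP + real nF + eps * real nG)
    + 5 / R0 * th * real nB).
  { apply (iint_le_bound R0 th) with (2 := EA); try assumption; try lra.
    intros N HN. rewrite rint2_lin by assumption.
    assert (HbN : rint2 th R0 N b <= 5 / R0 * th * real nB).
    { apply Rle_trans with (/ R0 * e ^ 2 * (rint2 th R0 N a2 + rint2 th R0 N a3)).
      - rewrite <- rint2_plus, <- rint2_scal; try assumption.
        + apply rint2_le; try assumption; try lra.
          * intros w y Hy. apply continuity_2d_pt_mult; [apply continuity_2d_pt_const|].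
            apply continuity_2d_pt_plus; [now apply A2|now apply A3].
          * intros w y Hw Hy. apply Hb. lra.
        + intros w y Hy. apply continuity_2d_pt_plus; [now apply A2|now apply A3].
      - destruct (energy_poincare N HN) as (P3 & _ & _). specialize (LB N HN).
        assert (n2 : 0 <= rint2 th R0 N a2) by (apply rint2_nonneg; try assumption; try lra; intros; apply sq).
        assert (n4 : 0 <= rint2 th R0 N a4) by (apply rint2_nonneg; try assumption; try lra; intros; apply sq).
        assert (n5 : 0 <= rint2 th R0 N a5) by (apply rint2_nonneg; try assumption; try lra; intros; apply sq).
        assert (n3 : rint2 th R0 N a3 <= 4 * rint2 th R0 N a2).
        { eapply Rle_trans; [exact P3|]. apply Rmult_le_compat_r; lra. }
        apply Rle_trans with (/ R0 * e ^ 2 * (5 * real nB)).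
        + apply Rmult_le_compat_l; [apply Rmult_le_pos; [lra|apply pow2_ge_0]|lra].
        + replace (5 / R0 * th * real nB) with (/ R0 * th * (5 * real nB)) by (field; lra).
          apply Rmult_le_compat_r; [lra|]. apply Rmult_le_compat_l; lra. }
    specialize (Hlim N HN). lra. }
  assert (Hkk : 0 <= energy_K) by (apply Rle_trans with energy_K1; apply energy_K_nonneg).
  assert (GB : 0 <= th * real nB).
  { apply Rmult_le_pos; [lra|]. eapply Rle_trans; [|apply (LB R0); lra].
    assert (0 <= rint2 th R0 R0 a2) by (apply nn; [intros; apply sq|exact A2]).
    assert (0 <= rint2 th R0 R0 a4) by (apply nn; [intros; apply sq|exact A4]).
    assert (0 <= rint2 th R0 R0 a5) by (apply nn; [intros; apply sq|exact A5]). lra. }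
  assert (GdP : 0 <= d * th * real nP) by (apply Rmult_le_pos; [apply Rmult_le_pos; lra|lra]).
  set (T := th * real nB + d * th * real nP + real nF + eps * real nG).
  assert (H5R : 0 <= 5 / R0) by (apply Rmult_le_pos; lra).
  assert (T1 : energy_K * (d * th * real nP + real nF + eps * real nG) >= 0)
    by (apply Rle_ge, Rmult_le_pos; lra).
  assert (T2 : 5 / R0 * (d * th * real nP + real nF + eps * real nG) >= 0)
    by (apply Rle_ge, Rmult_le_pos; lra).
  unfold energy_constant.  unfold T. lra.
Qed.

End Energy.

Theorem theorem1p11 (R0 ub thetabar : R) (ue0 ubar0 ub1 chi0 : R -> R)
    (up : R -> R -> R) (K a : nat -> R) (K1 : R)
    (Hdata : profile_data R0 ub ue0 ubar0 ub1 chi0)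
    (Hthetabar : 0 < thetabar)
    (Hprandtl : prandtl0 R0 ub thetabar ue0 ubar0 up)
    (Hvp0 : vpw R0 up 0 <> 0)
    (Ha : forall k, 0 < a k) :
  exists thetas c C : R, 0 < thetas /\ 0 < c /\ 0 < C /\
  forall (theta0 eps : R) (Vb0 Vb1 : R -> R) (ve : R -> R -> R),
    0 < theta0 <= thetas -> theta0 <= thetabar ->
    0 < eps <= 1 -> eps <= c * theta0 ->
    euler_side_data R0 theta0 up K a K1 Vb0 Vb1 ->
    euler1 R0 theta0 eps ue0 chi0 up Vb0 Vb1 ve ->
  forall (delta : R) (u v P f g : R -> R -> R),
    0 <= delta <= 1 ->
    linearized_system R0 theta0 eps
      (us R0 eps ue0 ub1 up ve) (vs R0 eps up ve) u v P f g ->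
    is_finite (normA2 R0 theta0 eps delta u) ->
    is_finite (normB2 R0 theta0 eps delta v) ->
    is_finite (normL2 R0 theta0 eps delta P) ->
    is_finite (normL2 R0 theta0 eps (2 + delta) f) ->
    is_finite (normL2 R0 theta0 eps (2 + delta) g) ->
    real (normA2 R0 theta0 eps delta u)
    <= C * (theta0 * real (normB2 R0 theta0 eps delta v)
            + delta * theta0 * real (normL2 R0 theta0 eps delta P)
            + real (normL2 R0 theta0 eps (2 + delta) f)
            + eps * real (normL2 R0 theta0 eps (2 + delta) g)).
Proof.
  assert (HR0 := pd_R0 _ _ _ _ _ _ Hdata).
  destruct (profile_bounds_uniform R0 ub thetabar ue0 ubar0 ub1 chi0 up K a Hdata Hprandtl Hvp0 Ha)
    as (ths & C & Hths & HC & Hprof).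
  (* The ratio 1 between [eps] and [theta0] suffices, since any further smallness of [eps] follows
     from [theta0 <= ths]. *)
  exists ths, 1, (energy_constant R0 C).
  split; [lra|]. split; [lra|]. split; [apply energy_constant_pos; lra|].
  intros theta0 eps Vb0 Vb1 ve Hth _ Heps Hepsth Hside Heuler delta u v P f g Hd HL FA FB FP FF FG.
  destruct (Hprof theta0 eps K1 Vb0 Vb1 ve Hth ltac:(lra) ltac:(lra) Hside Heuler)
    as (Usw & Q & Qy & L0 & Upy & Vw & Z & Zw & HB).
  assert (Esq : sqrt eps ^ 2 = eps) by (apply pow2_sqrt; lra).
  apply (energy_estimate R0 theta0 eps (sqrt eps) C delta (us R0 eps ue0 ub1 up ve) Usw
    (vs R0 eps up ve) Q Qy L0 Upy Vw Z Zw u v P f g); try assumption; try lra.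
  apply sqrt_lt_R0; lra.
Qed.
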